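(* Let $d\ge2$ and let $\Omega\subset\mathbb{R}^d$, $K\colon\mathbb{R}^d\to[0,+\infty)$ and $f\colon[0,+\infty)\to[0,+\infty)$ satisfy the standing assumptions (A1)–(A3) of the context, and assume in addition that $f''$ is bounded. Let $X$ and $\mathcal{E}_h$ be as in the context. Then a function $u\in X$ belongs to $H^2(\mathbb{R}^d)$ if and only if there exist $M>0$ and $\bar h>0$ such that $\mathcal{E}_h(u)\le M$ for all $h\in(0,\bar h)$.
   Context: Standing assumptions ($d\ge2$): (A1) $\Omega\subset\mathbb{R}^d$ is open and bounded with Lipschitz boundary. (A2) $K\colon\mathbb{R}^d\to[0,+\infty)$ is measurable, $K(z)=K(-z)$ for a.e. $z$, $\int_{\mathbb{R}^d}K(z)(1+|z|^2)\,dz<+\infty$, and there exist $r_0\ge0$, $r_1>0$ with $r_0<\sigma_d r_1$ and $\operatorname{ess\,inf}\{K(z): z\in B(0,r_1)\setminus B(0,r_0)\}>0$, where $\sigma_2=1$ and $\sigma_d=\frac{d-2}{d-1}$ for $d>2$. (A3) $f\colon[0,+\infty)\to[0,+\infty)$ is of class $C^2$, $f(0)=f'(0)=0$, and there is $\gamma>0$ with $f''(t)\ge\gamma$ for all $t\ge0$. Notation: $\hat z=z/|z|$ for $z\ne0$, $K_h(z)=h^{-d}K(z/h)$, $X=\{u\in H^1(\mathbb{R}^d): u=0\text{ a.e. in }\mathbb{R}^d\setminus\Omega\}$. For $u\in H^1(\mathbb{R}^d)$ and $h>0$, $$\mathcal{F}_h(u)=\int_{\mathbb{R}^d}\int_{\mathbb{R}^d}K_h(y-x)f\left(\frac{|u(y)-u(x)|}{|y-x|}\right)dy\,dx,\qquad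 \mathcal{F}_0(u)=\int_{\mathbb{R}^d}\int_{\mathbb{R}^d}K(z)f(|\nabla u(x)\cdot\hat z|)\,dz\,dx,$$ $$\mathcal{E}_h(u)=\frac{\mathcal{F}_0(u)-\mathcal{F}_h(u)}{h^2}.$$ (When $f''$ is bounded, $\mathcal F_0(u)$ and $\mathcal F_h(u)$ are finite for $u\in X$.) *)

(* Defs.v *)
From HB Require Import structures.
From mathcomp Require Import all_boot all_order all_algebra.
From mathcomp Require Import all_classical all_reals all_analysis ess_sup_inf.

Set Implicit Arguments.
Unset Strict Implicit.
Unset Printing Implicit Defensive.
Import Order.TTheory GRing.Theory Num.Theory.
Import numFieldNormedType.Exports.
Local Open Scope classical_set_scope.
Local Open Scope ring_scope.

(* Borel sets of R^n: the sigma-algebra generated by the coordinate maps. *)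
Definition rV_display : measure_display. Proof. exact: default_measure_display. Qed.

Section measurable_rV.
Variables (R : realType) (n : nat).

Let coor : 'I_n -> 'rV[R]_n -> R := fun i x => x ord0 i.

Let rV_set0 : g_sigma_preimage coor set0.
Proof. exact: sigma_algebra0. Qed.

Let rV_setC A : g_sigma_preimage coor A -> g_sigma_preimage coor (~` A).
Proof. exact: sigma_algebraC. Qed.

Let rV_bigcup (F : _^nat) : (forall i, g_sigma_preimage coor (F i)) ->
  g_sigma_preimage coor (\bigcup_i (F i)).
Proof. exact: sigma_algebra_bigcup. Qed.

HB.instance Definition _ := @isMeasurable.Build rV_display
  'rV[R]_n (g_sigma_preimage coor) rV_set0 rV_setC rV_bigcup.

End measurable_rV.

Lemma measurable_coor (R : realType) n (i : 'I_n) :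
  measurable_fun [set: 'rV[R]_n] (fun x => x ord0 i : R).
Proof.
move=> _ Y mY; rewrite setTI; apply: sub_sigma_algebra => /=.
rewrite -bigcup_seq/=; exists i => /=; first by rewrite mem_index_enum.
by exists Y => //; rewrite setTI.
Qed.

Lemma measurable_fun_coorP d (T : measurableType d) (R : realType) n
    (f : T -> 'rV[R]_n) :
  (forall i, measurable_fun [set: T] (fun t => f t ord0 i : R)) ->
  measurable_fun [set: T] f.
Proof.
move=> mf _ B mB; rewrite setTI.
pose G := [set B : set 'rV[R]_n | measurable (f @^-1` B)].
suff: g_sigma_preimage (fun i (x : 'rV[R]_n) => x ord0 i : R) `<=` G.
  by apply.
apply: smallest_sub.
  split=> [|A|F]; rewrite /G/=.
  - by rewrite preimage_set0.
  - by move=> mA; rewrite setTD preimage_setC; exact: measurableC.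
  - by move=> mF; rewrite preimage_bigcup; exact: bigcup_measurable.
rewrite -bigcup_seq; apply: bigcup_sub => i _ A [C mC <-].
by have := mf i measurableT C mC; rewrite /G/= !setTI.
Qed.

Section rV_cons.
Variables (R : realType) (n : nat).

Definition rV_cons (p : R * 'rV[R]_n) : 'rV[R]_n.+1 :=
  \row_i oapp (fun j => p.2 ord0 j) p.1 (unlift ord0 i).

Definition rV_uncons (x : 'rV[R]_n.+1) : R * 'rV[R]_n :=
  (x ord0 ord0, \row_i x ord0 (lift ord0 i)).

Lemma rV_consK : cancel rV_cons rV_uncons.
Proof.
move=> [a v]; congr pair; first by rewrite mxE unlift_none.
by apply/rowP => i; rewrite !mxE liftK.
Qed.

Lemma rV_unconsK : cancel rV_uncons rV_cons.
Proof.
by move=> x; apply/rowP => i; rewrite mxE; case: unliftP => [j|] -> //=; rewrite mxE.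
Qed.

Lemma measurable_rV_cons : measurable_fun [set: R * 'rV[R]_n] rV_cons.
Proof.
apply: measurable_fun_coorP => i.
case: (unliftP ord0 i) => [j|] ->.
  have -> : (fun p => rV_cons p ord0 (lift ord0 j) : R) =
      (fun x : 'rV[R]_n => x ord0 j : R) \o snd.
    by apply/funext => p; rewrite mxE liftK.
  by apply: measurableT_comp => //; exact: measurable_coor.
rewrite (_ : (fun p => _) = fst) //.
by apply/funext => p; rewrite mxE unlift_none.
Qed.

Lemma measurable_rV_uncons : measurable_fun [set: 'rV[R]_n.+1] rV_uncons.
Proof.
apply: measurable_fun_pair; first exact: measurable_coor.
apply: measurable_fun_coorP => i.
rewrite (_ : (fun x => _) = (fun x : 'rV[R]_n.+1 => x ord0 (lift ord0 i) : R)).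
  exact: measurable_coor.
by apply/funext => x; rewrite mxE.
Qed.

End rV_cons.

Section leb_step.
Variables (R : realType) (n : nat).
Variable mu : {sigma_finite_measure set 'rV[R]_n -> \bar R}.

Definition leb_step : set 'rV[R]_n.+1 -> \bar R :=
  pushforward (lebesgue_measure \x mu)%E (@rV_cons R n).

Let leb_step0 : leb_step set0 = 0%E.
Proof. by rewrite /leb_step /pushforward preimage_set0 measure0. Qed.

Let leb_step_ge0 A : (0 <= leb_step A)%E.
Proof. by rewrite /leb_step /pushforward; exact: measure_ge0. Qed.

Let leb_step_sigma_additive : semi_sigma_additive leb_step.
Proof.
move=> F mF tF mUF; rewrite /leb_step /pushforward preimage_bigcup.
have mcons A : measurable A -> measurable (@rV_cons R n @^-1` A).
  by move=> mA; rewrite -[X in measurable X]setTI; exact: measurable_rV_cons.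
apply: measure_semi_sigma_additive.
- by move=> k; exact: mcons.
- apply/trivIsetP => i j _ _ ij; rewrite -preimage_setI.
  by move/trivIsetP : tF => /(_ _ _ _ _ ij) ->//; rewrite preimage_set0.
- by rewrite -preimage_bigcup; exact: mcons.
Qed.

HB.instance Definition _ := isMeasure.Build _ _ _ leb_step
  leb_step0 leb_step_ge0 leb_step_sigma_additive.

Let leb_step_sigma_finite : sigma_finite setT leb_step.
Proof.
have /sigma_finiteP[F [TF ndF Foo]] := sigma_finiteT (@lebesgue_measure R).
have /sigma_finiteP[G [TG ndG Goo]] := sigma_finiteT mu.
exists (fun k => @rV_uncons R n @^-1` (F k `*` G k)) => [|k].
  rewrite -preimage_bigcup; apply/seteqP; split => // x _ /=.
  have [i _ Fi] : (\bigcup_k F k) (rV_uncons x).1 by rewrite -TF.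
  have [j _ Gj] : (\bigcup_k G k) (rV_uncons x).2 by rewrite -TG.
  exists (maxn i j) => //; split.
    by have /subsetPset := ndF _ _ (leq_maxl i j); apply.
  by have /subsetPset := ndG _ _ (leq_maxr i j); apply.
have [mF Fk] := Foo k; have [mG Gk] := Goo k; split.
  rewrite -[X in measurable X]setTI; apply: measurable_rV_uncons => //.
  exact: measurableX.
rewrite /leb_step /pushforward -comp_preimage.
rewrite (_ : _ \o _ = id); last by apply/funext => p; rewrite /= rV_consK.
by rewrite preimage_id product_measure1E// lte_mul_pinfty// ge0_fin_numE.
Qed.

HB.instance Definition _ := Measure_isSigmaFinite.Build _ _ _ leb_step
  leb_step_sigma_finite.

End leb_step.

(* Lebesgue measure on the Borel sets of R^n, as the n-fold product of the
   one-dimensional measure. *)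
Fixpoint lebn (R : realType) (n : nat) :
    {sigma_finite_measure set 'rV[R]_n -> \bar R} :=
  match n with
  | 0 => dirac (0 : 'rV[R]_0)
  | m.+1 => leb_step (lebn R m)
  end.

Definition rV_box (R : realType) (n : nat) (a b : 'rV[R]_n) : set 'rV[R]_n :=
  [set x | forall i, x ord0 i \in `[a ord0 i, b ord0 i]].

Lemma lebn_box (R : realType) (n : nat) (a b : 'rV[R]_n) :
  (forall i, a ord0 i <= b ord0 i) ->
  lebn R n (rV_box a b) = (\prod_(i < n) (b ord0 i - a ord0 i))%:E.
Proof.
elim: n a b => [|n IH] a b ab.
  rewrite big_ord0 /= diracE mem_set//= => -[].
  by [].
pose a' := (rV_uncons a).2; pose b' := (rV_uncons b).2.
have boxE : @rV_cons R n @^-1` rV_box a b =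
    `[a ord0 ord0, b ord0 ord0]%classic `*` rV_box a' b'.
  apply/seteqP; split => [[x v] /= h|[x v] /= [hx hv] i].
    split; first by have := h ord0; rewrite mxE unlift_none.
    by move=> i; have := h (lift ord0 i); rewrite !mxE liftK.
  rewrite mxE; case: unliftP => [j|] -> //=.
  by have := hv j; rewrite !mxE.
transitivity ((lebesgue_measure \x lebn R n)%E
    (`[a ord0 ord0, b ord0 ord0]%classic `*` rV_box a' b')).
  by rewrite -boxE.
rewrite product_measure1E //=.
  rewrite IH => [|i]; last by rewrite !mxE.
  rewrite lebesgue_measure_itv/= lte_fin big_ord_recl.
  under eq_bigr do rewrite !mxE.
  have [_|ba] := ltP (a ord0 ord0); first by rewrite -EFinB -EFinM.
  by rewrite (le_anti (introT andP (conj ba (ab ord0)))) subrr mul0r mul0e.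
rewrite (_ : rV_box a' b' = \bigcap_(i in [set: 'I_n])
    ((fun x : 'rV[R]_n => x ord0 i : R) @^-1` `[a' ord0 i, b' ord0 i])).
  apply: fin_bigcap_measurable => // i _.
  rewrite -[X in measurable X]setTI.
  by apply: (measurable_coor i) => //; exact: measurable_itv.
by apply/seteqP; split => x h i; [move=> _|]; exact: h.
Qed.

Section euclidean.
Variables (R : realType) (d : nat).
Implicit Types x y : 'rV[R]_d.

Definition dotp x y : R := \sum_(i < d) x ord0 i * y ord0 i.

(* The library norm `|x| of a row vector is the sup norm. *)
Definition enorm x : R := Num.sqrt (dotp x x).

(* z / |z|, with value 0 at z = 0. *)
Definition direction x : 'rV[R]_d := (enorm x)^-1 *: x.

End euclidean.

Section sobolev.
Variables (R : realType) (d : nat).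
Implicit Types u v phi : 'rV[R]_d -> R.

Local Notation mu := (lebn R d).

(* Lebesgue measurability, i.e. measurability for the completed measure. As
   [\int] is a supremum over Borel simple functions, it still gives the Lebesgue
   integral of the Lebesgue measurable functions. *)
Definition lebesgue_measurable u :=
  exists2 v, measurable_fun [set: 'rV[R]_d] v & u = v %[ae mu].

Definition L2 u := exists2 v, v \in Lfun mu 2%:E & u = v %[ae mu].

Definition partial (i : 'I_d) (phi : 'rV[R]_d -> R^o) : 'rV[R]_d -> R^o :=
  'D_(delta_mx ord0 i) phi.

(* A sequence of coordinates [:: i1; .. ; ik] stands for the multi-index
   e_i1 + .. + e_ik. *)
Definition partials (s : seq 'I_d) (phi : 'rV[R]_d -> R^o) : 'rV[R]_d -> R^o :=
  foldr partial phi s.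

Definition smooth (phi : 'rV[R]_d -> R^o) := forall s : seq 'I_d,
  continuous (partials s phi) /\
  forall i x, derivable (partials s phi) x (delta_mx ord0 i).

Definition test_function (phi : 'rV[R]_d -> R^o) :=
  smooth phi /\ compact (closure [set x | phi x != 0]).

Definition weak_partials (s : seq 'I_d) u v := forall phi, test_function phi ->
  (\int[mu]_x (u x * partials s phi x)%:E =
   ((-1) ^+ size s)%:E * \int[mu]_x (v x * phi x)%:E)%E.

(* The space H^k(R^d). *)
Definition sobolev (k : nat) u :=
  L2 u /\ forall s, (size s <= k)%N -> exists2 v, L2 v & weak_partials s u v.

(* A representative of the weak gradient; it is unique almost everywhere. *)
Definition weak_gradient u (x : 'rV[R]_d) : 'rV[R]_d :=
  \row_i xget (fun=> 0) [set v | L2 v /\ weak_partials [:: i] u v] x.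

End sobolev.

(* Near every boundary point the open set Omega is, up to a rotation, the strict
   epigraph of a Lipschitz function. The vertical direction is the Euclidean
   unit vector e, and g is only evaluated on the hyperplane orthogonal to e: a
   Lipschitz function on that hyperplane extends to the whole space, so g may be
   taken total. Being Lipschitz does not depend on the choice of the norm. *)
Definition lipschitz_boundary (R : realType) (d : nat) (Omega : set 'rV[R]_d) :=
  forall x0 : 'rV[R]_d, (closure Omega `\` interior Omega) x0 ->
  exists (e : 'rV[R]_d) (g : 'rV[R]_d -> R^o) (r : R),
    [/\ enorm e = 1, lipschitz g, 0 < r &
      forall x : 'rV[R]_d, enorm (x - x0) < r ->
        (Omega x <-> g (x - dotp x e *: e) < dotp x e)].

Definition bounded_lipschitz_domain (R : realType) (d : nat)
    (Omega : set 'rV[R]_d) :=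
  [/\ open Omega, bounded_set Omega & lipschitz_boundary Omega].

Definition sigma_const (R : realType) (d : nat) : R :=
  if d == 2%N then 1 else d.-2%:R / d.-1%:R.

Definition admissible_kernel (R : realType) (d : nat) (K : 'rV[R]_d -> R) :=
  [/\ forall z, 0 <= K z,
      lebesgue_measurable K,
      {ae lebn R d, forall z, K z = K (- z)},
      (\int[lebn R d]_z (K z * (1 + enorm z ^+ 2))%:E < +oo)%E &
      exists r0 r1 : R, [/\ 0 <= r0, 0 < r1, r0 < sigma_const R d * r1 &
        (0 < ess_inf (lebn R d)
               (fun z => if (r0 <= enorm z < r1)%R then (K z)%:E else +oo))%E]].

Section half_line.
Variable R : realType.
Implicit Type f : R -> R.

(* Functions on [0, +oo[ are total functions whose values at negative reals
   are never used; derivatives are taken within [0, +oo[, hence one-sided at 0. *)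
Definition quotient_filter f (t : R) :=
  (fun s => (f s - f t) / (s - t)) @ within `[0, +oo[%classic t^'.

Definition derivable_half f (t : R) := cvg (quotient_filter f t).

Definition derive_half f (t : R) : R := lim (quotient_filter f t).

Definition C2_half f :=
  [/\ forall t : R, 0 <= t -> derivable_half f t,
      forall t : R, 0 <= t -> derivable_half (derive_half f) t &
      {within `[0, +oo[%classic, continuous (derive_half (derive_half f))}].

Definition admissible_integrand f :=
  [/\ forall t : R, 0 <= t -> 0 <= f t,
      C2_half f,
      f 0 = 0,
      derive_half f 0 = 0 &
      exists2 gamma : R, 0 < gamma &
        forall t : R, 0 <= t -> gamma <= derive_half (derive_half f) t].

Definition bounded_second_derivative f :=
  exists C : R, forall t : R, 0 <= t -> `|derive_half (derive_half f) t| <= C.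

End half_line.

Section energies.
Variables (R : realType) (d : nat).
Variables (Omega : set 'rV[R]_d) (K : 'rV[R]_d -> R) (f : R -> R).
Implicit Type u : 'rV[R]_d -> R.

Local Notation mu := (lebn R d).

Definition X_space u := sobolev 1 u /\ {ae mu, forall x, ~ Omega x -> u x = 0}.

Definition rescaled_kernel (h : R) (z : 'rV[R]_d) : R :=
  h ^- d * K (h^-1 *: z).

Definition F_nonlocal (h : R) u : \bar R :=
  (\int[mu]_x \int[mu]_y
    (rescaled_kernel h (y - x) * f (`|u y - u x| / enorm (y - x)))%:E)%E.

Definition F_local u : \bar R :=
  (\int[mu]_x \int[mu]_z
    (K z * f `|dotp (weak_gradient u x) (direction z)|)%:E)%E.

(* Finite energies are the intended case; +oo - +oo is -oo in \bar R. *)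
Definition rate_functional (h : R) u : \bar R :=
  ((F_local u - F_nonlocal h u) * (h ^- 2)%:E)%E.

End energies.

(* Main.v *)
(* Strong convexity of f and boundedness of f'' control the gap in Jensen's
   inequality from both sides, so F_0(u) - F_h(u) is comparable to
   Q(h) = \int K(z) dev(h, z) dz, where dev(h, z) is the squared L2 deviation of
   the directional derivative of u along the segments [x, x + h z] from its mean,
   the difference quotient of u.

   If u is in H^2, then dev(h, z) = O(h^2 |z|^2), hence Q(h) = O(h^2).

   Conversely, if Q(h) = O(h^2), Fatou's lemma shows that for almost every z in
   the annulus where K is bounded below, dev(h_n, z) = O(h_n^2) for infinitely
   many terms of a fixed sequence h_n -> 0. For such a z the map
   phi |-> \int (grad u . z) (grad phi . z) is bounded in L2. It is quadratic in
   z, and four such z can be found at the vertices z, z + eps e_i, z + eps e_j,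
   z + eps e_i + eps e_j of a small parallelogram; polarization bounds
   phi |-> \int u d_i d_j phi, and the Riesz theorem gives the weak second
   derivatives. *)

Require Import Defs.
From HB Require Import structures.
From mathcomp Require Import all_boot all_order all_algebra.
From mathcomp Require Import all_classical all_reals all_analysis.
From mathcomp Require Import ess_sup_inf measurable_realfun.
From mathcomp Require Import ring lra.

Set Implicit Arguments.
Unset Strict Implicit.
Unset Printing Implicit Defensive.
Import Order.TTheory GRing.Theory Num.Theory.
Import numFieldNormedType.Exports.
Local Open Scope classical_set_scope.
Local Open Scope ring_scope.

(** The difference quotient of u over [x, x + h z] is, for almost every x, the mean over t in [0, 1]
    of grad u (x + t h z) . direction z, and for each t the shift by t h z preserves Lebesgue
    measure. The local energy is thus unchanged when its integrand is averaged over the segment, and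
    the two energies differ by a pointwise Jensen gap. As f lives on a half line, the Taylor bounds
    behind this gap are taken for the even function f |t|, twice differentiable on the whole line
    because f' vanishes at 0.

    The obstacle in the converse is that dev controls only a mean over t, while a derivative of w =
    grad u . direction z calls for two definite translates. Chebyshev supplies levels t <= 1/4 and s
    >= 3/4 at which w (x + t h z) and w (x + s h z) are both O(h)-close in L2 to the difference
    quotient of u; as s - t >= 1/2, the quotient of w between them stays bounded in L2. The levels
    depend on h, so the convergence of the transposed quotients of a test function must be uniform
    in t and s. *)

(** * Integrals of functions known only almost everywhere *)

Section ae_integral.
Context d (T : measurableType d) (R : realType) (mu : {measure set T -> \bar R}).
Local Open Scope ereal_scope.
Import HBNNSimple.

(* No measurability is required: the integral is a supremum over simple functions. *)
Lemma ge0_ae_le_integral_nonmeas (f g : T -> \bar R) :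
  (forall x, 0 <= f x) -> (forall x, 0 <= g x) ->
  {ae mu, forall x, f x <= g x} -> \int[mu]_x f x <= \int[mu]_x g x.
Proof.
move=> f0 g0 [N [mN N0 fgN]].
rewrite !ge0_integralTE//; apply: ge_ereal_sup => _ [h/= hf <-].
have mNc : measurable (~` N) by exact: measurableC.
pose h' := proj_nnsfun h mNc.
apply: ereal_sup_ubound; exists h' => /= [x|].
  rewrite /h' /= mindicE; have [xN|xN] := boolP (x \in ~` N).
    rewrite mulr1 (le_trans (hf x))//.
    apply: contrapT => /negP fg; rewrite inE in xN; apply: xN.
    by apply: fgN => /=; exact/negP.
  by rewrite mulr0.
rewrite -!integralT_nnsfun; apply: ge0_ae_eq_integral => //.
- by apply/measurable_EFinP; exact: measurable_funP.
- by apply/measurable_EFinP; exact: measurable_funP.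
- by move=> x _; rewrite lee_fin.
- by move=> x _; rewrite lee_fin.
exists N; split => // x /= hh; apply: contrapT => xN; apply: hh => _.
by rewrite /h' /= mindicE mem_set// mulr1.
Qed.

(** [u], [K] and [weak_gradient u] are Borel only up to null sets; this allows Borel representatives
    to be substituted for them under the integral sign. *)
Lemma ge0_ae_eq_integral_nonmeas (f g : T -> \bar R) :
  (forall x, 0 <= f x) -> (forall x, 0 <= g x) ->
  {ae mu, forall x, f x = g x} -> \int[mu]_x f x = \int[mu]_x g x.
Proof.
move=> f0 g0 fg; apply/eqP; rewrite eq_le !ge0_ae_le_integral_nonmeas//.
  by apply: filterS fg => x ->.
by apply: filterS fg => x ->.
Qed.

Lemma ae_eq_integral_nonmeas (f g : T -> \bar R) :
  {ae mu, forall x, f x = g x} -> \int[mu]_x f x = \int[mu]_x g x.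
Proof.
move=> fg; rewrite integralE [RHS]integralE.
congr (_ - _); apply: ge0_ae_eq_integral_nonmeas => //;
  by apply: filterS fg => x; rewrite ?funeposE ?funenegE => ->.
Qed.

End ae_integral.

(** * Borel sets of row vectors and uniqueness of measures *)

Section borel_boxes.
Variables (R : realType) (n : nat).
Local Notation V := 'rV[R]_n.

Definition boxes : set (set V) := [set rV_box p.1 p.2 | p in [set: V * V]].

Lemma measurable_rV_box (a b : V) : measurable (rV_box a b).
Proof.
rewrite (_ : rV_box a b = \bigcap_(i in [set: 'I_n])
    ((fun x : V => x ord0 i : R) @^-1` `[a ord0 i, b ord0 i])).
  apply: fin_bigcap_measurable => // i _.
  rewrite -[X in measurable X]setTI.
  by apply: (measurable_coor i) => //; exact: measurable_itv.
by apply/seteqP; split => x h i; [move=> _|]; exact: h.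
Qed.

Lemma setI_closed_boxes : setI_closed boxes.
Proof.
move=> _ _ [[a b] _ <-] [[a' b'] _ <-] /=.
exists (\row_i Num.max (a ord0 i) (a' ord0 i),
        \row_i Num.min (b ord0 i) (b' ord0 i)) => //=.
apply/seteqP; split=> x /=.
  move=> H; split => i; have := H i; rewrite !mxE !in_itv/= ge_max le_min.
    by move=> /andP[/andP[-> _] /andP[-> _]].
  by move=> /andP[/andP[_ ->] /andP[_ ->]].
move=> [H1 H2] i; have := H1 i; have := H2 i.
by rewrite !mxE !in_itv/= ge_max le_min => /andP[-> ->] /andP[-> ->].
Qed.

Definition cube (k : nat) : set V := rV_box (const_mx (- k%:R)) (const_mx k%:R).

Lemma cube_boxes k : boxes (cube k). Proof. by eexists (_, _). Qed.

Lemma cubeP k (x : V) : cube k x <-> forall i, `|x ord0 i| <= k%:R.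
Proof.
split => H i; have := H i; first by rewrite !mxE in_itv/= ler_norml.
by rewrite !mxE in_itv/= ler_norml.
Qed.

Lemma mem_cube (x : V) : exists k, cube k x.
Proof.
exists (\max_i (Num.bound `|x ord0 i|)); apply/cubeP => i.
rewrite (le_trans (ltW (archi_boundP _)))// ler_nat.
exact: (leq_bigmax_cond (F := fun i => Num.bound `|x ord0 i|)).
Qed.

Lemma cube_cover : \bigcup_k cube k = [set: V].
Proof. by apply/seteqP; split => // x _; have [k kx] := mem_cube x; exists k. Qed.

(** The half-spaces r <= x_i generate the Borel sets, and each is a countable union of boxes whose
    other faces recede to infinity. *)
Lemma measurable_boxesE : @measurable _ V = <<s boxes >>.
Proof.
apply/seteqP; split; last first.
  apply: smallest_sub; first exact: sigma_algebra_measurable.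
  by move=> _ [[a b] _ <-]; exact: measurable_rV_box.
apply: smallest_sub; first exact: smallest_sigma_algebra.
rewrite -bigcup_seq; apply: bigcup_sub => i _ A [C mC <-]; rewrite setTI.
pose coor (x : V) : R := x ord0 i.
pose GT := g_sigma_algebraType boxes.
suff : measurable_fun [set: GT] (coor : GT -> R).
  by move=> /(_ measurableT C mC); rewrite setTI.
apply: (measurability _ (RGenCInfty.measurableE R)) => _ [_ [r ->] <-].
rewrite setTI (_ : coor @^-1` _ = \bigcup_k rV_box
    (\row_j if j == i then r else - k%:R) (const_mx k%:R)).
  apply: bigcupT_measurable => k; apply: sub_sigma_algebra.
  by eexists (_, _).
apply/seteqP; split => x /=.
  rewrite in_itv/= andbT => rx; have [k /cubeP kx] := mem_cube x.
  exists k => // j; rewrite !mxE in_itv/=.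
  have := kx j; rewrite ler_norml => /andP[h1 ->]; rewrite andbT.
  by case: eqP => // ->.
by move=> [k _ /(_ i)]; rewrite !mxE eqxx !in_itv/= andbT => /andP[].
Qed.

Lemma cube_lty k : (lebn R n (cube k) < +oo)%E.
Proof.
rewrite lebn_box ?ltry// => i; rewrite !mxE.
by rewrite ge0_cp// ler0n.
Qed.

(** Boxes are stable under intersection and generate the Borel sets, and the cubes exhaust the space
    with finite measure, so the uniqueness theorem for measures applies. *)
Lemma rV_measure_unique (m1 m2 : {measure set V -> \bar R}) :
  (forall a b, m1 (rV_box a b) = m2 (rV_box a b)) ->
  (forall k, (m1 (cube k) < +oo)%E) ->
  forall A, measurable A -> m1 A = m2 A.
Proof.
move=> m12 m1oo A mA.
apply: (measure_unique boxes cube measurable_boxesE setI_closed_boxes cube_boxes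
  cube_cover) => //.
by move=> _ [[a b] _ <-]; exact: m12.
Qed.

End borel_boxes.

Section rV_measurability.
Variables (R : realType) (n : nat).
Local Notation V := 'rV[R]_n.

(** The Borel sets are generated here by the coordinates, not by the open sets. An open set is the
    countable union of the boxes with rational corners that it contains. *)
Lemma measurable_rV_open (U : set V) : open U -> measurable U.
Proof.
move=> oU.
pose B (p : 'rV[rat]_n * 'rV[rat]_n) : set V :=
  rV_box (map_mx ratr p.1) (map_mx ratr p.2).
pose B' p := if `[< B p `<=` U >] then B p else set0.
rewrite (_ : U = \bigcup_p B' p).
  apply: countable_bigcupT_measurable => [|p].
    exact: countableP.
  by rewrite /B'; case: ifP => // _; exact: measurable_rV_box.
apply/seteqP; split => x; last first.
  by move=> [p _]; rewrite /B'; case: asboolP => // + Bpx; exact.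
move=> Ux.
have /nbhs_ballP[e /= e0 xeU] : nbhs x U by exact: open_nbhs_nbhs.
have ex i : {q : rat * rat | x ord0 i - e < ratr q.1 < x ord0 i /\
    x ord0 i < ratr q.2 < x ord0 i + e}.
  apply: cid.
  have /rat_in_itvoo[p /[!in_itv]/= hp] : x ord0 i - e < x ord0 i by rewrite ltrBlDr ltrDl.
  have /rat_in_itvoo[q /[!in_itv]/= hq] : x ord0 i < x ord0 i + e by rewrite ltrDl.
  by exists (p, q).
pose p : 'rV[rat]_n := \row_i (sval (ex i)).1.
pose q : 'rV[rat]_n := \row_i (sval (ex i)).2.
exists (p, q) => //; rewrite /B' asboolT.
  move=> i; rewrite !mxE in_itv/=.
  have [/andP[_ /ltW ->] /andP[/ltW -> _]] := svalP (ex i); exact: isT.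
move=> y By; apply: xeU; split => // i j; rewrite ord1.
have := By j; rewrite !mxE in_itv/=.
have [/andP[h1 h2] /andP[h3 h4]] := svalP (ex j).
move=> /andP[h5 h6]; rewrite /ball/= ltr_norml; apply/andP; split; lra.
Qed.

Lemma measurable_continuous_rV (f : V -> R^o) :
  continuous f -> measurable_fun [set: V] (f : V -> R).
Proof.
move=> /continuousP cf.
apply: (measurability _ (RGenOpens.measurableE R)) => _ [_ [a [b ->]] <-].
by rewrite setTI; apply: measurable_rV_open; apply: cf; exact: interval_open.
Qed.

Lemma measurable_invr : measurable_fun [set: R] (GRing.inv : R -> R).
Proof.
rewrite -(setUv [set (0 : R)]); apply/measurable_funU => //.
  exact: measurableC.
split; first exact: measurable_fun_set1.
apply: open_continuous_measurable_fun.
  by rewrite openC; exact: closed_eq.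
by move=> x /[!inE]/= /eqP x0; exact: inv_continuous.
Qed.

Context d (T : measurableType d).
Implicit Types (f g : T -> V) (c : T -> R).

Lemma measurable_rV_coor f (i : 'I_n) : measurable_fun [set: T] f ->
  measurable_fun [set: T] (fun t => f t ord0 i : R).
Proof. by move=> mf; apply: (measurableT_comp (measurable_coor i) mf). Qed.

Lemma measurable_rV_add f g : measurable_fun [set: T] f ->
  measurable_fun [set: T] g -> measurable_fun [set: T] (fun t => f t + g t).
Proof.
move=> mf mg; apply: measurable_fun_coorP => i.
rewrite (_ : (fun t => _) = (fun t => f t ord0 i + g t ord0 i :> R)).
  by apply: measurable_funD; exact: measurable_rV_coor.
by apply/funext => t; rewrite mxE.
Qed.

Lemma measurable_rV_scale c f : measurable_fun [set: T] c ->
  measurable_fun [set: T] f -> measurable_fun [set: T] (fun t => c t *: f t).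
Proof.
move=> mc mf; apply: measurable_fun_coorP => i.
rewrite (_ : (fun t => _) = (fun t => c t * f t ord0 i :> R)).
  by apply: measurable_funM => //; exact: measurable_rV_coor.
by apply/funext => t; rewrite mxE.
Qed.

Lemma measurable_dotp f g : measurable_fun [set: T] f ->
  measurable_fun [set: T] g -> measurable_fun [set: T] (fun t => dotp (f t) (g t)).
Proof.
move=> mf mg; apply: measurable_sum => i.
by apply: measurable_funM; exact: measurable_rV_coor.
Qed.

Lemma measurable_enorm f : measurable_fun [set: T] f ->
  measurable_fun [set: T] (fun t => enorm (f t)).
Proof.
move=> mf; have ms : measurable_fun [set: R] (Num.sqrt : R -> R).
  by apply: continuous_measurable_fun; exact: sqrt_continuous.
exact: (measurableT_comp ms (measurable_dotp mf mf)).
Qed.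

Lemma measurable_direction f : measurable_fun [set: T] f ->
  measurable_fun [set: T] (fun t => direction (f t)).
Proof.
move=> mf; apply: measurable_rV_scale => //.
have := measurableT_comp measurable_invr (measurable_enorm mf); exact.
Qed.

End rV_measurability.

(** * Affine changes of variables *)

Section change_of_variables.
Variables (R : realType) (n : nat).
Local Notation V := 'rV[R]_n.
Local Notation mu := (lebn R n).

Lemma lebn_box0 (a b : V) (i : 'I_n) : b ord0 i < a ord0 i -> rV_box a b = set0.
Proof.
move=> ba; rewrite -subset0 => x /(_ i); rewrite in_itv/= => /andP[ax xb].
by have := le_lt_trans (le_trans ax xb) ba; rewrite ltxx.
Qed.

Section affine.
Variables (c : R) (a : V).
Hypothesis c0 : 0 < c.

Definition affine (x : V) : V := c *: x + a.

Lemma measurable_affine : measurable_fun [set: V] affine.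
Proof.
apply: measurable_rV_add => //; apply: measurable_rV_scale => //.
Qed.

(** Pushforward and rescaling are measures that agree on boxes. A box with reversed edges is empty
    and is treated apart, since [lebn_box] wants ordered edges. *)
Lemma lebn_affine (A : set V) : measurable A ->
  mu (affine @^-1` A) = ((c ^- n)%:E * mu A)%E.
Proof.
move=> mA.
have cn0 : 0 <= c ^- n by rewrite invr_ge0 exprn_ge0// ltW.
pose pf : {measure set V -> \bar R} := pushforward mu affine.
pose m1 := pf measurable_affine.
pose m2 : {measure set V -> \bar R} := mscale (NngNum cn0) mu.
have m12 p q : m1 (rV_box p q) = m2 (rV_box p q).
  have [pq|/existsNP[i /negP]] := pselect (forall i, p ord0 i <= q ord0 i); last first.
    by rewrite -ltNge => /lebn_box0 ->; rewrite !measure0.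
  rewrite /m1 /m2 /= /mscale/= /pushforward.
  rewrite (_ : affine @^-1` _ = rV_box (c^-1 *: (p - a)) (c^-1 *: (q - a))).
    rewrite !lebn_box//; last first.
      by move=> i; rewrite !mxE ler_pM2l ?invr_gt0// lerD2r pq.
    rewrite -EFinM; congr EFin.
    have -> : c ^- n = \prod_(i < n) c^-1 by rewrite prodr_const card_ord exprVn.
    rewrite -big_split/=.
    by apply: eq_bigr => i _; rewrite !mxE -mulrBr; congr (_ * _); ring.
  apply/seteqP; split => x H i; have := H i; rewrite /affine !mxE !in_itv/=.
    by rewrite ler_pdivrMl// ler_pdivlMl// lerBlDr lerBrDr.
  by rewrite ler_pdivrMl// ler_pdivlMl// lerBlDr lerBrDr.
apply: (rV_measure_unique (m1 := m1) (m2 := m2)) => // k.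
rewrite m12 /m2/= /mscale/= lte_mul_pinfty// ?lee_fin//.
exact: cube_lty.
Qed.

Lemma ge0_integral_affine (f : V -> \bar R) : measurable_fun [set: V] f ->
  (forall x, 0 <= f x)%E ->
  (\int[mu]_x f (c *: x + a)%R = (c ^- n)%:E * \int[mu]_x f x)%E.
Proof.
move=> mf f0.
have cn0 : 0 <= c ^- n by rewrite invr_ge0 exprn_ge0// ltW.
rewrite -[X in (X%:E * _)%E]/((NngNum cn0)%:num) -ge0_integral_mscale//.
rewrite -[LHS](ge0_integral_pushforward measurable_affine mu measurableT mf)//.
apply: eq_measure_integral => [|m A mA _]; first exact: measurable_affine.
exact: lebn_affine.
Qed.

Lemma ae_affine (P : V -> Prop) :
  {ae mu, forall x, P x} -> {ae mu, forall x, P (c *: x + a)}.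
Proof.
move=> [N [mN N0 PN]]; exists (affine @^-1` N); split.
- by rewrite -[X in measurable X]setTI; exact: measurable_affine.
- by rewrite lebn_affine// N0 mule0.
- by move=> x /= Px; apply: PN.
Qed.

End affine.

Lemma ge0_integral_shift (a : V) (f : V -> \bar R) : measurable_fun [set: V] f ->
  (forall x, 0 <= f x)%E -> (\int[mu]_x f (x + a)%R = \int[mu]_x f x)%E.
Proof.
move=> mf f0; have := ge0_integral_affine a (@ltr01 R) mf f0.
rewrite expr1n invr1 mul1e => <-.
by under [RHS]eq_integral do rewrite scale1r.
Qed.

Lemma integral_shift (a : V) (f : V -> \bar R) : measurable_fun [set: V] f ->
  (\int[mu]_x f (x + a)%R = \int[mu]_x f x)%E.
Proof.
move=> mf; rewrite integralE [RHS]integralE.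
rewrite -(ge0_integral_shift a (measurable_funepos mf))//.
rewrite -(ge0_integral_shift a (measurable_funeneg mf))//.
by congr (_ - _)%E; apply: eq_integral => x _; rewrite ?funeposE ?funenegE.
Qed.

Lemma measurable_shift (a : V) : measurable_fun [set: V] (fun x => x + a).
Proof. by apply: measurable_rV_add. Qed.

Lemma ae_shift (a : V) (P : V -> Prop) :
  {ae mu, forall x, P x} -> {ae mu, forall x, P (x + a)}.
Proof.
move=> aP; have := ae_affine a ltr01 aP.
by apply: filterS => x; rewrite scale1r.
Qed.

End change_of_variables.

(** * Smooth bump functions *)

Section derivative_along_line.
Variables (R : realType) (V : normedModType R).

(** The two difference quotients are the same function of the increment, so one-variable theorems
    apply along lines. *)
Lemma is_derive_line (f : V -> R^o) (x v : V) (t l : R) :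
  is_derive (t *: v + x) v f l <->
  is_derive t 1 (fun s : R => f (s *: v + x) : R^o) l.
Proof.
have E : (fun h : R => h^-1 *: ((f \o shift (t *: v + x)) (h *: v) - f (t *: v + x))) =
    (fun h : R => h^-1 *: (((fun s : R => f (s *: v + x) : R^o) \o shift t) (h *: (1 : R^o)) -
                       f (t *: v + x))).
  by apply/funext => h; rewrite /= scalerDl addrA [h%:A]mulr1.
split => -[d1 d2]; apply: DeriveDef.
- by move: d1; rewrite /derivable E.
- by move: d2; rewrite /derive E.
- by move: d1; rewrite /derivable E.
- by move: d2; rewrite /derive E.
Qed.

End derivative_along_line.

Section flat_functions.
Variable R : realType.
Implicit Types (P : {poly R}) (t : R).

(** The polynomial factor makes the class stable under differentiation: with s = 1/t, the derivative
    of P(s) exp(-s) in t is s^2 (P(s) - P'(s)) exp(-s), which is [flat_derive]. *)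
Definition flat P t : R := if 0 < t then P.[t^-1] * expR (- t^-1) else 0.

(** Each s^n exp(-s) is at most n!, because exp s >= 1 + s^n / n! for n > 0; the monomials are then
    summed with the absolute values of the coefficients. *)
Lemma horner_expR_bounded P :
  exists C : R, 0 <= C /\ forall s, 0 <= s -> `|P.[s] * expR (- s)| <= C.
Proof.
have mono n : exists C : R, 0 <= C /\ forall s, 0 <= s -> s ^+ n * expR (- s) <= C.
  case: n => [|n].
    exists 1; split => // s s0; rewrite expr0 mul1r.
    by rewrite -(@expR0 R) ler_expR oppr_le0.
  exists (n.+1)`!%:R; split=> // s s0.
  have := expR_ge1Dxn n s0 => h.
  rewrite expRN ler_pdivrMr ?expR_gt0//.
  have f0 : (0:R) < (n.+1)`!%:R by rewrite ltr0n fact_gt0.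
  by rewrite mulrC -ler_pdivrMr// (le_trans _ h)// lerDr.
elim/poly_ind: P => [|P c _].
  by exists 0; split => // s _; rewrite horner0 mul0r normr0.
move: (P * 'X + c%:P) => Q.
pose C n := sval (cid (mono n)).
have C0 n : 0 <= C n by have [] := svalP (cid (mono n)).
have CP n s : 0 <= s -> s ^+ n * expR (- s) <= C n.
  by have [_] := svalP (cid (mono n)); exact.
exists (\sum_(i < size Q) `|Q`_i| * C i); split.
  by apply: sumr_ge0 => i _; rewrite mulr_ge0.
move=> s s0; rewrite horner_coef mulr_suml (le_trans (ler_norm_sum _ _ _))//.
apply: ler_sum => i _; rewrite -mulrA normrM ler_wpM2l// ger0_norm ?CP//.
by rewrite mulr_ge0 ?exprn_ge0// expR_ge0.
Qed.

(** Gives the derivative at 0, where the difference quotient is then at most C |t|. The factor t^2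
    is gained by bounding X^2 P instead of P. *)
Lemma flat_le_sqr P : exists C : R, 0 <= C /\ forall t, `|flat P t| <= C * t ^+ 2.
Proof.
have [C [C0 CP]] := horner_expR_bounded ('X ^+ 2 * P).
exists C; split => // t; rewrite /flat; case: ifPn => t0; last first.
  by rewrite normr0 mulr_ge0// sqr_ge0.
have t'0 : 0 <= t^-1 by rewrite invr_ge0 ltW.
have := CP _ t'0; rewrite hornerM hornerXn -mulrA normrM ger0_norm ?exprn_ge0//.
by rewrite exprVn ler_pdivrMl ?exprn_gt0// [C * _]mulrC.
Qed.

Definition flat_derive P := 'X ^+ 2 * (P - P^`()).

Lemma is_derive_flat P t : is_derive t 1 (flat P : R -> R^o) (flat (flat_derive P) t).
Proof.
have [t0|t0|->] := ltgtP t 0.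
- have -> : flat (flat_derive P) t = 0 by rewrite /flat ltNge (ltW t0).
  apply: near_eq_is_derive (is_derive_cst _ _ _); near=> x.
  rewrite /flat ltNge (ltW _)//=; near: x; exact: lt_nbhsl.
- have tn0 : t != 0 by rewrite gt_eqF.
  have dV : is_derive t 1 (fun x : R => x^-1 : R^o) (- t ^- 2).
    by apply: is_derive_eq; [exact: (is_deriveV (f := id))|rewrite [LHS]mulr1].
  have h : \near t, P.[t^-1] * expR (- t^-1) = flat P t.
    near=> x; rewrite /flat ifT//; near: x; exact: lt_nbhsr.
  apply: (near_eq_is_derive (W := R^o) h).
  have -> : flat (flat_derive P) t = P.[t^-1] *: (expR (- t^-1) * (t ^- 2)) +
      expR (- t^-1) *: (P^`().[t^-1] * (- t ^- 2)).
    rewrite /flat t0 /flat_derive hornerM hornerXn hornerD hornerN exprVn.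
    by rewrite /GRing.scale/=; ring.
  have dP : is_derive t (1 : R) (horner P \o (fun x : R => x^-1)) (P^`().[t^-1] * (- t ^- 2)).
    exact: is_derive1_comp.
  have dN : is_derive t (1 : R) (fun x : R => - x^-1) (t ^- 2).
    by rewrite -[X in is_derive _ _ _ X]opprK; exact: is_deriveN.
  have dE : is_derive t (1 : R) (expR \o (fun x : R => - x^-1)) (expR (- t^-1) * t ^- 2).
    exact: is_derive1_comp.
  exact: (is_deriveM dP dE).
- have -> : flat (flat_derive P) 0 = 0 by rewrite /flat ltxx.
  have [C [C0 CP]] := flat_le_sqr P.
  have c0 : (fun h : R => h^-1 *: ((flat P \o shift 0) (h *: (1 : R^o)) - flat P 0 : R^o))
      @ 0^' --> (0 : R^o).
    have C1 : 0 < C + 1 by rewrite ltr_wpDl.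
    apply/cvgrPdist_le => e e0; near=> h.
    have h0 : h != 0 by near: h; exact: nbhs_dnbhs_neq.
    rewrite /= addr0 [h%:A]mulr1 {2}/flat ltxx subr0 sub0r normrN normrM normfV.
    rewrite ler_pdivrMl ?normr_gt0//.
    rewrite (le_trans (CP h))// -real_normK ?num_real// expr2 mulrCA ler_wpM2l//.
    have : `|h| <= e / (C + 1).
      near: h; apply: dnbhs0_le; exact: divr_gt0.
    rewrite ler_pdivlMr// => he; rewrite (le_trans _ he)// mulrC.
    by rewrite ler_wpM2l// lerDl.
  apply: DeriveDef; first by apply/cvg_ex; exists 0.
  exact: cvg_lim c0.
Unshelve. all: by end_near. Qed.

End flat_functions.

Section bumps.
Variables (R : realType) (d : nat).
Local Notation V := 'rV[R]_d.
Implicit Types (phi : V -> R) (P : {poly R}).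

(* A class of functions that contains bumps and is stable under the partial
   derivatives, hence made of smooth functions. *)
Inductive flat_generated : (V -> R) -> Prop :=
| fg_flat P (a b : R) (i : 'I_d) : flat_generated (fun x => flat P (a * x ord0 i + b))
| fg_cst (c : R) : flat_generated (fun=> c)
| fg_add f g : flat_generated f -> flat_generated g -> flat_generated (fun x => f x + g x)
| fg_mul f g : flat_generated f -> flat_generated g -> flat_generated (fun x => f x * g x).

Lemma flat_generated_derive phi (i : 'I_d) : flat_generated phi ->
  exists2 psi, flat_generated psi &
    forall x, is_derive x (delta_mx ord0 i) (phi : V -> R^o) (psi x).
Proof.
elim=> [P a b j|c|f g _ [f' gf' df] _ [g' gg' dg]|f g gf [f' gf' df] gg [g' gg' dg]].
- exists (fun x => (a * (j == i)%:R) * flat (flat_derive P) (a * x ord0 j + b)).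
    by apply: fg_mul; [exact: fg_cst|exact: fg_flat].
  (* Writing x as 0 e_i + x reduces the partial derivative to one variable at 0. *)
  move=> x; rewrite -[X in is_derive X _ _]add0r -[X in is_derive (X + _)](scale0r (delta_mx ord0 i)).
  apply/is_derive_line; rewrite mulrC.
  have E s : a * (s *: delta_mx ord0 i + x) ord0 j + b =
      (a * (j == i)%:R) * s + (a * x ord0 j + b).
    by rewrite !mxE eqxx/=; ring.
  under eq_fun do rewrite E.
  set c := a * (j == i)%:R; set e := a * x ord0 j + b.
  have dl : is_derive (0:R) (1:R) (fun s : R => c * s + e) c.
    rewrite (_ : (fun s => _) = horner (c *: 'X + e%:P)); last first.
      by apply/funext => s; rewrite !hornerE.
    by apply: is_derive_eq; rewrite derivD derivZ derivX derivC addr0 hornerZ hornerC mulr1.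
  apply: (is_derive1_comp (f := flat P) (g := fun s => c * s + e)).
  rewrite mulr0 add0r.
  exact: is_derive_flat.
- by exists (fun=> 0); [exact: fg_cst|move=> x; exact: is_derive_cst].
- exists (fun x => f' x + g' x); first exact: fg_add.
  by move=> x; exact: is_deriveD.
- exists (fun x => f x * g' x + g x * f' x).
    by apply: fg_add; exact: fg_mul.
  by move=> x; exact: is_deriveM.
Qed.

Lemma flat_continuous P : continuous (flat P : R -> R^o).
Proof.
move=> t; apply: differentiable_continuous; apply/derivable1_diffP.
by have [] := is_derive_flat P t.
Qed.

Lemma flat_generated_continuous phi : flat_generated phi -> continuous (phi : V -> R^o).
Proof.
elim=> [P a b j|c|f g _ cf _ cg|f g _ cf _ cg] x.
- apply: (continuous_comp (f := fun x : V => a * x ord0 j + b) (g := flat P)).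
    apply: (@continuousD _ _ _ (fun y : V => a * y ord0 j : R^o) (cst b : V -> R^o)).
      apply: (@continuousM _ _ (cst a) (fun y : V => y ord0 j)).
        exact: cst_continuous.
      exact: coord_continuous.
    exact: cst_continuous.
  exact: flat_continuous.
- exact: cst_continuous.
- by apply: (@continuousD _ _ _ (f : V -> R^o) (g : V -> R^o)); [exact: cf|exact: cg].
- by apply: (@continuousM _ _ f g); [exact: cf|exact: cg].
Qed.

Lemma flat_generated_smooth phi : flat_generated phi -> smooth (phi : V -> R^o).
Proof.
move=> gphi s.
suff gs : flat_generated (partials s (phi : V -> R^o)).
  split; first exact: flat_generated_continuous.
  move=> i x; have [psi _ /(_ x) []//] := flat_generated_derive i gs.
elim: s => // i s IH /=.
have [psi gpsi h] := flat_generated_derive i IH.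
rewrite (_ : partial i _ = psi)//; apply/funext => x.
by rewrite /partial; have [_ ->] := h x.
Qed.

Lemma rV_norm_leP (x : V) (M : R) : 0 <= M ->
  (`|x| <= M) <-> forall i, `|x ord0 i| <= M.
Proof.
move=> M0; rewrite [`|x|]/Num.norm/= mx_normrE; split => [/bigmax_leP[_ h] i|h].
  exact: (h (ord0, i)).
by apply/bigmax_leP; split => // -[i j] _ /=; rewrite ord1.
Qed.

Lemma compact_closure_box (a b : V) (A : set V) : A `<=` rV_box a b -> compact (closure A).
Proof.
move=> Ab; apply: bounded_closed_compact; last exact: closed_closure.
have [k ak] := mem_cube a; have [k' bk'] := mem_cube b.
have cA : A `<=` [set x | `|x| <= (k + k')%:R].
  move=> x /Ab xab /=; apply/rV_norm_leP => // j.
  have := xab j; rewrite in_itv/= => /andP[h1 h2].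
  move/cubeP: ak => /(_ j); move/cubeP: bk' => /(_ j).
  rewrite !ler_norml natrD => /andP[h3 h4] /andP[h5 h6].
  have k0 : 0 <= k%:R :> R by rewrite ler0n.
  have k'0 : 0 <= k'%:R :> R by rewrite ler0n.
  by apply/andP; split; lra.
exists (k + k')%:R; split => // M kM x clx.
suff : closed [set x : V | `|x| <= (k + k')%:R].
  by move/closure_id => E; apply: (le_trans _ (ltW kM)); have := closure_subset cA clx; rewrite -E.
have := @closed_comp _ _ (fun x : V => `|x|) [set y : R | y <= (k + k')%:R].
apply; last exact: closed_le.
by move=> y _; exact: norm_continuous.
Qed.

(** A smooth approximation of the indicator of the closed box. With N = n + 1, each factor is flat
    at N^2 s + N, where s is the signed distance to a face: it vanishes once s <= -1/N, and since
    the argument is at least N for s >= 0, it tends to 1 up to and including the face. *)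
Definition bump (n : nat) (a b : V) (x : V) : R :=
  \prod_(i < d) (flat 1 (n.+1%:R ^+ 2 * (x ord0 i - a ord0 i) + n.+1%:R) *
                 flat 1 (n.+1%:R ^+ 2 * (b ord0 i - x ord0 i) + n.+1%:R)).

Lemma flat1_ge0 (t : R) : 0 <= flat 1 t.
Proof. by rewrite /flat; case: ifP => // _; rewrite hornerC mul1r expR_ge0. Qed.

Lemma flat1_le1 (t : R) : flat 1 t <= 1.
Proof.
rewrite /flat; case: ifP => // t0; rewrite hornerC mul1r -[leRHS](@expR0 R).
by rewrite ler_expR oppr_le0 invr_ge0 ltW.
Qed.

Lemma flat1_le0 (t : R) : t <= 0 -> flat 1 t = 0.
Proof. by move=> t0; rewrite /flat ltNge t0. Qed.

Lemma bump_ge0 n a b x : 0 <= bump n a b x.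
Proof. by apply: prodr_ge0 => i _; rewrite mulr_ge0 ?flat1_ge0. Qed.

Lemma bump_le1 n a b x : bump n a b x <= 1.
Proof.
apply: prodr_ile1 => i _; rewrite mulr_ge0 ?flat1_ge0//=.
by rewrite mulr_ile1 ?flat1_ge0 ?flat1_le1.
Qed.

Lemma flat_generated_bump n a b : flat_generated (bump n a b).
Proof.
rewrite /bump; elim: (index_enum 'I_d) => [|i s IH].
  by under [X in flat_generated X]eq_fun do rewrite big_nil; exact: fg_cst.
under [X in flat_generated X]eq_fun do rewrite big_cons.
apply: fg_mul => //; apply: fg_mul.
  rewrite (_ : (fun x : V => _) = (fun x : V =>
    flat 1 (n.+1%:R ^+ 2 * x ord0 i + (n.+1%:R - n.+1%:R ^+ 2 * a ord0 i)))); first exact: fg_flat.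
  by apply/funext => x; congr flat; ring.
rewrite (_ : (fun x : V => _) = (fun x : V =>
  flat 1 ((- n.+1%:R ^+ 2) * x ord0 i + (n.+1%:R + n.+1%:R ^+ 2 * b ord0 i)))); first exact: fg_flat.
by apply/funext => x; congr flat; ring.
Qed.

Lemma bump_support n a b x : bump n a b x != 0 ->
  rV_box (a - const_mx n.+1%:R^-1) (b + const_mx n.+1%:R^-1) x.
Proof.
move=> /prodf_neq0 h i; have := h i isT; rewrite mulf_eq0 negb_or => /andP[ha hb].
have n0' : 0 < n.+1%:R :> R by [].
have E (t : R) : flat 1 (n.+1%:R ^+ 2 * t + n.+1%:R) != 0 -> - n.+1%:R^-1 <= t.
  move=> /eqP ht; rewrite leNgt; apply/negP => tn; apply: ht; apply: flat1_le0.
  rewrite -[X in _ + X <= 0](_ : - (n.+1%:R ^+ 2 * - n.+1%:R^-1) = _).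
    by rewrite subr_le0 ler_wpM2l ?sqr_ge0// ltW.
  by rewrite mulrN opprK expr2 mulfK// gt_eqF.
have := E _ ha; have := E _ hb.
rewrite in_itv/= !mxE; move: (n.+1%:R^-1) => e h1 h2.
by apply/andP; split; lra.
Qed.

Lemma test_function_bump n a b : test_function (bump n a b : V -> R^o).
Proof.
split; first by apply: flat_generated_smooth; exact: flat_generated_bump.
apply: compact_closure_box => x; exact: bump_support.
Qed.

Lemma flat1_cvg1 (t : R) : 0 <= t ->
  flat 1 (n.+1%:R ^+ 2 * t + n.+1%:R) @[n --> \oo] --> (1 : R).
Proof.
move=> t0; apply: (@squeeze_cvgr _ _ _ _ (fun n => 1 - n.+1%:R^-1) (fun=> 1)).
- near=> n; rewrite flat1_le1 andbT.
  have n0 : 0 < n.+1%:R :> R by [].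
  have s0 : n.+1%:R <= n.+1%:R ^+ 2 * t + n.+1%:R :> R by rewrite lerDr mulr_ge0// sqr_ge0.
  rewrite /flat (lt_le_trans n0 s0) hornerC mul1r.
  rewrite (le_trans _ (expR_ge1Dx _))// lerD2l lerN2 lef_pV2 ?posrE//.
  exact: lt_le_trans s0.
- rewrite -[X in _ --> X]subr0; apply: cvgB; first exact: cvg_cst.
  exact: cvg_harmonic.
- exact: cvg_cst.
Unshelve. all: by end_near. Qed.

Lemma flat1_cvg0 (t : R) : t < 0 ->
  \forall n \near \oo, flat 1 (n.+1%:R ^+ 2 * t + n.+1%:R) = 0.
Proof.
move=> t0; near=> n; apply: flat1_le0.
rewrite expr2 -mulrA -[X in _ + X]mulr1 -mulrDr pmulr_rle0//.
rewrite -lerBrDr sub0r lerNr -mulrN -ler_pdivrMr ?oppr_gt0// div1r.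
near: n; exists (Num.bound (- t)^-1) => // n /= hn.
rewrite (le_trans (ltW (archi_boundP _))) ?invr_ge0 ?oppr_ge0 1?ltW//.
by rewrite ltr_nat ltnS.
Unshelve. all: by end_near. Qed.

Lemma bump_cvg a b x : bump n a b x @[n --> \oo] --> (\1_(rV_box a b) x : R).
Proof.
rewrite indicE; case: (boolP (x \in rV_box a b)) => [/set_mem xab|/negP xab].
- have -> : true%:R = \prod_(i < d) (1 : R) by rewrite big1.
  apply: cvg_big => [|i _]; first exact: mul_continuous.
  have := xab i; rewrite in_itv/= => /andP[xa xb].
  rewrite -[X in _ --> X]mulr1.
  by apply: cvgM; apply: flat1_cvg1; rewrite subr_ge0.
- have /existsNP[i xi] : ~ rV_box a b x by move=> h; apply: xab; rewrite inE.
  apply: cvg_near_cst.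
  suff : \forall n \near \oo, flat 1 (n.+1%:R ^+ 2 * (x ord0 i - a ord0 i) + n.+1%:R) = 0 \/
      flat 1 (n.+1%:R ^+ 2 * (b ord0 i - x ord0 i) + n.+1%:R) = 0.
    apply: filterS => n h; apply/eqP; rewrite /bump prodf_seq_eq0.
    apply/hasP; exists i; first by rewrite mem_index_enum.
    by rewrite /= mulf_eq0; case: h => ->; rewrite eqxx ?orbT.
  move: xi => /negP; rewrite in_itv/= negb_and -!ltNge => /orP[h|h].
    have : x ord0 i - a ord0 i < 0 by rewrite subr_lt0.
    by move=> /flat1_cvg0; apply: filterS => n ->; left.
  have : b ord0 i - x ord0 i < 0 by rewrite subr_lt0.
  by move=> /flat1_cvg0; apply: filterS => n ->; right.
Qed.

End bumps.

(** * Directional derivatives and symmetry of second derivatives *)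

Section line_calculus.
Variables (R : realType) (V : normedModType R).

Lemma mvt_line (f : V -> R^o) (v : V) (df : V -> R) :
  (forall x, is_derive x v f (df x)) ->
  forall (y : V) (s : R), exists2 t : R, `|t| <= `|s| &
    f (s *: v + y) - f y = s * df (t *: v + y).
Proof.
move=> fdf y s.
pose g (t : R) := f (t *: v + y).
have dg (t : R) : is_derive t (1 : R) g (df (t *: v + y)).
  exact: (is_derive_line f y v t _).1 (fdf _).
have cg (A : set R) : {within A, continuous g}.
  apply: continuous_subspaceT => t; apply: differentiable_continuous.
  by apply/derivable1_diffP; have [] := dg t.
have g0 : g 0 = f y by rewrite /g scale0r add0r.
have [s0|s0] := leP 0 s.
  have [t] := @MVT_segment _ g (fun t => df (t *: v + y)) 0 s s0 (fun t _ => dg t) (cg _).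
  rewrite in_itv/= => /andP[t0 ts] gE; exists t; first by rewrite !ger0_norm.
  by rewrite -g0 -/(g s) gE subr0 mulrC.
have [t] := @MVT_segment _ g (fun t => df (t *: v + y)) s 0 (ltW s0) (fun t _ => dg t) (cg _).
rewrite in_itv/= => /andP[t0 ts] gE; exists t; first by rewrite !ler0_norm ?lerN2// ltW.
by rewrite -g0 -/(g s) -opprB gE sub0r mulrN opprK mulrC.
Qed.

(** The increment along h (w + c e) is the increment along h w plus one along h c e, started at x +
    h w. By the mean value theorem the latter is h c times [df] at a point tending to x. Adding the
    coordinates one by one, continuous partial derivatives yield all directional derivatives. *)
Lemma is_derive_add_direction (f : V -> R^o) (x w e : V) (l c : R) (df : V -> R^o) :
  (forall y, is_derive y e f (df y)) -> {for x, continuous df} ->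
  is_derive x w f l -> is_derive x (w + c *: e) f (l + c * df x).
Proof.
move=> fdf cdf [dw lw].
have cvw : (fun h : R => h^-1 *: ((f \o shift x) (h *: w) - f x : R^o)) @ 0^' --> (l : R^o).
  by rewrite -lw.
suff cve : (fun h : R => h^-1 *: (f (h *: (w + c *: e) + x) - f (h *: w + x) : R^o)) @ 0^' -->
    (c * df x : R^o).
  have E : (fun h : R => h^-1 *: ((f \o shift x) (h *: (w + c *: e)) - f x : R^o)) @ 0^' -->
     (l + c * df x : R^o).
    rewrite (_ : (fun h : R => _) = (fun h : R => h^-1 *: ((f \o shift x) (h *: w) - f x : R^o)
      + h^-1 *: (f (h *: (w + c *: e) + x) - f (h *: w + x) : R^o))).
      exact: cvgD.
    by apply/funext => h /=; rewrite -scalerDr; congr (_ *: _); ring.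
  apply: DeriveDef; first by apply/cvg_ex; exists (l + c * df x).
  exact: cvg_lim E.
have tE (h : R) : {t : R | `|t| <= `|h * c| &
    f (h *: (w + c *: e) + x) - f (h *: w + x) = (h * c) * df (t *: e + (h *: w + x))}.
  apply: cid2; have [t th tE] := mvt_line fdf (h *: w + x) (h * c).
  exists t => //; rewrite -tE; congr (f _ - _).
  by rewrite scalerDr scalerA [X in X + _ = _]addrC addrA.
pose t h := s2val (tE h).
have th h : `|t h| <= `|h * c| by exact: (s2valP (tE h)).
have tE' h := s2valP' (tE h); rewrite -/(t _) in tE'.
apply: (@cvg_trans _ ((fun h : R => c * df (t h *: e + (h *: w + x)) : R^o) @ 0^')).
  apply: near_eq_cvg; near=> h.
  have h0 : h != 0 by near: h; exact: nbhs_dnbhs_neq.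
  by rewrite tE' /GRing.scale/= -/(t h); field.
apply: (@cvgM _ _ _ _ (fun=> c) (fun h : R => df (t h *: e + (h *: w + x)))).
  exact: cvg_cst.
have cp : (fun h : R => t h *: e + (h *: w + x)) @ 0^' --> x.
  rewrite -[X in _ --> X]add0r -[X in _ --> X + _](scale0r e); apply: cvgD.
    apply: cvgZr_tmp.
    have c1 : 0 < `|c| + 1 by rewrite ltr_wpDl.
    apply/cvgrPdist_le => eps eps0; near=> h.
    rewrite sub0r normrN (le_trans (th h))// normrM.
    have : `|h| <= eps / (`|c| + 1) by near: h; apply: dnbhs0_le; exact: divr_gt0.
    rewrite ler_pdivlMr//; apply: le_trans.
    by rewrite ler_wpM2l// lerDl.
  rewrite -[X in _ --> X]add0r -[X in _ --> X + _](scale0r w); apply: cvgD; last exact: cvg_cst.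
  apply: cvgZr_tmp.
  apply: cvg_within; exact: cvg_id.
exact: (cvg_comp _ _ cp cdf).
Unshelve. all: by end_near. Qed.

End line_calculus.

Section smooth_calculus.
Variables (R : realType) (d : nat).
Local Notation V := 'rV[R]_d.
Local Notation e_ i := (delta_mx ord0 i : V).
Implicit Type phi : V -> R^o.

Lemma smooth_is_derive phi (i : 'I_d) x : smooth phi ->
  is_derive x (e_ i) phi (partial i phi x).
Proof. by move=> /(_ [::])[_ /(_ i x)]; exact: derivableP. Qed.

Lemma smooth_partial phi i : smooth phi -> smooth (partial i phi).
Proof.
move=> sphi s; have := sphi (rcons s i).
by rewrite /partials foldr_rcons.
Qed.

Definition dirderiv (z : V) phi (x : V) : R := \sum_(i < d) z ord0 i * partial i phi x.

Lemma smooth_is_derive_dir phi (z x : V) : smooth phi ->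
  is_derive x z phi (dirderiv z phi x).
Proof.
move=> sphi; rewrite {1}(row_sum_delta z) /dirderiv.
elim: (index_enum 'I_d) => [|i s IH].
  by rewrite !big_nil; exact: is_derive0.
rewrite !big_cons [X in is_derive _ X]addrC [X in is_derive _ _ _ X]addrC.
apply: is_derive_add_direction => //.
- by move=> y; exact: smooth_is_derive.
- by have [c _] := smooth_partial i sphi [::]; exact: c.
Qed.

(** By continuity both values are within any tolerance of a common one. The nearby points are
    written as two steps along [e] and [e'], the form in which iterated mean values deliver them. *)
Lemma eq_of_close_values (A B : V -> R^o) (x e e' : V) : `|e| <= 1 -> `|e'| <= 1 ->
  continuous A -> continuous B ->
  (forall h : R, 0 < h -> exists s t s' t' : R,
    [/\ `|s| <= h, `|t| <= h, `|s'| <= h, `|t'| <= h &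
     A (s *: e' + (t *: e + x)) = B (s' *: e + (t' *: e' + x))]) ->
  A x = B x.
Proof.
move=> e1 e'1 cA cB AB.
have cvg0 (D : V -> R^o) (eps : R) : continuous D -> 0 < eps ->
    exists2 r : R, 0 < r & forall (s t : R) (a b : V), `|a| <= 1 -> `|b| <= 1 ->
      `|s| <= r -> `|t| <= r -> `|D x - D (s *: a + (t *: b + x))| <= eps.
  move=> cD eps0.
  have /cvgrPdist_le /(_ eps eps0) /nbhs_ballP[r /= r0 rD] := cD x.
  exists (r / 4); first by rewrite divr_gt0.
  move=> s t a b a1 b1 hs ht; apply: rD.
  rewrite -ball_normE /= addrA opprD addrCA subrr addr0 normrN.
  rewrite (le_lt_trans (ler_normD _ _))// !normrZ.
  have h1 : `|s| * `|a| <= r / 4 by rewrite -[leRHS]mulr1 ler_pM.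
  have h2 : `|t| * `|b| <= r / 4 by rewrite -[leRHS]mulr1 ler_pM.
  lra.
apply/eqP; rewrite -subr_eq0 -normr_eq0 eq_le normr_ge0 andbT.
apply/ler_addgt0Pl => eps eps0; rewrite addr0.
have eps2 : 0 < eps / 2 by rewrite divr_gt0.
have [r1 r10 h1] := cvg0 _ _ cA eps2.
have [r2 r20 h2] := cvg0 _ _ cB eps2.
pose h := Num.min r1 r2; have h0 : 0 < h by rewrite lt_min r10.
have hr1 : h <= r1 by rewrite ge_min lexx.
have hr2 : h <= r2 by rewrite ge_min lexx orbT.
have [s [t [s' [t' [hs ht hs' ht' E]]]]] := AB h h0.
have := h1 s t e' e e'1 e1 (le_trans hs hr1) (le_trans ht hr1).
have := h2 s' t' e e' e1 e'1 (le_trans hs' hr2) (le_trans ht' hr2).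
rewrite E; move: (A x) (B x) (B _) => a b c.
by rewrite !ler_norml => /andP[? ?] /andP[? ?]; apply/andP; split; lra.
Qed.

(** The second difference of phi with step h along e_i and e_j is symmetric in i and j. Two mean
    values write it, in either order, as h^2 times a mixed derivative at a point near x; continuity
    then lets h tend to 0. *)
Lemma smooth_schwarz phi i j : smooth phi ->
  partial i (partial j phi) = partial j (partial i phi).
Proof.
move=> sphi; apply/funext => x.
have key (k l : 'I_d) (h : R) : exists2 p : R * R, `|p.1| <= `|h| /\ `|p.2| <= `|h| &
    phi (h *: e_ k + (h *: e_ l + x)) - phi (h *: e_ k + x) -
    (phi (h *: e_ l + x) - phi x) =
    h * (h * partial l (partial k phi) (p.1 *: e_ l + (p.2 *: e_ k + x))).
  pose G y : R^o := phi (y + h *: e_ l) - phi y.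
  have dG y : is_derive y (e_ k) G (partial k phi (y + h *: e_ l) - partial k phi y).
    apply: is_deriveB; last exact: smooth_is_derive.
    rewrite -[X in is_derive X _ _ _]add0r -[X in is_derive (X + _) _ _ _](scale0r (e_ k)).
    apply: (is_derive_line (fun z => phi (z + h *: e_ l) : R^o) y (e_ k) 0 _).2.
    under eq_fun do rewrite -addrA.
    apply: (is_derive_line phi (y + h *: e_ l) (e_ k) 0 _).1.
    by rewrite scale0r add0r; exact: smooth_is_derive.
  have [t th tE] := mvt_line dG x h.
  have dP y : is_derive y (e_ l) (partial k phi) (partial l (partial k phi) y).
    by apply: smooth_is_derive; exact: smooth_partial.
  have [t' th' tE'] := mvt_line dP (t *: e_ k + x) h.
  exists (t', t) => //=; rewrite -tE' [h *: e_ l + (_ + _)]addrC -tE /G.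
  by rewrite [h *: e_ l + x]addrC addrA.
have c1 : continuous (partial j (partial i phi)).
  by have [] := smooth_partial j (smooth_partial i sphi) [::].
have c2 : continuous (partial i (partial j phi)).
  by have [] := smooth_partial i (smooth_partial j sphi) [::].
have en (k : 'I_d) : `|e_ k| <= 1.
  by apply/rV_norm_leP => // l; rewrite mxE eqxx/=; case: eqP; rewrite ?normr1 ?normr0.
apply: esym; apply: (eq_of_close_values (en i) (en j) c1 c2) => h h0.
have [[s t]/= [hs ht] E1] := key i j h.
have [[s' t']/= [hs' ht'] E2] := key j i h.
rewrite (gtr0_norm h0) in hs ht hs' ht'.
exists s, t, s', t'; split; [exact: hs|exact: ht|exact: hs'|exact: ht'|].
have hn0 : h != 0 by rewrite gt_eqF.
move: E1 E2; rewrite [h *: e_ i + (_ + x)]addrCA.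
move: (phi (h *: e_ j + (h *: e_ i + x))) (phi (h *: e_ i + x)) (phi (h *: e_ j + x)) => a b c.
move: (phi x) => p E1 E2.
have E0 : a - b - (c - p) = a - c - (b - p).
  by rewrite !opprB addrACA [- b + _]addrC -addrACA.
have E3 := etrans (etrans (esym E1) E0) E2.
exact: (mulfI hn0 (mulfI hn0 E3)).
Qed.

End smooth_calculus.

(** * Square-integrable functions, completeness and Riesz representation *)

Section square_integrable.
Context d (T : measurableType d) (R : realType) (mu : {measure set T -> \bar R}).
Implicit Types f g : T -> R.

(** Speaks of an actual measurable function, not of a class modulo null sets, so that values, shifts
    and averages make sense pointwise. *)
Definition sqint f :=
  measurable_fun [set: T] f /\ (\int[mu]_x (f x ^+ 2)%:E < +oo)%E.

Definition ip f g : R := \int[mu]_x (f x * g x).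

Lemma sqint_sqr_integrable f : sqint f ->
  mu.-integrable [set: T] (fun x => (f x ^+ 2)%:E).
Proof.
move=> [mf foo]; apply/integrableP; split.
  by apply/measurable_EFinP; exact: measurable_funX.
by under eq_integral do rewrite gee0_abs ?lee_fin ?sqr_ge0//.
Qed.

Lemma sqint_mul_integrable f g : sqint f -> sqint g ->
  mu.-integrable [set: T] (fun x => (f x * g x)%:E).
Proof.
move=> hf hg; have [mf _] := hf; have [mg _] := hg.
have := integrableD measurableT (sqint_sqr_integrable hf) (sqint_sqr_integrable hg).
apply: le_integrable => //; first by apply/measurable_EFinP; exact: measurable_funM.
move=> x _; rewrite /= lee_fin [leRHS]ger0_norm ?addr_ge0 ?sqr_ge0//.
rewrite normrM -(real_normK (num_real (f x))) -(real_normK (num_real (g x))).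
move: (normr_ge0 (f x)) (normr_ge0 (g x)) (sqr_ge0 (`|f x| - `|g x|)); nra.
Qed.

Lemma sqintD f g : sqint f -> sqint g -> sqint (fun x => f x + g x).
Proof.
move=> hf hg; have [mf _] := hf; have [mg _] := hg; split; first exact: measurable_funD.
have mfx : measurable_fun [set: T] (fun x => (f x ^+ 2)%:E : \bar R).
  by apply/measurable_EFinP; exact: measurable_funX.
have mgx : measurable_fun [set: T] (fun x => (g x ^+ 2)%:E : \bar R).
  by apply/measurable_EFinP; exact: measurable_funX.
apply: (@le_lt_trans _ _ (\int[mu]_x (2%:E * ((f x ^+ 2)%:E + (g x ^+ 2)%:E)))%E).
  apply: ge0_le_integral => //.
  - by move=> x _; rewrite lee_fin sqr_ge0.
  - by apply/measurable_EFinP; apply: measurable_funX; exact: measurable_funD.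
  - by apply: measurable_funeM; exact: emeasurable_funD.
  - by move=> x _; rewrite -EFinD -EFinM lee_fin; have := sqr_ge0 (f x - g x); nra.
rewrite ge0_integralZl//; last 2 first.
- exact: emeasurable_funD.
- by move=> x _; rewrite -EFinD lee_fin addr_ge0 ?sqr_ge0.
rewrite ge0_integralD//; [|by move=> x _; rewrite lee_fin sqr_ge0..].
by rewrite lte_mul_pinfty// lte_add_pinfty//; [exact: hf.2|exact: hg.2].
Qed.

Lemma sqintZ (c : R) f : sqint f -> sqint (fun x => c * f x).
Proof.
move=> [mf foo]; split; first exact: measurable_funM.
under eq_integral do rewrite exprMn EFinM.
rewrite ge0_integralZl//; [|by apply/measurable_EFinP; exact: measurable_funX
  |by move=> x _; rewrite lee_fin sqr_ge0|by rewrite lee_fin sqr_ge0].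
by rewrite lte_mul_pinfty// lee_fin sqr_ge0.
Qed.

Lemma sqintN f : sqint f -> sqint (fun x => - f x).
Proof.
move=> /(sqintZ (-1)); congr sqint.
by apply/funext => x; rewrite mulN1r.
Qed.

Lemma sqintB f g : sqint f -> sqint g -> sqint (fun x => f x - g x).
Proof. by move=> hf hg; apply: sqintD => //; exact: sqintN. Qed.

Lemma sqint0 : sqint (fun=> 0).
Proof. by split => //; under eq_integral do rewrite expr0n/=; rewrite integral0. Qed.

Lemma sqint_sum (I : Type) (s : seq I) (f : I -> T -> R) :
  (forall i, sqint (f i)) -> sqint (fun x => \sum_(i <- s) f i x).
Proof.
move=> hf; elim: s => [|i s IH].
  by under eq_fun do rewrite big_nil; exact: sqint0.
by under eq_fun do rewrite big_cons; exact: sqintD.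
Qed.

Lemma ipC f g : ip f g = ip g f.
Proof. by apply: eq_Rintegral => x _; rewrite mulrC. Qed.

Lemma ipDl f g k : sqint f -> sqint g -> sqint k ->
  ip (fun x => f x + g x) k = ip f k + ip g k.
Proof.
move=> hf hg hk; rewrite /ip -RintegralD//; [|exact: sqint_mul_integrable..].
by apply: eq_Rintegral => x _; rewrite mulrDl.
Qed.

Lemma ipZl c f g : sqint f -> sqint g -> ip (fun x => c * f x) g = c * ip f g.
Proof.
move=> hf hg; rewrite /ip -RintegralZl//; last exact: sqint_mul_integrable.
by apply: eq_Rintegral => x _; rewrite mulrA.
Qed.

Lemma ipBl f g k : sqint f -> sqint g -> sqint k ->
  ip (fun x => f x - g x) k = ip f k - ip g k.
Proof.
move=> hf hg hk; rewrite /ip -RintegralB//; [|exact: sqint_mul_integrable..].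
by apply: eq_Rintegral => x _; rewrite mulrBl.
Qed.

Lemma ipNl f g : sqint f -> sqint g -> ip (fun x => - f x) g = - ip f g.
Proof.
move=> hf hg; rewrite -mulN1r -ipZl//.
by apply: eq_Rintegral => x _; rewrite mulN1r.
Qed.

Lemma ip_sumr (I : Type) (s : seq I) (f : I -> T -> R) g :
  sqint g -> (forall i, sqint (f i)) ->
  ip g (fun x => \sum_(i <- s) f i x) = \sum_(i <- s) ip g (f i).
Proof.
move=> hg hf; elim: s => [|i s IH].
  rewrite big_nil; transitivity (ip (fun=> 0) g); last first.
    by rewrite /ip /Rintegral; under eq_integral do rewrite mul0r; rewrite integral0.
  by rewrite ipC; apply: eq_Rintegral => x _; rewrite big_nil.
rewrite big_cons -IH ipC [ip g (f i)]ipC [X in _ + X]ipC -ipDl//; last exact: sqint_sum.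
by apply: eq_Rintegral => x _; rewrite big_cons.
Qed.

Lemma ip_ge0 f : 0 <= ip f f.
Proof. by apply: Rintegral_ge0 => x _; rewrite -expr2 sqr_ge0. Qed.

Lemma ipE f : sqint f -> (ip f f)%:E = (\int[mu]_x (f x ^+ 2)%:E)%E.
Proof.
move=> [mf foo]; rewrite /ip /Rintegral fineK; last first.
  rewrite ge0_fin_numE; first by under eq_integral do rewrite -expr2.
  by apply: integral_ge0 => x _; rewrite lee_fin -expr2 sqr_ge0.
by under eq_integral do rewrite -expr2.
Qed.

Lemma ip_sqrD f g : sqint f -> sqint g ->
  ip (fun x => f x + g x) (fun x => f x + g x) = ip f f + 2 * ip f g + ip g g.
Proof.
move=> hf hg; have hfg := sqintD hf hg.
rewrite (ipDl hf hg hfg) (ipC f (fun x => f x + g x)) (ipC g (fun x => f x + g x)).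
by rewrite (ipDl hf hg hf) (ipDl hf hg hg) (ipC g f); ring.
Qed.

(** The square of f - c g has nonnegative integral. This is Cauchy-Schwarz without square roots: the
    free scale c plays the role of the optimization. *)
Lemma ip_AMGM f g (c : R) : sqint f -> sqint g -> 2 * (c * ip f g) <= ip f f + c ^+ 2 * ip g g.
Proof.
move=> hf hg; have hcg := sqintZ c hg.
have := ip_ge0 (fun x => f x - c * g x).
have hfcg := sqintB hf hcg.
rewrite ipBl// ![ip _ (fun x => f x - _)]ipC !ipBl// [ip f (fun x => c * _)]ipC.
rewrite !ipZl// [ip g (fun x => c * _)]ipC ipZl// [ip g f]ipC.
lra.
Qed.

Lemma Lfun2P f : f \in Lfun mu 2%:E <-> sqint f.
Proof.
split=> [lf|[mf foo]].
  have /integrableP[mf2 foo] := Lfun2_integrable_sqr lf; split.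
    by move: lf; rewrite inE => /andP[/[!inE]].
  apply: le_lt_trans foo; apply: ge0_le_integral => //.
  - by move=> x _; rewrite lee_fin sqr_ge0.
  - exact: measurableT_comp.
  - by move=> x _ /=; rewrite lee_fin ler_norm.
rewrite inE; apply/andP; split; rewrite inE//= /finite_norm.
rewrite unlock /=; apply: poweR_lty; apply: le_lt_trans foo.
apply: ge0_le_integral => //.
- apply/measurable_EFinP.
  apply: (@measurableT_comp _ _ _ _ _ _ (fun x : R => x `^ 2)%R) => //.
  exact: measurableT_comp.
- by apply/measurable_EFinP; exact: measurable_funX.
- move=> x _; rewrite /= lee_fin powR_mulrn// real_normK ?num_real//.
Qed.

End square_integrable.

Section limn_einf_bounds.
Variable R : realType.
Local Open Scope ereal_scope.

Lemma limn_einf_le (u : (\bar R)^nat) (c : \bar R) :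
  (forall n, u n <= c) -> limn_einf u <= c.
Proof.
move=> uc; rewrite limn_einf_lim; apply: lime_le; first exact: is_cvg_einfs.
apply: nearW => n; apply: (le_trans _ (uc n)); apply: ereal_inf_lbound.
by exists n => //=.
Qed.

Lemma limn_einf_lt_frequently (u : (\bar R)^nat) (c : \bar R) :
  limn_einf u < c -> forall N, exists2 n, (N <= n)%N & u n < c.
Proof.
move=> uc N; have : einfs u N < c.
  apply: le_lt_trans uc; rewrite limn_einf_lim.
  rewrite (cvg_lim _ (@cvg_einfs_sup _ u))//.
  by apply: ereal_sup_ubound; exists N.
by move=> /ereal_inf_lt[_ [n /= Nn <-]] h; exists n.
Qed.

End limn_einf_bounds.

Section riesz.
Context d (T : measurableType d) (R : realType) (mu : {measure set T -> \bar R}).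
Implicit Types phi : nat -> T -> R.

(** Since 4^n 8^-n = 2^-n, the series of the 4^n (phi_(n+1) - phi_n)^2 has integral at most 2 C. It
    is finite almost everywhere, where the increments decay like 2^-n and phi_n converges; Fatou
    carries the rate over to the limit. *)
Lemma fast_cauchy_L2_limit phi (C : R) : (forall n, sqint mu (phi n)) ->
  (forall n m, (n <= m)%N ->
    ip mu (fun x => phi m x - phi n x) (fun x => phi m x - phi n x) <= C * 8^-1 ^+ n) ->
  exists2 v, sqint mu v & forall n,
    ip mu (fun x => v x - phi n x) (fun x => v x - phi n x) <= C * 8^-1 ^+ n.
Proof.
move=> sphi cphi.
have mphi n : measurable_fun [set: T] (phi n) by exact: (sphi n).1.
have sB n m : sqint mu (fun x => phi m x - phi n x) by exact: sqintB.
have C0 : 0 <= C by have := cphi 0%N 0%N (leqnn _); rewrite expr0 mulr1; apply: le_trans; exact: ip_ge0.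
pose a n x := phi n.+1 x - phi n x.
pose g n x : \bar R := (4 ^+ n * a n x ^+ 2)%:E.
have g0 n x : (0 <= g n x)%E by rewrite lee_fin mulr_ge0 ?sqr_ge0 ?exprn_ge0.
have mg n : measurable_fun [set: T] (g n).
  apply/measurable_EFinP; apply: measurable_funM => //; apply: measurable_funX.
  exact: measurable_funB.
pose G x := (\sum_(n <oo) g n x)%E.
have mG : measurable_fun [set: T] G by exact: ge0_emeasurable_sum.
have G0 x : (0 <= G x)%E by exact: nneseries_ge0.
have Goo : (\int[mu]_x G x < +oo)%E.
  rewrite integral_nneseries//.
  apply: (@le_lt_trans _ _ (2 * C)%:E); last exact: ltry.
  apply: (le_trans _ (@epsilon_trick0 R (2 * C) xpredT _)); last by rewrite mulr_ge0.
  apply: lee_nneseries => n _; first by move=> _; exact: integral_ge0.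
  rewrite /g; under eq_integral do rewrite EFinM.
  have ma : measurable_fun [set: T] (fun x => (a n x ^+ 2)%:E : \bar R).
    by apply/measurable_EFinP; apply: measurable_funX; exact: measurable_funB.
  rewrite ge0_integralZl//; last by move=> *; rewrite lee_fin ?sqr_ge0 ?exprn_ge0.
  rewrite -(ipE (sB n n.+1)) -EFinM lee_fin (le_trans (ler_wpM2l _ (cphi n n.+1 _)))//.
  rewrite mulrCA -exprMn (_ : 4 * 8^-1 = 2^-1 :> R); last by field.
  by rewrite natrX exprS exprVn invfM mulrACA mulfV// mul1r.
pose E := [set x | (G x < +oo)%E].
have mE : measurable E by rewrite -[E]setTI; exact: emeasurable_fun_infty_o.
have aeE : {ae mu, forall x, E x}.
  have : mu.-integrable setT G.
    apply/integrableP; split => //.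
    by under eq_integral do rewrite gee0_abs//.
  move=> /(integrable_ae measurableT); apply: filterS => x /(_ I).
  by rewrite ge0_fin_numE.
(* Setting the sequence to 0 off [E] makes it converge everywhere, so that the limit is
   measurable. *)
pose psi n x := phi n x * \1_E x.
have mpsi n : measurable_fun [set: T] (psi n).
  by apply: measurable_funM => //; exact: measurable_indic.
have psiE n x : E x -> psi n x = phi n x.
  by move=> Ex; rewrite /psi indicE mem_set// mulr1.
have cv x : cvgn (psi^~ x).
  have [Ex|Ex] := pselect (E x); last first.
    apply/cvg_ex; exists 0; rewrite (_ : (psi^~ x) = fun=> 0); first exact: cvg_cst.
    by apply/funext => n; rewrite /psi indicE memNset// mulr0.
  rewrite (_ : (psi^~ x) = phi^~ x); last by apply/funext => n; rewrite psiE.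
  rewrite (_ : (phi^~ x) = (fun n => phi 0%N x + series (telescope (phi^~ x)) n)).
    apply: is_cvgD; first exact: is_cvg_cst.
    apply: normed_cvg.
    (* The added 1 ensures K^2 >= G x, so that 4^n a_n^2 <= G x yields |a_n| <= K 2^-n. *)
    pose K := 1 + fine (G x).
    have K1 : 1 <= K by rewrite lerDl fine_ge0.
    apply: (@series_le_cvg _ _ (geometric K 2^-1)).
    - by move=> n; exact: normr_ge0.
    - by move=> n; rewrite /geometric/= mulr_ge0 ?exprn_ge0// (le_trans ler01).
    - move=> n; rewrite /geometric/= /telescope/=.
      rewrite exprVn ler_pdivlMr ?exprn_gt0//.
      have gn : 4 ^+ n * a n x ^+ 2 <= fine (G x).
        rewrite -lee_fin fineK ?ge0_fin_numE//.
        have := @nneseries_lim_ge R (g^~ x) xpredT 0 n.+1 (fun k _ _ => g0 k x).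
        apply: le_trans; rewrite big_nat_recr//= leeDr// sume_ge0//.
      rewrite -ler_sqr ?nnegrE ?mulr_ge0 ?exprn_ge0 ?(le_trans ler01 K1)//.
      rewrite exprMn real_normK ?num_real// -exprM mulnC exprM.
      rewrite (_ : 2 ^+ 2 = 4 :> R); last by rewrite -natrX.
      rewrite mulrC (le_trans gn)// (_ : fine (G x) = K - 1); last by rewrite /K addrC addKr.
      by nra.
    - apply: is_cvg_geometric_series; rewrite ger0_norm//.
      by rewrite invf_lt1// ltr1n.
  by apply/funext => n; rewrite -eq_sum_telescope.
pose v x := limn (psi^~ x).
have mv : measurable_fun [set: T] v by apply: (measurable_fun_cvg mpsi) => x _; exact: cv.
have vphi n : (\int[mu]_x ((v x - phi n x) ^+ 2)%:E <= (C * 8^-1 ^+ n)%:E)%E.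
  rewrite (_ : integral _ _ _ = \int[mu]_x limn_einf (fun m => ((psi (n + m)%N x - psi n x) ^+ 2)%:E))%E.
    apply: (le_trans (fatou mu measurableT _ _)).
    - move=> m; apply/measurable_EFinP; apply: measurable_funX; exact: measurable_funB.
    - by move=> m x _; rewrite lee_fin sqr_ge0.
    apply: limn_einf_le => m.
    have := cphi n (n + m)%N (leq_addr _ _); rewrite -lee_fin ipE//.
    apply: le_trans; apply: ge0_ae_le_integral_nonmeas => [x|x|].
    - by rewrite lee_fin sqr_ge0.
    - by rewrite lee_fin sqr_ge0.
    - by apply: filterS aeE => x Ex; rewrite !psiE.
  apply: ae_eq_integral_nonmeas; apply: filterS aeE => x Ex.
  have c1 : (fun m => ((psi (n + m)%N x - psi n x) ^+ 2)%:E) @ \oo --> ((v x - phi n x) ^+ 2)%:E.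
    apply: cvg_EFin; first exact: nearW.
    rewrite psiE//.
    have c2 : (fun m => psi (n + m)%N x - phi n x) @ \oo --> v x - phi n x.
      apply: cvgB; last exact: cvg_cst.
      have : (psi^~ x) @ \oo --> v x by exact: cv.
      rewrite -(cvg_shiftn n); apply: cvg_trans; apply: near_eq_cvg.
      by apply: nearW => m; rewrite /= addnC.
    by rewrite expr2; under eq_fun do rewrite expr2; exact: cvgM.
  by have [-> _] := cvg_limn_einf_sup c1.
have sv n : sqint mu (fun x => v x - phi n x).
  split; first exact: measurable_funB.
  exact: le_lt_trans (vphi n) (ltry _).
exists v => [|n]; last by rewrite -lee_fin ipE.
have := sqintD (sv 0%N) (sphi 0%N); congr sqint.
by apply/funext => x; rewrite subrK.
Qed.

(* Maximize 2 l f - |f|^2 over S: by the parallelogram law a maximizing sequence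
   is Cauchy, and its L2 limit represents l on S. *)
Lemma riesz_subspace (S : set (T -> R)) (l : (T -> R) -> R) (A : R) :
  S (fun=> 0) -> (forall f, S f -> sqint mu f) ->
  (forall f g (c : R), S f -> S g -> S (fun x => f x + c * g x)) ->
  (forall f g (c : R), S f -> S g -> l (fun x => f x + c * g x) = l f + c * l g) ->
  (forall f, S f -> 2 * l f <= A + ip mu f f) ->
  exists2 v, sqint mu v & forall f, S f -> l f = ip mu v f.
Proof.
move=> S0 Ssq SD lD lA.
pose I f := 2 * l f - ip mu f f.
have supI : has_sup [set I f | f in S].
  split; first by exists (I (fun=> 0)); exists (fun=> 0).
  by exists A => _ [f Sf <-]; rewrite /I lerBlDr lA.
pose s := sup [set I f | f in S].
have Is f : S f -> I f <= s by move=> Sf; apply: sup_upper_bound => //; exists f.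
have /choice[phi phiP] n : exists f, S f /\ s - 8^-1 ^+ n < I f.
  have [] := @sup_adherent _ [set I f | f in S] (8^-1 ^+ n) _ supI.
    by rewrite exprn_gt0.
  by move=> _ [f Sf <-] h; exists f.
have Sphi n := (phiP n).1; have sphi n := Ssq _ (Sphi n).
have IE f g c : S f -> S g ->
    I (fun x => f x + c * g x) = I f + 2 * c * (l g - ip mu f g) - c ^+ 2 * ip mu g g.
  move=> Sf Sg; have sf := Ssq _ Sf; have sg := Ssq _ Sg.
  have scg := sqintZ c sg; have sfg := sqintD sf scg.
  rewrite /I lD// ipDl// ![ip mu _ (fun x => f x + _)]ipC !ipDl//.
  rewrite !ipZl// [ip mu f (fun x => c * _)]ipC [ip mu g (fun x => c * _)]ipC !ipZl//.
  by rewrite [ip mu g f]ipC; ring.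
have [|v sv vphi] := @fast_cauchy_L2_limit phi 4 sphi.
  move=> n m nm.
  have SB : S (fun x => phi m x + (-1) * phi n x) by exact: SD.
  (* The value of [I] at the midpoint of phi_m and phi_n is the mean of the two values plus N / 4,
     where N is the squared distance. It is at most s, and the two values exceed s - 8^-n, hence N
     <= 4 8^-n. *)
  have := Is _ (SD _ _ (- 2^-1) (Sphi m) SB); rewrite IE//.
  have := IE _ _ (-1) (Sphi m) SB.
  rewrite (_ : (fun x => phi m x + -1 * (phi m x + -1 * phi n x)) = phi n); last first.
    by apply/funext => x; ring.
  rewrite (_ : (fun x => phi m x - phi n x) = (fun x => phi m x + -1 * phi n x)); last first.
    by apply/funext => x; ring.
  have := (phiP n).2; have := (phiP m).2.
  have : 8^-1 ^+ m <= 8^-1 ^+ n :> R by rewrite ler_wiXn2l ?invr_ge0// invf_le1// ler1n.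
  move: (8^-1 ^+ m) (8^-1 ^+ n) => dm dn.
  set N := ip mu _ _; set L := l _ - ip mu _ _.
  move: N L (I (phi n)) (I (phi m)) => N L In Im; rewrite expr2 => *; lra.
exists v => // f Sf; have sf := Ssq _ Sf.
have key c : 2 * c * (l f - ip mu v f) <= 2 * c ^+ 2 * ip mu f f.
  (* Near-maximality of phi_n in the direction f costs 8^-n + c^2 |f|^2, and replacing phi_n by v
     costs 4 8^-n + c^2 |f|^2. *)
  have bnd n : 2 * c * (l f - ip mu v f) <= 2 * c ^+ 2 * ip mu f f + 5 * 8^-1 ^+ n.
    have := Is _ (SD _ _ c (Sphi n) Sf); rewrite IE//.
    have := (phiP n).2; have := vphi n.
    have := ip_AMGM (- c) (sqintB sv (sphi n)) sf.
    rewrite ipBl//; move: (8^-1 ^+ n) => dn.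
    by rewrite sqrrN => *; lra.
  apply/ler_addgt0Pr => e e0.
  have e5 : 0 < e / 5 by rewrite divr_gt0.
  have [n hn] : exists n, 8^-1 ^+ n <= e / 5 :> R.
    have : (fun n => 8^-1 ^+ n : R) @ \oo --> 0.
      by apply: cvg_expr; rewrite ger0_norm ?invr_ge0// invf_lt1// ltr1n.
    move=> /cvgrPdist_le /(_ _ e5)[n _ /(_ n (leqnn _))]/=.
    by rewrite sub0r normrN ger0_norm ?exprn_ge0 ?invr_ge0// => h; exists n.
  by apply: (le_trans (bnd n)); rewrite lerD2l; lra.
set D := l f - ip mu v f in key.
apply/eqP; rewrite -subr_eq0 -/D; apply/eqP; set N := ip mu f f in key.
have N0 : 0 <= N by exact: ip_ge0.
have N1 : 0 < N + 1 by rewrite ltr_wpDl.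
(* At this c the inequality becomes 0 <= - 2 D^2 / (N + 1)^2. *)
have := key (D / (N + 1)).
rewrite -subr_ge0 (_ : _ - _ = - 2 * D ^+ 2 / (N + 1) ^+ 2); last by field; rewrite gt_eqF.
rewrite -mulrA mulNr oppr_ge0 pmulr_rle0// pmulr_lle0 ?invr_gt0 ?exprn_gt0//.
by move=> D0; apply/eqP; rewrite -sqrf_eq0 eq_le D0 sqr_ge0.
Qed.

End riesz.

(** * Test functions and the Du Bois-Reymond lemma *)

Section test_functions.
Variables (R : realType) (d : nat).
Local Notation V := 'rV[R]_d.
Local Notation mu := (lebn R d).
Local Notation e_ i := (delta_mx ord0 i : V).
Implicit Type phi : V -> R^o.

Lemma smooth_continuous phi : smooth phi -> continuous phi.
Proof. by move=> /(_ [::])[]. Qed.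

Lemma smooth_measurable phi : smooth phi -> measurable_fun [set: V] (phi : V -> R).
Proof. by move=> /smooth_continuous; exact: measurable_continuous_rV. Qed.

Lemma test_function_support phi : test_function phi ->
  exists k : nat, forall x, phi x != 0 -> cube k x.
Proof.
move=> [_ /compact_bounded[M [_ hM]]].
pose k := Num.bound (`|M| + 1); exists k => x px; apply/cubeP.
have kM : `|M| + 1 <= k%:R by rewrite ltW// archi_boundP// addr_ge0.
apply/rV_norm_leP => //; apply: le_trans kM.
apply: hM; first by rewrite (le_lt_trans (ler_norm M))// ltrDl.
exact: subset_closure.
Qed.

Lemma test_function_bounded phi : test_function phi ->
  exists M : R, 0 <= M /\ forall x, `|phi x| <= M.
Proof.
move=> [sphi cphi].
have := @continuous_compact _ _ phi (closure [set x | phi x != 0]) _ cphi.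
have cw : {within closure [set x | phi x != 0], continuous phi}.
  by apply: continuous_subspaceT => x; exact: smooth_continuous.
move=> /(_ cw) /compact_bounded[M [_ hM]].
exists (`|M| + 1); split => [|x]; first by rewrite addr_ge0.
have [->|px] := eqVneq (phi x) 0; first by rewrite normr0 addr_ge0.
apply: (hM (`|M| + 1)); first by rewrite (le_lt_trans (ler_norm M))// ltrDl.
by exists x => //; exact: subset_closure.
Qed.

Lemma sqint_bounded_cube (f : V -> R) (M : R) (k : nat) : measurable_fun [set: V] f ->
  (forall x, `|f x| <= M) -> (forall x, f x != 0 -> cube k x) -> sqint mu f.
Proof.
move=> mf fM fk; split => //.
have M0 : 0 <= M by exact: (le_trans _ (fM 0)).
apply: (@le_lt_trans _ _ (\int[mu]_x ((M ^+ 2)%:E * (\1_(cube k) x)%:E))%E).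
  apply: ge0_le_integral => //.
  - by move=> x _; rewrite lee_fin sqr_ge0.
  - by apply/measurable_EFinP; exact: measurable_funX.
  - apply: measurable_funeM; apply/measurable_EFinP; apply: measurable_indic.
    exact: measurable_rV_box.
  move=> x _; rewrite -EFinM lee_fin.
  have [->|fx] := eqVneq (f x) 0; first by rewrite expr0n mulr_ge0 ?sqr_ge0.
  rewrite indicE mem_set ?mulr1; last exact: fk.
  by rewrite -real_normK ?num_real// ler_sqr ?nnegrE.
have mi : measurable_fun [set: V] (fun x => (\1_(cube k) x : R)%:E).
  by apply/measurable_EFinP; apply: measurable_indic; exact: measurable_rV_box.
rewrite ge0_integralZl//; last by rewrite lee_fin sqr_ge0.
rewrite integral_indic ?setIT//; last exact: measurable_rV_box.
by rewrite lte_mul_pinfty ?lee_fin ?sqr_ge0//; exact: cube_lty.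
Qed.

Lemma test_function_sqint phi : test_function phi -> sqint mu (phi : V -> R).
Proof.
move=> tphi; have [M [_ hM]] := test_function_bounded tphi.
have [k hk] := test_function_support tphi.
apply: (@sqint_bounded_cube _ M k) => //.
by apply: smooth_measurable; have [] := tphi.
Qed.

Lemma partial_support phi i : [set x | partial i phi x != 0] `<=` closure [set x | phi x != 0].
Proof.
move=> x /= px; apply: contrapT => ncl; move/eqP: px; apply.
have ox : open (~` closure [set x | phi x != 0]) by rewrite openC; exact: closed_closure.
rewrite /partial -(derive_cst (0 : R^o) x (e_ i)); apply: near_eq_derive.
have : \forall y \near x, (~` closure [set x | phi x != 0]) y by exact: open_nbhs_nbhs.
apply: filterS => y ny; apply/eqP; apply: contrapT => /negP h; apply: ny.
exact: subset_closure.
Qed.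

Lemma test_function_partial phi i : test_function phi -> test_function (partial i phi).
Proof.
move=> [sphi cphi]; split; first exact: smooth_partial.
apply: (subclosed_compact _ cphi); first exact: closed_closure.
have cc : closed (closure [set x | phi x != 0]) by exact: closed_closure.
rewrite [X in _ `<=` X](closure_id _).1//.
by apply: closure_subset; exact: partial_support.
Qed.

Lemma test_function_partials phi s : test_function phi -> test_function (partials s phi).
Proof. by move=> tphi; elim: s => //= i s IH; exact: test_function_partial. Qed.

Lemma partials_lin s phi psi (c : R) : smooth phi -> smooth psi ->
  partials s (fun x => phi x + c * psi x : R^o) =
  (fun x => partials s phi x + c * partials s psi x).
Proof.
move=> sphi spsi; elim: s => //= i s ->; apply/funext => x.
rewrite {1}/partial; have [_ /(_ i x) d1] := sphi s; have [_ /(_ i x) d2] := spsi s.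
rewrite (_ : (fun y => _) = partials s phi + c *: partials s psi)//.
by rewrite deriveD ?deriveZ//; exact: derivableZ.
Qed.

Lemma smooth_lin phi psi (c : R) : smooth phi -> smooth psi ->
  smooth (fun x => phi x + c * psi x : R^o).
Proof.
move=> sphi spsi s; rewrite partials_lin//.
have [c1 d1] := sphi s; have [c2 d2] := spsi s; split.
  move=> x; apply: (@continuousD _ _ _ (partials s phi) (fun x => c * partials s psi x : R^o)).
    exact: c1.
  apply: (@continuousM R V (cst c) (partials s psi : V -> R)); first exact: cst_continuous.
  exact: c2.
move=> i x; rewrite (_ : (fun y => _) = partials s phi + c *: partials s psi)//.
by apply: derivableD => //; exact: derivableZ.
Qed.

Lemma test_function_lin phi psi (c : R) : test_function phi -> test_function psi ->
  test_function (fun x => phi x + c * psi x : R^o).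
Proof.
move=> tphi tpsi; split; first by apply: smooth_lin; [case: tphi|case: tpsi].
have [k hk] := test_function_support tphi; have [l hl] := test_function_support tpsi.
pose m := maxn k l.
apply: (@compact_closure_box _ _ (const_mx (- m%:R)) (const_mx m%:R)).
have sub (k' : nat) (x : V) : (k' <= m)%N -> cube k' x -> cube m x.
  by move=> k'm /cubeP h; apply/cubeP => i; rewrite (le_trans (h i))// ler_nat.
move=> x /= h; suff : cube m x by [].
have [px|/hk] := eqVneq (phi x) 0; last by apply: sub; exact: leq_maxl.
apply: (sub l); first exact: leq_maxr.
by apply: hl; apply: contra_neq h => ->; rewrite px mulr0 addr0.
Qed.

Lemma partials_shift s phi (a : V) :
  partials s (fun x => phi (x + a) : R^o) = (fun x => partials s phi (x + a)).
Proof.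
elim: s => //= i s ->; apply/funext => x; rewrite /partial /derive.
by under eq_fun do rewrite /= -addrA.
Qed.

Lemma test_function_shift phi (a : V) : test_function phi ->
  test_function (fun x => phi (x + a) : R^o).
Proof.
move=> tphi; have [sphi _] := tphi; split => [s|].
  rewrite partials_shift; have [c dd] := sphi s; split.
    move=> x; apply: (@continuous_comp _ _ _ (fun y : V => y + a) (partials s phi)); last exact: c.
    by apply: (@continuousD _ _ _ (id : V -> V) (cst a)); [exact: cvg_id|exact: cst_continuous].
  move=> i x; have := dd i (x + a); rewrite /derivable.
  by under [in X in _ -> X]eq_fun do rewrite /= -addrA.
have [k hk] := test_function_support tphi.
apply: (@compact_closure_box _ _ (const_mx (- k%:R) - a) (const_mx k%:R - a)).
move=> x /= /hk h i; have := h i; rewrite !in_itv/= !mxE.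
by rewrite lerBlDr lerBrDr.
Qed.

Lemma test_function0 : test_function (cst 0 : V -> R^o).
Proof.
have t0 := @test_function_bump R d 0 0 0.
have := test_function_lin (-1) t0 t0; congr test_function.
by apply/funext => x; rewrite mulN1r subrr.
Qed.

Lemma test_function_dirderiv phi z : test_function phi ->
  test_function (dirderiv z phi : V -> R^o).
Proof.
move=> tphi; rewrite /dirderiv; elim: (index_enum 'I_d) => [|i s IH].
  by under eq_fun do rewrite big_nil; exact: test_function0.
under eq_fun do rewrite big_cons addrC.
by apply: test_function_lin => //; exact: test_function_partial.
Qed.

Lemma dirderiv_shift phi z (a : V) :
  dirderiv z (fun x => phi (x + a) : R^o) = (fun x => dirderiv z phi (x + a)).
Proof.
apply/funext => x; apply: eq_bigr => i _; congr (_ * _).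
by have /(congr1 (fun f => f x)) := partials_shift [:: i] phi a.
Qed.

Lemma L2P (u : V -> R) : L2 u <-> exists2 v, sqint mu v & {ae mu, forall x, u x = v x}.
Proof.
split => [[v /Lfun2P sv uv]|[v sv uv]]; exists v => //.
- by apply: filterS uv => x; exact.
- exact/Lfun2P.
- by apply: filterS uv => x.
Qed.

End test_functions.

Section density_measure.
Context d (T : measurableType d) (R : realType) (mu : {measure set T -> \bar R}).
Variable g : T -> \bar R.

Definition density_measure (A : set T) : \bar R := (\int[mu]_(x in A) g x)%E.

Hypotheses (g0 : forall x, (0 <= g x)%E) (mg : measurable_fun [set: T] g).

Let density0 : density_measure set0 = 0%E.
Proof. by rewrite /density_measure integral_set0. Qed.

Let density_ge0 A : (0 <= density_measure A)%E.
Proof. exact: integral_ge0. Qed.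

Let density_sigma_additive : semi_sigma_additive density_measure.
Proof.
move=> /= F mF tF mUF; rewrite /density_measure; apply: cvg_toP.
  apply: ereal_nondecreasing_is_cvgn => m n mn.
  by apply: lee_sum_nneg_natr => // k _ _; exact: integral_ge0.
by rewrite ge0_integral_bigcup//=; exact: measurable_funTS.
Qed.

HB.instance Definition _ := isMeasure.Build _ _ _ density_measure
  density0 density_ge0 density_sigma_additive.

End density_measure.

Section du_bois_reymond.
Variables (R : realType) (d : nat).
Local Notation V := 'rV[R]_d.
Local Notation mu := (lebn R d).

(** The positive and negative parts of D are densities of two finite measures that agree on boxes,
    hence on all Borel sets. *)
Lemma integral_boxes_eq0 (D : V -> R) : mu.-integrable [set: V] (EFin \o D) ->
  (forall a b, \int[mu]_(x in rV_box a b) (D x)%:E = 0)%E ->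
  {ae mu, forall x, D x = 0}.
Proof.
move=> iD D0; have mD : measurable_fun [set: V] (EFin \o D) by exact: measurable_int iD.
pose gp := (EFin \o D)^\+%E; pose gn := (EFin \o D)^\-%E.
have gp0 x : (0 <= gp x)%E by exact: funepos_ge0.
have gn0 x : (0 <= gn x)%E by exact: funeneg_ge0.
have mgp : measurable_fun [set: V] gp by exact: measurable_funepos.
have mgn : measurable_fun [set: V] gn by exact: measurable_funeneg.
have igp : (\int[mu]_x gp x < +oo)%E := integral_funepos_lt_pinfty measurableT iD.
have ign : (\int[mu]_x gn x < +oo)%E := integral_funeneg_lt_pinfty measurableT iD.
have gpA A : measurable A -> (\int[mu]_(x in A) gp x < +oo)%E.
  by move=> mA; apply: le_lt_trans igp; exact: ge0_subset_integral.
have gnA A : measurable A -> (\int[mu]_(x in A) gn x < +oo)%E.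
  by move=> mA; apply: le_lt_trans ign; exact: ge0_subset_integral.
pose pp : {measure set V -> \bar R} := density_measure mu gp.
pose pn : {measure set V -> \bar R} := density_measure mu gn.
have E A : measurable A -> (pp gp0 mgp A = pn gn0 mgn A).
  apply: rV_measure_unique => [a b|k]; last first.
    by apply: gpA; exact: measurable_rV_box.
  have mb := measurable_rV_box a b.
  have := D0 a b; rewrite integralE /= -/gp -/gn.
  have fn : (\int[mu]_(x in rV_box a b) gn x)%E \is a fin_num.
    by rewrite ge0_fin_numE ?gnA//; exact: integral_ge0.
  move=> /eqP; rewrite sube_eq ?add0e; first by move=> /eqP.
    by rewrite ge0_fin_numE ?gpA//; exact: integral_ge0.
  by rewrite fin_num_adde_defl.
have : ae_eq mu setT (EFin \o D) (cst 0%E).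
  apply: integral_ae_eq => // A _ mA; rewrite integral0 integralE.
  have := E A mA; rewrite /= /density_measure /gp /gn => ->.
  rewrite subee// ge0_fin_numE ?gnA//; exact: integral_ge0.
by apply: filterS => x /(_ I) [].
Qed.

(** Bumps converge boundedly to the indicator of a box, so by dominated convergence D has zero
    integral over every box. *)
Lemma du_bois_reymond (D : V -> R) : measurable_fun [set: V] D ->
  (forall k, mu.-integrable (cube k) (EFin \o D)) ->
  (forall phi : V -> R^o, test_function phi -> \int[mu]_x (D x * phi x)%:E = 0)%E ->
  {ae mu, forall x, D x = 0}.
Proof.
move=> mD iD D0.
have mE : measurable_fun [set: V] (EFin \o D) by exact/measurable_EFinP.
have mcube k : measurable (cube k : set V) by exact: measurable_rV_box.
have box0 a b : (\int[mu]_(x in rV_box a b) (D x)%:E = 0)%E.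
  have [ka hka] := mem_cube a; have [kb hkb] := mem_cube b.
  (* The supports of the bumps exceed the box by at most 1 / (n + 1) <= 1, whence the successor. *)
  pose k := (ka + kb).+1.
  have bk n x : bump n a b x != 0 -> cube k x.
    move=> /bump_support h; apply/cubeP => i; have := h i; rewrite in_itv/= !mxE.
    move/cubeP: hka => /(_ i); move/cubeP: hkb => /(_ i).
    have : n.+1%:R^-1 <= 1 :> R by rewrite invf_le1// ler1n.
    move: (n.+1%:R^-1) => e; rewrite /k -natr1 natrD.
    have : 0 <= ka%:R :> R by [].
    have : 0 <= kb%:R :> R by [].
    rewrite !ler_norml => ? ? ? /andP[? ?] /andP[? ?] /andP[? ?].
    by apply/andP; split; lra.
  pose g x : \bar R := `|(EFin \o D) x * (\1_(cube k) x)%:E|%E.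
  have ig : mu.-integrable [set: V] g.
    apply: integrable_abse; apply: (eq_integrable measurableT
      ((EFin \o D) \_ (cube k))) => [x _|].
      rewrite patchE indicE; case: ifP => _; first by rewrite mule1.
      by rewrite mule0.
    exact/(integrable_mkcond _ (mcube k)).
  have mb n : measurable_fun [set: V] (bump n a b).
    by apply: smooth_measurable; have [] := @test_function_bump R d n a b.
  have [|||||] := @dominated_convergence _ _ _ mu setT measurableT
      (fun n x => (D x * bump n a b x)%:E) (fun x => (D x * \1_(rV_box a b) x)%:E) g.
  - by move=> n; apply/measurable_EFinP; exact: measurable_funM.
  - apply/measurable_EFinP; apply: measurable_funM => //; apply: measurable_indic.
    exact: measurable_rV_box.
  - apply: aeW => x _; apply: cvg_EFin; first exact: nearW.
    by apply: cvgM; [exact: cvg_cst|exact: bump_cvg].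
  - exact: ig.
  - apply: aeW => x n _; rewrite /g /= lee_fin !normrM ler_wpM2l//.
    have [->|/bk kx] := eqVneq (bump n a b x) 0; first by rewrite normr0.
    rewrite [\1_(cube k) x]indicE mem_set// normr1 ger0_norm ?bump_le1//.
    exact: bump_ge0.
  move=> _ _; rewrite (_ : (fun n => _) = cst 0%E); last first.
    by apply/funext => n /=; apply: D0; exact: test_function_bump.
  move=> /cvg_lim h; have {}h := h _; rewrite lim_cst in h => //.
  rewrite integral_mkcond (_ : integral _ _ _ = \int[mu]_x (D x * \1_(rV_box a b) x)%:E)%E; last first.
    apply: eq_integral => x _; rewrite patchE indicE; case: ifP => _; first by rewrite mulr1.
    by rewrite mulr0.
  by rewrite -h.
(* D is only locally integrable. Its restriction to a cube is integrable, and integrates over a box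
   as D does over the intersection, again a box. *)
have key k : {ae mu, forall x, D x * \1_(cube k) x = 0}.
  apply: integral_boxes_eq0 => [|a b].
    apply: (eq_integrable measurableT ((EFin \o D) \_ (cube k))) => [x _|].
      rewrite patchE /= indicE; case: ifP => _; first by rewrite mulr1.
      by rewrite mulr0.
    exact/(integrable_mkcond _ (mcube k)).
  have [[p q] _ /= E] := setI_closed_boxes (ex_intro2 _ _ (a, b) I (erefl (rV_box a b)))
    (cube_boxes R d k).
  have := box0 p q; rewrite E integral_mkcondr => <-.
  apply: eq_integral => x _; rewrite patchE /= indicE; case: ifP => _; first by rewrite mulr1.
  by rewrite mulr0.
have := (ae_foralln key); apply: filterS => x hx.
have [k kx] := mem_cube x.
by have := hx k; rewrite indicE mem_set// mulr1.
Qed.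

End du_bois_reymond.

(** * Averages along segments *)

Section probability_l2.
Context d (T : measurableType d) (R : realType) (P : probability T R).

Lemma integral_probability_cst (c : \bar R) : (\int[P]_x c = c)%E.
Proof.
rewrite integral_cst// -[RHS]mule1; congr (_ * _)%E.
exact: probability_setT.
Qed.

Lemma probability_sqint_cst (c : R) : sqint P (fun=> c).
Proof.
by split => //; rewrite integral_probability_cst ltry.
Qed.

Lemma ip_cst1 (c : R) : ip P (fun=> c) (fun=> 1) = c.
Proof.
transitivity (\int[P]_t (c * 1)); first by [].
by rewrite mulr1 /Rintegral integral_probability_cst.
Qed.

Lemma ip1_sqr_le (X : T -> R) : sqint P X -> (ip P X (fun=> 1)) ^+ 2 <= ip P X X.
Proof.
move=> sX; have s1 := probability_sqint_cst 1.
have := ip_AMGM (ip P X (fun=> 1)) sX s1.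
rewrite ip_cst1 mulr1; lra.
Qed.

End probability_l2.

Section slide.
Variables (R : realType) (d : nat).
Local Notation V := 'rV[R]_d.
Local Notation mu := (lebn R d).
Local Notation P := (uniform_prob (@ltr01 R)).
Local Notation T01 := (measurableTypeR R).
Variable k : V.

(** The value of f at a uniformly random point of the segment [x, x + k]. For fixed x this is a
    random variable of t, to which Jensen and variance arguments apply. *)
Definition slide (f : V -> R) (p : V * T01) : R := f (p.1 + (p.2 : R) *: k).

Lemma measurable_slide (f : V -> R) : measurable_fun [set: V] f ->
  measurable_fun [set: V * T01] (slide f).
Proof.
move=> mf; apply: (measurableT_comp mf).
apply: measurable_rV_add; first exact: measurable_fst.
by apply: measurable_rV_scale => //; exact: measurable_snd.
Qed.

(** For each t the shift by t k preserves Lebesgue measure, and t ranges over a probability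
    space. *)
Lemma ge0_integral_slide (f : V -> R) : measurable_fun [set: V] f ->
  (forall x, 0 <= f x) ->
  (\int[mu \x P]_p (slide f p)%:E = \int[mu]_x (f x)%:E)%E.
Proof.
move=> mf f0; have mE : measurable_fun [set: V] (EFin \o f) by exact/measurable_EFinP.
rewrite fubini_tonelli2; last 2 first.
- by apply/measurable_EFinP; exact: measurable_slide.
- by move=> p; rewrite lee_fin; exact: f0.
rewrite /fubini_G /slide /=.
under eq_integral => t _.
  rewrite (ge0_integral_shift ((t : R) *: k) mE) => [|x]; last by rewrite lee_fin.
  over.
by rewrite integral_probability_cst.
Qed.

Lemma sqint_slide (f : V -> R) : sqint mu f -> sqint (mu \x P)%E (slide f).
Proof.
move=> [mf foo]; split; first exact: measurable_slide.
rewrite (_ : (fun p => _) = (fun p => (slide (fun x => f x ^+ 2) p)%:E))//.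
rewrite ge0_integral_slide//; first exact: measurable_funX.
by move=> x; rewrite sqr_ge0.
Qed.

Lemma ae_sqint_slide (f : V -> R) : sqint mu f ->
  {ae mu, forall x, sqint P (fun t => slide f (x, t))}.
Proof.
move=> sf; have [mf foo] := sqint_slide sf.
have mf2 : measurable_fun [set: V * T01] (fun p => (slide f p ^+ 2)%:E : \bar R).
  by apply/measurable_EFinP; exact: measurable_funX.
have f20 p : (0 <= (slide f p ^+ 2)%:E)%E by rewrite lee_fin sqr_ge0.
have : mu.-integrable [set: V] (fubini_F P (fun p => (slide f p ^+ 2)%:E)).
  apply/integrableP; split; first exact: measurable_fun_fubini_tonelli_F.
  under eq_integral do rewrite gee0_abs ?integral_ge0//.
  by rewrite -fubini_tonelli1.
move=> /(integrable_ae measurableT); apply: filterS => x /(_ I) h; split.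
  by apply: (measurableT_comp mf); exact: measurable_fun_pair.
by rewrite -ge0_fin_numE//; exact: integral_ge0.
Qed.

(** The mean is written as an inner product with 1 so that the [ip] lemmas apply to it. *)
Definition avg (f : V -> R) (x : V) : R := ip P (fun t => slide f (x, t)) (fun=> 1).

Lemma avgE (f : V -> R) x : avg f x = \int[P]_t slide f (x, t).
Proof. by apply: eq_Rintegral => t _; rewrite mulr1. Qed.

Lemma measurable_avg (f : V -> R) : measurable_fun [set: V] f ->
  measurable_fun [set: V] (avg f).
Proof.
move=> mf; have ms := measurable_slide mf.
rewrite (_ : avg f = fine \o (fun x => \int[P]_t (slide f (x, t))%:E)%E); last first.
  by apply/funext => x; rewrite avgE.
apply: measurableT_comp => //.
rewrite (_ : (fun x => _) = (fun x => fubini_F P ((EFin \o slide f)^\+) x -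
                                     fubini_F P ((EFin \o slide f)^\-) x))%E; last first.
  apply/funext => x; rewrite integralE; congr (_ - _)%E.
    by apply: eq_integral => t _; rewrite !funeposE.
  by apply: eq_integral => t _; rewrite !funenegE.
have mE : measurable_fun [set: V * T01] (EFin \o slide f) by exact/measurable_EFinP.
apply: emeasurable_funB; apply: measurable_fun_fubini_tonelli_F.
- exact: measurable_funepos.
- by move=> p; exact: funepos_ge0.
- exact: measurable_funeneg.
- by move=> p; exact: funeneg_ge0.
Qed.

Lemma ae_avg_sqr_le (f : V -> R) : sqint mu f ->
  {ae mu, forall x, ((avg f x) ^+ 2)%:E <= \int[P]_t (slide f (x, t) ^+ 2)%:E}%E.
Proof.
move=> sf; apply: filterS (ae_sqint_slide sf) => x sx.
by rewrite -ipE// lee_fin ip1_sqr_le.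
Qed.

Lemma integral_avg_sqr_le (f : V -> R) : sqint mu f ->
  (\int[mu]_x ((avg f x) ^+ 2)%:E <= \int[mu]_x (f x ^+ 2)%:E)%E.
Proof.
move=> sf; have [mf foo] := sf; have [msf _] := sqint_slide sf.
rewrite -(@ge0_integral_slide (fun x => f x ^+ 2)); last 2 first.
- exact: measurable_funX.
- by move=> x; rewrite sqr_ge0.
rewrite fubini_tonelli1; last 2 first.
- by apply/measurable_EFinP; exact: (measurable_funX 2 msf).
- by move=> p; rewrite lee_fin sqr_ge0.
apply: ge0_ae_le_integral_nonmeas => [x|x|].
- by rewrite lee_fin sqr_ge0.
- by apply: integral_ge0 => t _; rewrite lee_fin sqr_ge0.
exact: ae_avg_sqr_le.
Qed.

Lemma sqint_avg (f : V -> R) : sqint mu f -> sqint mu (avg f).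
Proof.
move=> sf; split; first by apply: measurable_avg; case: sf.
by apply: (le_lt_trans (integral_avg_sqr_le sf)); case: sf.
Qed.

End slide.

(** * Increments of Sobolev functions *)

Section sobolev_increments.
Variables (R : realType) (d : nat).
Local Notation V := 'rV[R]_d.
Local Notation mu := (lebn R d).
Local Notation P := (uniform_prob (@ltr01 R)).
Local Notation T01 := (measurableTypeR R).

Lemma integral_uniform01 (f : T01 -> R) : measurable_fun [set: T01] f ->
  (\int[P]_t (f t)%:E = \int[lebesgue_measure]_(t in `[0%R, 1%R]) (f t)%:E)%E.
Proof.
move=> mf; have mE : measurable_fun [set: T01] (EFin \o f) by exact/measurable_EFinP.
rewrite integralE [RHS]integralE.
rewrite (integral_uniform (@ltr01 R) (measurable_funepos mE)) => [|x]; last exact: funepos_ge0.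
rewrite (integral_uniform (@ltr01 R) (measurable_funeneg mE)) => [|x]; last exact: funeneg_ge0.
by rewrite subr0 invr1 !mul1e.
Qed.

Lemma smooth_increment (phi : V -> R^o) (k x : V) : smooth phi ->
  phi (x + k) - phi x = avg k (dirderiv k phi) x.
Proof.
move=> sphi.
have cD : continuous (dirderiv k phi : V -> R^o).
  rewrite /dirderiv; elim: (index_enum 'I_d) => [|i s IH].
    by under eq_fun do rewrite big_nil; exact: cst_continuous.
  under eq_fun do rewrite big_cons.
  move=> y; apply: (@continuousD _ _ _ (fun y => k ord0 i * partial i phi y : R^o)); last exact: IH.
  apply: (@continuousM R V (cst (k ord0 i)) (partial i phi : V -> R)); first exact: cst_continuous.
  exact: (smooth_continuous (smooth_partial i sphi)).
pose F (t : R) : R^o := phi (t *: k + x).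
pose f (t : R) : R := dirderiv k phi (t *: k + x).
have dF (t : R) : is_derive t (1 : R) F (f t).
  apply: (is_derive_line phi x k t _).1; exact: smooth_is_derive_dir.
have cline : continuous (fun t : R => t *: k + x).
  move=> t; apply: (@continuousD _ _ _ (fun t : R => t *: k) (cst x)); last exact: cst_continuous.
  exact: scalel_continuous.
have cf : continuous f.
  by move=> t; apply: (@continuous_comp _ _ _ (fun t : R => t *: k + x) (dirderiv k phi)); [exact: cline|exact: cD].
have cF : continuous F.
  by move=> t; apply: differentiable_continuous; apply/derivable1_diffP; have [] := dF t.
have := @continuous_FTC2 R f F 0 1 ltr01 _ _ _.
have h1 : {within `[0, 1], continuous f} by apply: continuous_subspaceT; exact: cf.
have h2 : derivable_oo_LRcontinuous F 0 1.
  split; [by move=> t _; have [] := dF t| |].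
  - by apply: cvg_at_right_filter; exact: cF.
  - by apply: cvg_at_left_filter; exact: cF.
have h3 : {in `]0, 1[, F^`()%classic =1 f}.
  by move=> t _; rewrite derive1E; have [_ ->] := dF t.
move=> /(_ h1 h2 h3) E.
have mf : measurable_fun [set: T01] f by exact: continuous_measurable_fun.
have := integral_uniform01 mf; rewrite E /F scale1r scale0r add0r -EFinB [k + x]addrC => E2.
have E3 : \int[P]_t f t = phi (x + k) - phi x by exact: (congr1 fine E2).
rewrite avgE; apply: etrans (esym E3) _.
by apply: eq_Rintegral => t _; rewrite /slide /f /= addrC.
Qed.

Lemma sqint_shift (f : V -> R) (a : V) : sqint mu f -> sqint mu (fun x => f (x + a)).
Proof.
move=> [mf foo]; split; first by apply: measurableT_comp => //; exact: measurable_shift.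
rewrite (@ge0_integral_shift _ _ a (fun x => (f x ^+ 2)%:E))//.
- by apply/measurable_EFinP; exact: measurable_funX.
- by move=> x; rewrite lee_fin sqr_ge0.
Qed.

Lemma ip_shift (f g : V -> R) (a : V) : measurable_fun [set: V] f -> measurable_fun [set: V] g ->
  ip mu (fun x => f (x + a)) g = ip mu f (fun x => g (x - a)).
Proof.
move=> mf mg; congr fine.
rewrite -[RHS](@integral_shift _ _ a); last first.
  apply/measurable_EFinP; apply: measurable_funM => //.
  by apply: measurableT_comp => //; exact: measurable_shift.
by apply: eq_integral => x _; rewrite addrK.
Qed.

Lemma ip_avg (f g : V -> R) (k : V) : sqint mu f -> sqint mu g ->
  ip mu f (avg k g) = \int[P]_t ip mu f (fun x => g (x + (t : R) *: k)).
Proof.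
move=> sf sg.
have sf0 : sqint (mu \x P)%E (fun p : V * T01 => f p.1).
  have := sqint_slide 0 sf; congr sqint.
  by apply/funext => p; rewrite /slide scaler0 addr0.
have ifg := sqint_mul_integrable sf0 (sqint_slide k sg).
have := Fubini ifg => /= F.
congr fine; transitivity (\int[mu]_x \int[P]_t (f x * slide k g (x, t))%:E)%E.
  apply: ae_eq_integral_nonmeas; apply: filterS (ae_sqint_slide k sg) => x sx.
  have i1 : P.-integrable [set: T01] (fun t => (slide k g (x, t))%:E).
    have := sqint_mul_integrable sx (probability_sqint_cst _ 1).
    by apply: eq_integrable => // t _; rewrite mulr1.
  under [RHS]eq_integral do rewrite EFinM.
  rewrite integralZl// EFinM avgE /Rintegral fineK//.
  exact: integrable_fin_num.
rewrite F; apply: eq_integral => t _; rewrite /ip /Rintegral fineK//.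
apply: integrable_fin_num => //.
exact: (sqint_mul_integrable sf (sqint_shift ((t : R) *: k) sg)).
Qed.

(** By Fubini and translation invariance, a shift by t k moves to the other factor as a shift by - t
    k. *)
Lemma avg_adjoint (f g : V -> R) (k : V) : sqint mu f -> sqint mu g ->
  ip mu f (avg (- k) g) = ip mu (avg k f) g.
Proof.
move=> sf sg; rewrite (ip_avg _ sf sg) [RHS]ipC (ip_avg _ sg sf).
apply: eq_Rintegral => t _; rewrite [RHS]ipC ip_shift; [|by case: sf|by case: sg].
by congr ip; apply/funext => x; rewrite scalerN.
Qed.

Lemma sqint_integrable_cube (f : V -> R) j : sqint mu f ->
  mu.-integrable (cube j) (EFin \o f).
Proof.
move=> sf; have mc : measurable (cube j : set V) by exact: measurable_rV_box.
apply/(integrable_mkcond _ mc).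
have s1 : sqint mu (\1_(cube j) : V -> R).
  have mi : measurable_fun [set: V] (\1_(cube j) : V -> R) by exact: measurable_indic.
  apply: (sqint_bounded_cube (M := 1) (k := j) mi) => x.
    by rewrite indicE; case: (_ \in _); rewrite ?normr1 ?normr0.
  by rewrite indicE; case: (boolP (x \in cube j)) => [/set_mem//|]; rewrite eqxx.
have := sqint_mul_integrable sf s1; apply: eq_integrable => // x _.
rewrite patchE indicE /=; case: ifP => _; first by rewrite mulr1.
by rewrite mulr0.
Qed.

Lemma dirderivN (phi : V -> R^o) k x : dirderiv (- k) phi x = - dirderiv k phi x.
Proof. by rewrite /dirderiv -sumrN; apply: eq_bigr => i _; rewrite mxE mulNr. Qed.

Definition weak_dirderiv (k : V) (u w : V -> R) := forall phi : V -> R^o,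
  test_function phi -> ip mu u (dirderiv k phi) = - ip mu w phi.

(** By duality with the smooth case. Tested against phi, the increment of u becomes the increment of
    phi along - k, which is an average of shifts of its derivative along - k. The definition of w,
    applied to each shifted test function, turns the pairing into that of [avg k w] with phi. *)
Lemma sobolev_increment (u w : V -> R) (k : V) : sqint mu u -> sqint mu w ->
  weak_dirderiv k u w -> {ae mu, forall x, u (x + k) - u x = avg k w x}.
Proof.
move=> su sw uw.
pose D x := u (x + k) - u x - avg k w x.
have sD : sqint mu D by apply: sqintB; [apply: sqintB => //; exact: sqint_shift|exact: sqint_avg].
have : {ae mu, forall x, D x = 0}.
  apply: du_bois_reymond; [by case: sD|by move=> j; exact: sqint_integrable_cube|].
  move=> phi tphi; have sphi := test_function_sqint tphi.
  have [smphi _] := tphi; have mphi := smooth_measurable smphi.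
  have iD := sqint_mul_integrable sD sphi.
  suff ip0 : ip mu D phi = 0.
    transitivity ((ip mu D phi)%:E); last by rewrite ip0.
    rewrite /ip /Rintegral fineK//.
    exact: (integrable_fin_num measurableT iD).
  have suk := sqint_shift k su; have sphik := sqint_shift (- k) sphi.
  rewrite /D ipBl//; [|exact: sqintB|exact: sqint_avg].
  rewrite ipBl// ip_shift//; last by case: su.
  rewrite [ip mu u (fun x => _)]ipC [ip mu u phi]ipC -ipBl//.
  have sdk := test_function_sqint (test_function_dirderiv k tphi).
  have sdNk := test_function_sqint (test_function_dirderiv (- k) tphi).
  rewrite (_ : (fun x => phi (x - k) - phi x) = avg (- k) (dirderiv (- k) phi)); last first.
    by apply/funext => x; exact: smooth_increment.
  rewrite ipC -[ip mu (avg k w) phi]avg_adjoint// !ip_avg//.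
  apply/eqP; rewrite subr_eq0; apply/eqP; apply: eq_Rintegral => t _.
  have ts := test_function_shift ((t : R) *: - k) tphi.
  have := uw _ ts; rewrite dirderiv_shift => h.
  transitivity (- ip mu u (fun x => dirderiv k phi (x + (t : R) *: - k))); last by rewrite h opprK.
  transitivity (- ip mu (fun x => dirderiv k phi (x + (t : R) *: - k)) u); last by rewrite ipC.
  rewrite ipC -(ipNl (sqint_shift _ sdk) su).
  by congr ip; apply/funext => x; rewrite dirderivN.
by apply: filterS => x /eqP; rewrite subr_eq0 => /eqP.
Qed.

End sobolev_increments.

(** * Even extension of the integrand and Taylor bounds *)

Section half_line_calculus.
Variable R : realType.
Implicit Types f g : R -> R.

Lemma is_derive_eps f (t l : R) :
  (forall e : R, 0 < e -> exists2 r : R, 0 < r & forall h : R, h != 0 -> `|h| < r ->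
     `|l - h^-1 * (f (t + h) - f t)| <= e) ->
  is_derive t (1 : R) (f : R -> R^o) l.
Proof.
move=> H.
have c : (fun h : R => h^-1 *: (((f : R -> R^o) \o shift t) (h *: (1 : R^o)) - f t : R^o)) @ 0^' -->
    (l : R^o).
  apply/cvgrPdist_le => e e0; have [r r0 hr] := H e e0.
  near=> h; rewrite /= [h%:A]mulr1 [h + t]addrC; apply: hr.
    by near: h; exact: nbhs_dnbhs_neq.
  by near: h; exact: dnbhs0_lt.
apply: DeriveDef; first by apply/cvg_ex; exists l.
exact: cvg_lim c.
Unshelve. all: by end_near. Qed.

Lemma derivable_half_eps f (t : R) : derivable_half f t ->
  forall e : R, 0 < e -> exists2 r : R, 0 < r & forall s : R, 0 <= s -> s != t -> `|s - t| < r ->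
    `|derive_half f t - (f s - f t) / (s - t)| <= e.
Proof.
move=> df e e0.
have /cvgrPdist_le /(_ e e0) H : (fun s => (f s - f t) / (s - t)) @
    within `[0, +oo[%classic t^' --> derive_half f t by exact: df.
move: H; rewrite !near_withinE => /nbhs_ballP[r /= r0 hr].
exists r => // s s0 st sr; apply: hr => //.
- by rewrite /ball/= distrC.
- by rewrite /= in_itv/= s0.
Qed.

(** The even extension for [sg] = 1 and the odd one for [sg] = -1. *)
Definition parity_ext (sg : R) g (t : R) : R := if 0 <= t then g t else sg * g (- t).

(** Differentiation exchanges even and odd. At 0 the condition on [g 0] gives continuity, and the
    one on [derive_half g 0] makes the two one-sided derivatives agree. *)
Lemma is_derive_parity_ext (sg : R) g :
  sg ^+ 2 = 1 -> sg * g 0 = g 0 -> - sg * derive_half g 0 = derive_half g 0 ->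
  (forall t, 0 <= t -> derivable_half g t) ->
  forall t, is_derive t (1 : R) (parity_ext sg g : R -> R^o)
              (parity_ext (- sg) (derive_half g) t).
Proof.
move=> sg2 sg0 sgd dg t; apply: is_derive_eps => e e0.
have sg1 : `|sg| = 1.
  by apply/eqP; rewrite -sqrp_eq1 ?normr_ge0// real_normK ?num_real// sg2.
have [t0|t0|->] := ltgtP t 0.
- have t'0 : 0 <= - t by rewrite oppr_ge0 ltW.
  have [r r0 hr] := derivable_half_eps (dg _ t'0) e0.
  exists (Num.min r (- t)); first by rewrite lt_min r0 oppr_gt0.
  move=> h h0; rewrite lt_min => /andP[hr1 ht].
  have th : t + h < 0.
    by move: ht; rewrite ltr_norml => /andP[_ ?]; lra.
  rewrite /parity_ext [0 <= t + h]leNgt [0 <= t]leNgt th t0 /=.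
  have := hr (- (t + h)); rewrite oppr_ge0 (ltW th) => /(_ isT).
  have -> : - (t + h) - - t = - h by ring.
  rewrite normrN hr1; have -> : (- (t + h) != - t) by apply: contra_neq h0; move=> /oppr_inj; lra.
  move=> /(_ isT isT).
  have -> : - sg * derive_half g (- t) - h^-1 * (sg * g (- (t + h)) - sg * g (- t)) =
    (- sg) * (derive_half g (- t) - (g (- (t + h)) - g (- t)) / - h) by field.
  by rewrite normrM normrN sg1 mul1r.
- have [r r0 hr] := derivable_half_eps (dg _ (ltW t0)) e0.
  exists (Num.min r t); first by rewrite lt_min r0.
  move=> h h0; rewrite lt_min => /andP[hr1 ht].
  have th : 0 <= t + h.
    by move: ht; rewrite ltr_norml => /andP[? _]; lra.
  rewrite /parity_ext th (ltW t0).
  have := hr (t + h) th.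
  have -> : t + h - t = h by ring.
  rewrite hr1; have -> : (t + h != t) by apply: contra_neq h0; lra.
  by move=> /(_ isT isT); rewrite mulrC.
- have [r r0 hr] := derivable_half_eps (dg _ (lexx 0)) e0.
  exists r => // h h0 hr1; rewrite /parity_ext lexx add0r.
  have [h1|h1] := leP 0 h.
    by have := hr h h1 h0; rewrite subr0 => /(_ hr1); rewrite mulrC.
  have := hr (- h); rewrite subr0 normrN oppr_ge0 (ltW h1) oppr_eq0 h0 => /(_ isT isT hr1).
  have -> : derive_half g 0 - h^-1 * (sg * g (- h) - g 0) =
     - sg * (derive_half g 0 - (g (- h) - g 0) / (- h)).
    by rewrite -[in LHS]sgd -[in LHS]sg0; field.
  by rewrite normrM normrN sg1 mul1r.
Qed.

Lemma mvt_between f (df : R -> R) (a b : R) : (forall t, is_derive t (1 : R) (f : R -> R^o) (df t)) ->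
  exists2 c, 0 <= (c - a) * (b - c) & f b - f a = df c * (b - a).
Proof.
move=> fdf.
have cf (A : set R) : {within A, continuous (f : R -> R^o)}.
  apply: continuous_subspaceT => t; apply: differentiable_continuous.
  by apply/derivable1_diffP; have [] := fdf t.
have [ab|/ltW ba] := leP a b.
  have [c] := MVT_segment ab (fun t _ => fdf t) (cf _).
  rewrite in_itv/= => /andP[? ?] E; exists c => //.
  by rewrite mulr_ge0 ?subr_ge0.
have [c] := MVT_segment ba (fun t _ => fdf t) (cf _).
rewrite in_itv/= => /andP[? ?] E; exists c.
  by rewrite -mulrNN !opprB mulr_ge0 ?subr_ge0.
by rewrite -opprB E -mulrN opprB.
Qed.

(** Subtract the quadratic q with value F m, slope P m and second derivative m0. The mean value
    theorem for F - q, then for P, gives a remainder (Q c' - m0) (c - m) (a - m). As c lies between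
    m and a, whatever their order, the last two factors have a nonnegative product. *)
Lemma taylor_lower_bound F P Q (m0 : R) :
  (forall t, is_derive t (1 : R) (F : R -> R^o) (P t)) ->
  (forall t, is_derive t (1 : R) (P : R -> R^o) (Q t)) ->
  (forall t, m0 <= Q t) ->
  forall a m, F m + P m * (a - m) + m0 / 2 * (a - m) ^+ 2 <= F a.
Proof.
move=> dF dP mQ a m.
pose q : {poly R} := (F m)%:P + (P m)%:P * ('X - m%:P) + (m0 / 2)%:P * (('X - m%:P) * ('X - m%:P)).
pose G t := F t - q.[t].
have dG t : is_derive t (1 : R) (G : R -> R^o) (P t - q^`().[t]) by exact: is_deriveB.
have qE t : q.[t] = F m + P m * (t - m) + m0 / 2 * (t - m) ^+ 2.
  by rewrite /q !hornerE.
have dqE t : q^`().[t] = P m + m0 * (t - m).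
  rewrite /q !(derivD, derivM, derivN, derivC, derivX).
  rewrite !(hornerD, hornerM, hornerN, hornerC, hornerX, horner0).
  by rewrite /=; field.
have [c hc] := mvt_between m a dG.
rewrite {1 2}/G !qE subrr mulr0 expr0n/= mulr0 !addr0 subrr subr0 dqE.
have [c' _ E'] := mvt_between m c dP.
move=> E; rewrite -subr_ge0 E.
have -> : P c - (P m + m0 * (c - m)) = (Q c' - m0) * (c - m).
  by rewrite mulrBl -E'; ring.
rewrite -mulrA mulr_ge0 ?subr_ge0//.
by have := sqr_ge0 (c - m); nra.
Qed.

Lemma taylor_bounds F P Q (m0 C : R) :
  (forall t, is_derive t (1 : R) (F : R -> R^o) (P t)) ->
  (forall t, is_derive t (1 : R) (P : R -> R^o) (Q t)) ->
  (forall t, m0 <= Q t <= C) ->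
  forall a m, F m + P m * (a - m) + m0 / 2 * (a - m) ^+ 2 <= F a <=
              F m + P m * (a - m) + C / 2 * (a - m) ^+ 2.
Proof.
move=> dF dP mQC a m; apply/andP; split.
  by apply: taylor_lower_bound dF dP _ _ _ => t; have /andP[] := mQC t.
have dF' t : is_derive t (1 : R) (\- F : R -> R^o) (- P t) by exact: is_deriveN.
have dP' t : is_derive t (1 : R) (\- P : R -> R^o) (- Q t) by exact: is_deriveN.
have Q' t : - C <= - Q t by rewrite lerN2; have /andP[] := mQC t.
have := taylor_lower_bound dF' dP' Q' a m => /=.
lra.
Qed.

(** The even extension F(t) = f |t| is twice differentiable on the whole line because f' vanishes at
    0. Its second derivative stays between gamma and C, and the witness [P] is its odd first
    derivative. *)
Lemma admissible_integrand_bounds f : admissible_integrand f -> bounded_second_derivative f ->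
  exists (gamma C : R) (P : R -> R), [/\ 0 < gamma, 0 <= C, P 0 = 0,
    continuous ((fun t => f `|t|) : R -> R^o) &
    forall a m, f `|m| + P m * (a - m) + gamma / 2 * (a - m) ^+ 2 <= f `|a| <=
                f `|m| + P m * (a - m) + C / 2 * (a - m) ^+ 2].
Proof.
move=> [f0 [df d2f _] f00 df00 [gamma gamma0 hgamma]] [C hC].
pose P := parity_ext (-1) (derive_half f).
pose Q := parity_ext 1 (derive_half (derive_half f)).
have fE : (fun t => f `|t|) = parity_ext 1 f.
  apply/funext => t; rewrite /parity_ext mul1r; case: ifPn => t0; first by rewrite ger0_norm.
  by rewrite ltr0_norm// ltNge.
have dF t : is_derive t (1 : R) ((fun t => f `|t|) : R -> R^o) (P t).
  rewrite fE; apply: is_derive_parity_ext => //; rewrite ?expr1n ?mul1r//.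
  by rewrite df00 mulr0.
have dP t : is_derive t (1 : R) (P : R -> R^o) (Q t).
  have -> : Q = parity_ext (- -1) (derive_half (derive_half f)) by rewrite opprK.
  apply: is_derive_parity_ext => //; rewrite ?sqrrN ?expr1n ?opprK ?mul1r//.
  by rewrite df00 mulr0.
have QC t : gamma <= Q t <= C.
  have key s : 0 <= s -> gamma <= derive_half (derive_half f) s <= C.
    by move=> s0; rewrite hgamma// (le_trans (ler_norm _))// hC.
  rewrite /Q /parity_ext mul1r; case: ifPn => t0; first exact: key.
  by apply: key; rewrite oppr_ge0 ltW// ltNge.
exists gamma, C, P; split => //.
- exact: le_trans (hC 0 (lexx 0)).
- by rewrite /P /parity_ext lexx.
- by move=> t; apply: differentiable_continuous; apply/derivable1_diffP; have [] := dF t.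
- by move=> a m; exact: (taylor_bounds dF dP QC).
Qed.

End half_line_calculus.

(** * The gap in Jensen's inequality *)

Section jensen_gap.
Context d (T : measurableType d) (R : realType) (P : probability T R).
Variables (F F' : R -> R) (c1 c2 : R).
Hypotheses (F_ge0 : forall t, 0 <= F t) (F'0 : F' 0 = 0) (F0 : F 0 = 0).
Hypothesis mF : measurable_fun [set: R] F.
Hypothesis FE : forall a m, F m + F' m * (a - m) + c1 / 2 * (a - m) ^+ 2 <= F a <=
                            F m + F' m * (a - m) + c2 / 2 * (a - m) ^+ 2.

Lemma F_le_sqr a : F a <= c2 / 2 * a ^+ 2.
Proof. by have /andP[_] := FE a 0; rewrite F0 F'0 mul0r !add0r subr0. Qed.

Lemma integrable_F (X : T -> R) : sqint P X -> P.-integrable [set: T] (fun t => (F (X t))%:E).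
Proof.
move=> sX; have [mX _] := sX.
have := integrableZl measurableT (c2 / 2) (sqint_sqr_integrable sX).
apply: le_integrable => //.
  by apply/measurable_EFinP; apply: measurableT_comp.
move=> t _; rewrite /= lee_fin ger0_norm//.
exact: (le_trans (F_le_sqr _) (ler_norm _)).
Qed.

Lemma Rintegral_quadratic (X : T -> R) (m b c : R) : sqint P X -> m = ip P X (fun=> 1) ->
  let q t := F m + b * (X t - m) + c * (X t - m) ^+ 2 in
  P.-integrable [set: T] (EFin \o q) /\
  \int[P]_t q t = F m + c * ip P (fun t => X t - m) (fun t => X t - m).
Proof.
move=> sX mE q.
have s1 := probability_sqint_cst P 1.
have sm := probability_sqint_cst P m.
have sXm := sqintB sX sm.
have i0 : P.-integrable [set: T] (EFin \o (fun=> F m)).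
  have := sqint_mul_integrable (probability_sqint_cst P (F m)) s1.
  by apply: eq_integrable => // t _; rewrite /= mulr1.
have i1 : P.-integrable [set: T] (EFin \o (fun t => X t - m)).
  have := sqint_mul_integrable sXm s1.
  by apply: eq_integrable => // t _; rewrite /= mulr1.
have i2 : P.-integrable [set: T] (EFin \o (fun t => (X t - m) ^+ 2)).
  exact: sqint_sqr_integrable.
have ib1 : P.-integrable [set: T] (EFin \o (fun t => b * (X t - m))).
  by have := integrableZl measurableT b i1; apply: eq_integrable.
have ic2 : P.-integrable [set: T] (EFin \o (fun t => c * (X t - m) ^+ 2)).
  by have := integrableZl measurableT c i2; apply: eq_integrable.
have i01 : P.-integrable [set: T] (EFin \o (fun t => F m + b * (X t - m))).
  by have := integrableD measurableT i0 ib1; apply: eq_integrable.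
split; first by have := integrableD measurableT i01 ic2; apply: eq_integrable.
rewrite RintegralD// RintegralD// !RintegralZl//.
have -> : \int[P]_t (X t - m) = 0.
  transitivity (ip P (fun t => X t - m) (fun=> 1)).
    by apply: eq_Rintegral => t _; rewrite mulr1.
  by rewrite (ipBl sX sm s1) -mE ip_cst1 subrr.
have -> : \int[P]_t F m = F m by rewrite /Rintegral integral_probability_cst.
by rewrite mulr0 addr0.
Qed.

(** The Taylor bounds at the mean m are integrated; the linear term has integral 0 and the quadratic
    one gives the variance. *)
Lemma jensen_gap (X : T -> R) (m : R) : sqint P X -> m = ip P X (fun=> 1) ->
  ((F m + c1 / 2 * ip P (fun t => X t - m) (fun t => X t - m))%:E <=
     \int[P]_t (F (X t))%:E <=
   (F m + c2 / 2 * ip P (fun t => X t - m) (fun t => X t - m))%:E)%E.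
Proof.
move=> sX mE; have iF := integrable_F sX.
have [i1 <-] := Rintegral_quadratic (F' m) (c1 / 2) sX mE.
have [i2 <-] := Rintegral_quadratic (F' m) (c2 / 2) sX mE.
rewrite /Rintegral !fineK; [|exact: integrable_fin_num..].
apply/andP; split.
  apply: le_integral => // t _; rewrite lee_fin.
  by have /andP[] := FE (X t) m.
apply: le_integral => // t _; rewrite lee_fin.
by have /andP[] := FE (X t) m.
Qed.

(** X - m is orthogonal to constants, so the square of X - c splits without a cross term. *)
Lemma variance_le (X : T -> R) (m c : R) : sqint P X -> m = ip P X (fun=> 1) ->
  ip P (fun t => X t - m) (fun t => X t - m) <= ip P (fun t => X t - c) (fun t => X t - c).
Proof.
move=> sX mE.
have s1 := probability_sqint_cst P 1.
have sm := probability_sqint_cst P m.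
have sXm := sqintB sX sm; have smc := probability_sqint_cst P (m - c).
rewrite (_ : (fun t => X t - c) = (fun t => (X t - m) + (m - c) * 1)); last first.
  by apply/funext => t; rewrite mulr1 addrA subrK.
have smc1 := sqintZ (m - c) s1.
have sD := sqintD sXm smc1.
rewrite (ip_sqrD sXm smc1) [X in 2 * X](_ : _ = 0) ?mulr0 ?addr0 ?lerDl ?ip_ge0//.
by rewrite ipC (ipZl _ s1 sXm) ipC (ipBl sX sm s1) -mE ip_cst1 subrr mulr0.
Qed.

End jensen_gap.

Section energy_gap.
Variables (R : realType) (d : nat).
Local Notation V := 'rV[R]_d.
Local Notation mu := (lebn R d).
Local Notation P := (uniform_prob (@ltr01 R)).
Local Notation T01 := (measurableTypeR R).
Variables (F F' : R -> R) (c1 c2 : R).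
Hypotheses (F_ge0 : forall t, 0 <= F t) (F'0 : F' 0 = 0) (F0 : F 0 = 0).
Hypotheses (c1_ge0 : 0 <= c1) (c2_ge0 : 0 <= c2).
Hypothesis mF : measurable_fun [set: R] F.
Hypothesis FE : forall a m, F m + F' m * (a - m) + c1 / 2 * (a - m) ^+ 2 <= F a <=
                            F m + F' m * (a - m) + c2 / 2 * (a - m) ^+ 2.

(** [v] stands for [avg k w] but is kept separate: in the application it is a difference quotient,
    equal to the average only almost everywhere. *)
Definition deviation (k : V) (w v : V -> R) : \bar R :=
  (\int[mu]_x \int[P]_t ((slide k w (x, t) - v x) ^+ 2)%:E)%E.

(** By translation invariance the integral of F(w) is that of the means of F(w) over the segments
    [x, x + k], to which [jensen_gap] applies for almost every x. *)
Lemma energy_gap (k : V) (w v : V -> R) : sqint mu w -> measurable_fun [set: V] v ->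
  {ae mu, forall x, v x = avg k w x} ->
  (\int[mu]_x (F (v x))%:E + (c1 / 2)%:E * deviation k w v <= \int[mu]_x (F (w x))%:E /\
   \int[mu]_x (F (w x))%:E <= \int[mu]_x (F (v x))%:E + (c2 / 2)%:E * deviation k w v)%E.
Proof.
move=> sw mv vw; have [mw _] := sw.
have msw := measurable_slide k mw.
have mFw : measurable_fun [set: V] (fun x => F (w x)) by exact: measurableT_comp.
have EFw : (\int[mu]_x (F (w x))%:E = \int[mu]_x \int[P]_t (F (slide k w (x, t)))%:E)%E.
  have mFs : measurable_fun [set: V * T01] (fun p => (F (slide k w p))%:E : \bar R).
    by apply/measurable_EFinP; exact: (measurableT_comp mF msw).
  rewrite -(ge0_integral_slide k mFw)//.
  by rewrite (fubini_tonelli1 _ mFs) => [|p]; rewrite ?lee_fin.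
have mFv : measurable_fun [set: V] (fun x => (F (v x))%:E).
  by apply/measurable_EFinP; exact: measurableT_comp.
have mdev : measurable_fun [set: V * T01] (fun p => ((slide k w p - v p.1) ^+ 2)%:E : \bar R).
  apply/measurable_EFinP; apply: measurable_funX; apply: measurable_funB => //.
  exact: (measurableT_comp mv).
pose dev x := (\int[P]_t ((slide k w (x, t) - v x) ^+ 2)%:E)%E.
have mdevx : measurable_fun [set: V] dev.
  by apply: (measurable_fun_fubini_tonelli_F _ mdev) => p; rewrite lee_fin sqr_ge0.
have dev0 x : (0 <= dev x)%E by apply: integral_ge0 => t _; rewrite lee_fin sqr_ge0.
have key : {ae mu, forall x,
    ((F (v x))%:E + (c1 / 2)%:E * dev x <= \int[P]_t (F (slide k w (x, t)))%:E)%E /\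
    (\int[P]_t (F (slide k w (x, t)))%:E <= (F (v x))%:E + (c2 / 2)%:E * dev x)%E}.
  have := ae_sqint_slide k sw; move: vw; apply: filterS2 => x vx sx.
  have /andP[] := jensen_gap F_ge0 F'0 F0 mF FE sx vx.
  rewrite !EFinD !EFinM ipE; last first.
    by apply: sqintB => //; exact: probability_sqint_cst.
  by [].
have addint (c : R) : 0 <= c ->
    (\int[mu]_x (F (v x))%:E + c%:E * deviation k w v = \int[mu]_x ((F (v x))%:E + c%:E * dev x))%E.
  move=> c0; rewrite ge0_integralD//; last 3 first.
  - by move=> x _; rewrite lee_fin.
  - by move=> x _; rewrite mule_ge0.
  - exact: measurable_funeM.
  by rewrite ge0_integralZl.
have c10 : 0 <= c1 / 2 by rewrite divr_ge0.
have c20 : 0 <= c2 / 2 by rewrite divr_ge0.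
have Fs0 x : (0 <= \int[P]_t (F (slide k w (x, t)))%:E)%E.
  by apply: integral_ge0 => t _; rewrite lee_fin.
have Fc0 c x : 0 <= c -> (0 <= (F (v x))%:E + c%:E * dev x)%E.
  by move=> cge0; rewrite adde_ge0 ?lee_fin ?mule_ge0.
rewrite EFw !addint//; split; apply: ge0_ae_le_integral_nonmeas => //.
- by move=> x; exact: Fc0.
- by apply: filterS key => x [].
- by move=> x; exact: Fc0.
- by apply: filterS key => x [].
Qed.

End energy_gap.

(** * The energies as integrals over directions *)

Section euclidean_norm.
Variables (R : realType) (d : nat).
Implicit Types x y z : 'rV[R]_d.

Lemma dotpZl (c : R) x y : dotp (c *: x) y = c * dotp x y.
Proof. by rewrite /dotp mulr_sumr; apply: eq_bigr => i _; rewrite mxE mulrA. Qed.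

Lemma dotpC x y : dotp x y = dotp y x.
Proof. by apply: eq_bigr => i _; rewrite mulrC. Qed.

Lemma dotp_ge0 x : 0 <= dotp x x.
Proof. by apply: sumr_ge0 => i _; rewrite -expr2 sqr_ge0. Qed.

Lemma enorm_ge0 x : 0 <= enorm x.
Proof. exact: sqrtr_ge0. Qed.

Lemma sqr_enorm x : enorm x ^+ 2 = dotp x x.
Proof. by rewrite sqr_sqrtr// dotp_ge0. Qed.

Lemma enormZ (c : R) x : 0 <= c -> enorm (c *: x) = c * enorm x.
Proof.
move=> c0; rewrite /enorm dotpZl dotpC dotpZl mulrA -expr2.
by rewrite sqrtrM ?sqr_ge0// sqrtr_sqr ger0_norm.
Qed.

Lemma coord_le_enorm x (i : 'I_d) : `|x ord0 i| <= enorm x.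
Proof.
rewrite -ler_sqr ?nnegrE ?enorm_ge0// sqr_enorm real_normK ?num_real//.
rewrite /dotp (bigD1 i)//= -expr2 lerDl; apply: sumr_ge0 => j _.
by rewrite -expr2 sqr_ge0.
Qed.

Lemma enorm_eq0 x : enorm x = 0 -> x = 0.
Proof.
move=> x0; apply/rowP => i; rewrite mxE; apply/eqP; rewrite -normr_le0.
by rewrite (le_trans (coord_le_enorm x i))// x0.
Qed.

Lemma direction_coord_le1 x (i : 'I_d) : `|direction x ord0 i| <= 1.
Proof.
rewrite mxE normrM normfV [`|enorm x|]ger0_norm ?enorm_ge0//.
have [->|x0] := eqVneq (enorm x) 0; first by rewrite invr0 mul0r.
by rewrite ler_pdivrMl ?lt0r ?x0 ?enorm_ge0// mulr1 coord_le_enorm.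
Qed.

Lemma enorm_direction x : enorm x *: direction x = x.
Proof.
rewrite scalerA; have [x0|x0] := eqVneq (enorm x) 0.
  by rewrite (enorm_eq0 x0) scaler0.
by rewrite mulfV// scale1r.
Qed.

End euclidean_norm.

Section energies_as_integrals.
Variables (R : realType) (d : nat).
Local Notation V := 'rV[R]_d.
Local Notation mu := (lebn R d).
Local Notation P := (uniform_prob (@ltr01 R)).

Definition dirgrad (g : 'I_d -> V -> R) (k x : V) : R := \sum_(i < d) k ord0 i * g i x.

(** Written as the increment of c u with c = 1 / (h |z|), the form to which [sobolev_increment]
    applies. At z = 0 the inverse is 0, which agrees with [direction 0] = 0. *)
Definition diffquot (u : V -> R) (h : R) (z x : V) : R :=
  (h * enorm z)^-1 * u (x + h *: z) - (h * enorm z)^-1 * u x.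

Lemma measurable_diffquot (u : V -> R) (h : R) : measurable_fun [set: V] u ->
  measurable_fun [set: V * V] (fun p => diffquot u h p.1 p.2).
Proof.
move=> mu'.
have mc : measurable_fun [set: V * V] (fun p : V * V => (h * enorm p.1)^-1 : R).
  have me : measurable_fun [set: V * V] (fun p : V * V => h * enorm p.1).
    apply: measurable_funM => //.
    by apply: measurable_enorm; exact: measurable_fst.
  exact: (measurableT_comp (@measurable_invr R) me).
apply: measurable_funB; apply: measurable_funM => //.
  apply: (measurableT_comp mu'); apply: measurable_rV_add; first exact: measurable_snd.
  by apply: measurable_rV_scale => //; exact: measurable_fst.
by apply: (measurableT_comp mu'); exact: measurable_snd.
Qed.

Lemma measurable_dirgrad (g : 'I_d -> V -> R) : (forall i, measurable_fun [set: V] (g i)) ->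
  measurable_fun [set: V * V] (fun p => dirgrad g (direction p.1) p.2).
Proof.
move=> mg; apply: measurable_sum => i; apply: measurable_funM.
  apply: measurable_rV_coor; apply: measurable_direction; exact: measurable_fst.
by apply: (measurableT_comp (mg i)); exact: measurable_snd.
Qed.

Lemma integral_swap_kernel (K : V -> R) (G : V -> V -> R) : (forall z, 0 <= K z) ->
  measurable_fun [set: V] K -> (forall z x, 0 <= G z x) ->
  measurable_fun [set: V * V] (fun p => G p.1 p.2) ->
  (\int[mu]_x \int[mu]_z (K z * G z x)%:E = \int[mu]_z ((K z)%:E * \int[mu]_x (G z x)%:E))%E.
Proof.
move=> K0 mK G0 mG.
pose H (p : V * V) := (K p.1 * G p.1 p.2)%:E : \bar R.
have mH : measurable_fun [set: V * V] H.
  apply/measurable_EFinP; apply: measurable_funM => //.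
  by apply: (measurableT_comp mK); exact: measurable_fst.
have H0 p : (0 <= H p)%E by rewrite lee_fin mulr_ge0.
have := fubini_tonelli H mH H0; rewrite /fubini_F /fubini_G /H /= => <-.
apply: eq_integral => z _; under eq_integral do rewrite EFinM.
have mGz : measurable_fun [set: V] (fun x => (G z x)%:E).
  apply/measurable_EFinP.
  by have := measurableT_comp mG (@measurable_pair1 _ _ V V z); exact.
by rewrite ge0_integralZl// => *; rewrite lee_fin.
Qed.

Variables (K K' : V -> R) (f : R -> R) (u u' : V -> R).
Hypotheses (K_ge0 : forall z, 0 <= K z) (K'_ge0 : forall z, 0 <= K' z).
Hypotheses (mK' : measurable_fun [set: V] K') (KK' : {ae mu, forall z, K z = K' z}).
Hypotheses (mu' : measurable_fun [set: V] u') (uu' : {ae mu, forall x, u x = u' x}).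
Hypotheses (f_ge0 : forall t, 0 <= t -> 0 <= f t).
Hypothesis mf : measurable_fun [set: R] (fun t => f `|t|).

(** The substitution y = x + h z cancels the factor h^-d of the rescaled kernel; Tonelli then puts
    the integral over z outside. *)
Lemma F_nonlocalE (h : R) : 0 < h ->
  (F_nonlocal K f h u = \int[mu]_z ((K' z)%:E * \int[mu]_x (f `|diffquot u' h z x|)%:E))%E.
Proof.
move=> h0; have hd0 : 0 <= h ^- d by rewrite invr_ge0 exprn_ge0// ltW.
have fq0 t (x : V) : 0 <= f (`|t| / enorm x) by rewrite f_ge0// divr_ge0// enorm_ge0.
rewrite -integral_swap_kernel//; last first.
- by apply: (measurableT_comp mf); exact: measurable_diffquot.
- by move=> z x; exact: f_ge0.
rewrite /F_nonlocal; apply: ge0_ae_eq_integral_nonmeas => [x|x|].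
- by apply: integral_ge0 => y _; rewrite lee_fin !mulr_ge0.
- by apply: integral_ge0 => z _; rewrite lee_fin mulr_ge0// f_ge0.
apply: filterS uu' => x ux.
pose G y : \bar R := (h ^- d * K' (h^-1 *: (y - x)) * f `|(u' y - u' x) / enorm (y - x)|)%:E.
have mG : measurable_fun [set: V] G.
  have mB : measurable_fun [set: V] (fun y => y - x) by exact: measurable_shift.
  apply/measurable_EFinP; apply: measurable_funM.
    apply: measurable_funM => //; apply: (measurableT_comp mK').
    exact: measurable_rV_scale.
  apply: (measurableT_comp mf); apply: measurable_funM; first exact: measurable_funB.
  exact: (measurableT_comp (@measurable_invr R) (measurable_enorm mB)).
transitivity (\int[mu]_y G y)%E.
  (* The kernel is evaluated at (y - x) / h, so the exceptional null set is pulled back by an affine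
     map in y. *)
  have aK := ae_affine (- (h^-1 *: x)) (_ : 0 < h^-1) KK'.
  have {}aK := aK _; rewrite invr_gt0 h0 in aK; have {}aK := aK isT.
  apply: ge0_ae_eq_integral_nonmeas => [y|y|].
  - by rewrite lee_fin !mulr_ge0.
  - by rewrite lee_fin !mulr_ge0// f_ge0.
  move: uu' aK; apply: filterS2 => y uy Ky.
  rewrite /G /rescaled_kernel uy ux normrM normfV [`|enorm _|]ger0_norm ?enorm_ge0//.
  by rewrite scalerBr Ky.
have G0 y : (0 <= G y)%E by rewrite lee_fin !mulr_ge0// f_ge0.
have := ge0_integral_affine x h0 mG G0.
have hn : h ^+ d != 0 by rewrite expf_neq0// gt_eqF.
move=> E; have {}E : (\int[mu]_y G y = (h ^+ d)%:E * \int[mu]_z G (h *: z + x)%R)%E.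
  by rewrite E muleA -EFinM mulfV// mul1e.
rewrite E -ge0_integralZl//; last 2 first.
- exact: (measurableT_comp mG (measurable_affine h x)).
- by rewrite lee_fin exprn_ge0// ltW.
apply: eq_integral => z _; rewrite /G -EFinM; congr EFin.
rewrite addrK scalerA mulVf ?gt_eqF// scale1r !mulrA mulfV// mul1r; congr (_ * f `|_|).
rewrite /diffquot [h *: z + x]addrC enormZ ?ltW//.
by rewrite mulrC mulrBr.
Qed.

Variable g : 'I_d -> V -> R.
Hypothesis mg : forall i, measurable_fun [set: V] (g i).
Hypothesis gE : {ae mu, forall x, forall i, weak_gradient u x ord0 i = g i x}.

Lemma F_localE :
  (F_local K f u = \int[mu]_z ((K' z)%:E * \int[mu]_x (f `|dirgrad g (direction z) x|)%:E))%E.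
Proof.
rewrite -integral_swap_kernel//; last first.
- by apply: (measurableT_comp mf); exact: measurable_dirgrad.
- by move=> z x; exact: f_ge0.
apply: ge0_ae_eq_integral_nonmeas => [x|x|].
- by apply: integral_ge0 => y _; rewrite lee_fin mulr_ge0// f_ge0.
- by apply: integral_ge0 => z _; rewrite lee_fin mulr_ge0// f_ge0.
apply: filterS gE => x gx.
apply: ge0_ae_eq_integral_nonmeas => [z|z|].
- by rewrite lee_fin mulr_ge0// f_ge0.
- by rewrite lee_fin mulr_ge0// f_ge0.
apply: filterS KK' => z ->; congr (_ * f `|_|)%:E.
by apply: eq_bigr => i _; rewrite gx mulrC.
Qed.

End energies_as_integrals.

(** * Weak gradients and the comparison of the energies *)

Section weak_derivatives.
Variables (R : realType) (d : nat).
Local Notation V := 'rV[R]_d.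
Local Notation mu := (lebn R d).
Implicit Types (u v w : V -> R) (g : 'I_d -> V -> R).

Lemma weak_partials_ip (s : seq 'I_d) u u' v v' : sqint mu u' -> sqint mu v' ->
  {ae mu, forall x, u x = u' x} -> {ae mu, forall x, v x = v' x} ->
  weak_partials s u v <-> forall phi : V -> R^o, test_function phi ->
    ip mu u' (partials s phi) = (-1) ^+ size s * ip mu v' phi.
Proof.
move=> su sv uu vv.
have E (a a' : V -> R) (phi : V -> R^o) : sqint mu a' -> {ae mu, forall x, a x = a' x} ->
    test_function phi -> (\int[mu]_x (a x * phi x)%:E = (ip mu a' phi)%:E)%E.
  move=> sa aa tphi; rewrite /ip /Rintegral fineK; last first.
    apply: integrable_fin_num => //.
    exact: (sqint_mul_integrable sa (test_function_sqint tphi)).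
  by apply: ae_eq_integral_nonmeas; apply: filterS aa => x ->.
split=> H phi tphi.
  have := H phi tphi; rewrite (E _ _ _ su uu (test_function_partials s tphi)) (E _ _ _ sv vv tphi).
  by rewrite -EFinM => -[].
rewrite (E _ _ _ su uu (test_function_partials s tphi)) (E _ _ _ sv vv tphi).
by rewrite H// EFinM.
Qed.

Definition is_weak_gradient u g := forall (i : 'I_d) (phi : V -> R^o), test_function phi ->
  ip mu u (partial i phi) = - ip mu (g i) phi.

(** Membership in H^1 makes the set of weak derivatives nonempty, so [xget] returns one of them.
    That choice is only almost everywhere equal to a Borel function, whence the separate [g]. *)
Lemma sobolev1_representatives u : sobolev 1 u -> exists u' g,
  [/\ sqint mu u', {ae mu, forall x, u x = u' x}, forall i, sqint mu (g i),
      {ae mu, forall x, forall i, weak_gradient u x ord0 i = g i x} & is_weak_gradient u' g].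
Proof.
move=> [/L2P[u' su' uu'] hu].
have hg (i : 'I_d) : exists g1 : V -> R, [/\ sqint mu g1, {ae mu, forall x, weak_gradient u x ord0 i = g1 x} &
    forall phi : V -> R^o, test_function phi -> ip mu u' (partial i phi) = - ip mu g1 phi].
  pose S := [set v : V -> R | L2 v /\ weak_partials [:: i] u v].
  have [v Lv wv] := hu [:: i] (leqnn _).
  have [Lx wx] : S (xget (fun=> 0) S) by apply: (xgetPex (fun=> 0)); exists v.
  have [g sg xg] := (L2P _).1 Lx.
  exists g; split => //; first by apply: filterS xg => x; rewrite mxE.
  move=> phi tphi; have := (weak_partials_ip [:: i] su' sg uu' xg).1 wx phi tphi.
  by rewrite /= expr1 mulN1r.
have [g hg'] := choice hg.
exists u', g; split => //.
- by move=> i; have [] := hg' i.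
- by apply: filter_forall => i; have [] := hg' i.
- by move=> i; have [_ _] := hg' i.
Qed.

Lemma sqint_dirgrad g k : (forall i, sqint mu (g i)) -> sqint mu (dirgrad g k).
Proof. by move=> sg; apply: sqint_sum => i; exact: sqintZ. Qed.

Lemma weak_dirderiv_dirgrad u g k : sqint mu u -> (forall i, sqint mu (g i)) ->
  is_weak_gradient u g -> weak_dirderiv k u (dirgrad g k).
Proof.
move=> su sg ug phi tphi.
have sp i := test_function_sqint (test_function_partial i tphi).
have sphi := test_function_sqint tphi.
rewrite /dirderiv ip_sumr//; last by move=> i; exact: sqintZ.
rewrite [ip mu (dirgrad g k) phi]ipC /dirgrad ip_sumr//; last by move=> i; exact: sqintZ.
rewrite -sumrN; apply: eq_bigr => i _.
rewrite ipC (ipZl _ (sp i) su) ipC ug// [ip mu phi _]ipC (ipZl _ (sg i) sphi).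
by rewrite mulrN.
Qed.

Lemma dirgradZ g c k x : dirgrad g (c *: k) x = c * dirgrad g k x.
Proof. by rewrite /dirgrad mulr_sumr; apply: eq_bigr => i _; rewrite mxE mulrA. Qed.

Lemma weak_dirderivZ c k u w : sqint mu u -> sqint mu w -> weak_dirderiv k u w ->
  weak_dirderiv k (fun x => c * u x) (fun x => c * w x).
Proof.
move=> su sw uw phi tphi.
have sphi := test_function_sqint tphi.
have sd := test_function_sqint (test_function_dirderiv k tphi).
by rewrite (ipZl _ su sd) (ipZl _ sw sphi) uw// mulrN.
Qed.

(** [sobolev_increment] is applied to c u along h z with c = 1 / (h |z|), and c h z = [direction z],
    at z = 0 as well. *)
Lemma ae_diffquot_avg u g (h : R) (z : V) : sqint mu u -> (forall i, sqint mu (g i)) ->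
  is_weak_gradient u g -> 0 < h ->
  {ae mu, forall x, diffquot u h z x = avg (h *: z) (dirgrad g (direction z)) x}.
Proof.
move=> su sg ug h0.
pose c := (h * enorm z)^-1.
have sw := sqint_dirgrad (h *: z) sg.
have := sobolev_increment (sqintZ c su) (sqintZ c sw)
  (weak_dirderivZ c su sw (weak_dirderiv_dirgrad (h *: z) su sg ug)).
apply: filterS => x; rewrite /diffquot => ->.
congr avg; apply/funext => y; rewrite -dirgradZ; congr dirgrad.
by rewrite scalerA /c invfM mulrAC mulVf ?gt_eqF// mul1r.
Qed.

End weak_derivatives.

Section energy_sandwich.
Variables (R : realType) (d : nat).
Local Notation V := 'rV[R]_d.
Local Notation mu := (lebn R d).
Local Notation P := (uniform_prob (@ltr01 R)).
Local Notation T01 := (measurableTypeR R).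
Variables (F F' : R -> R) (c1 c2 : R).
Hypotheses (F_ge0 : forall t, 0 <= F t) (F'0 : F' 0 = 0) (F0 : F 0 = 0).
Hypotheses (c1_ge0 : 0 <= c1) (c2_ge0 : 0 <= c2).
Hypothesis mF : measurable_fun [set: R] F.
Hypothesis FE : forall a m, F m + F' m * (a - m) + c1 / 2 * (a - m) ^+ 2 <= F a <=
                            F m + F' m * (a - m) + c2 / 2 * (a - m) ^+ 2.
Variables (K : V -> R) (u : V -> R) (g : 'I_d -> V -> R).
Hypotheses (K_ge0 : forall z, 0 <= K z) (mK : measurable_fun [set: V] K).
Hypotheses (su : sqint mu u) (sg : forall i, sqint mu (g i)) (ug : is_weak_gradient u g).

Definition dev (h : R) (z : V) : \bar R :=
  deviation (h *: z) (dirgrad g (direction z)) (diffquot u h z).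

Lemma dev_ge0 h z : (0 <= dev h z)%E.
Proof.
by apply: integral_ge0 => x _; apply: integral_ge0 => t _; rewrite lee_fin sqr_ge0.
Qed.

Lemma measurable_dev h : measurable_fun [set: V] (dev h).
Proof.
have mu' : measurable_fun [set: V] u by case: su.
have mg i : measurable_fun [set: V] (g i) by case: (sg i).
pose w z x := dirgrad g (direction z) x.
pose H (p : (V * V) * T01) : \bar R :=
  ((w p.1.1 (p.1.2 + (p.2 : R) *: (h *: p.1.1)) - diffquot u h p.1.1 p.1.2) ^+ 2)%:E.
have mfst : measurable_fun [set: (V * V) * T01] (fun p => p.1.1).
  exact: (measurableT_comp measurable_fst measurable_fst).
have msnd : measurable_fun [set: (V * V) * T01] (fun p => p.1.2).
  exact: (measurableT_comp measurable_snd measurable_fst).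
have mH : measurable_fun [set: (V * V) * T01] H.
  apply/measurable_EFinP; apply: measurable_funX; apply: measurable_funB.
    have mq : measurable_fun [set: (V * V) * T01]
        (fun p => (p.1.1, p.1.2 + (p.2 : R) *: (h *: p.1.1))).
      apply: measurable_fun_pair => //; apply: measurable_rV_add => //.
      apply: measurable_rV_scale; first exact: measurable_snd.
      by apply: measurable_rV_scale.
    exact: (measurableT_comp (measurable_dirgrad mg) mq).
  exact: (measurableT_comp (measurable_diffquot h mu') measurable_fst).
have H0 p : (0 <= H p)%E by rewrite lee_fin sqr_ge0.
have m1 := measurable_fun_fubini_tonelli_F (m2 := P) H mH H0.
have m10 p : (0 <= fubini_F P H p)%E by exact: integral_ge0.
exact: (measurable_fun_fubini_tonelli_F (m2 := mu) _ m1 m10).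
Qed.

Let FhK h := (\int[mu]_z ((K z)%:E * \int[mu]_x (F (diffquot u h z x))%:E))%E.
Let F0K := (\int[mu]_z ((K z)%:E * \int[mu]_x (F (dirgrad g (direction z) x))%:E))%E.
Let devK h := (\int[mu]_z ((K z)%:E * dev h z))%E.

(** [energy_gap] is applied for each z with w = grad u . direction z and k = h z, then integrated
    against K. Sums replace differences, so no finiteness has to be known at this stage. *)
Lemma energy_sandwich (h : R) : 0 < h ->
  (FhK h + (c1 / 2)%:E * devK h <= F0K /\ F0K <= FhK h + (c2 / 2)%:E * devK h)%E.
Proof.
move=> h0.
have mu' : measurable_fun [set: V] u by case: su.
have mg i : measurable_fun [set: V] (g i) by case: (sg i).
have mKE : measurable_fun [set: V] (EFin \o K) by exact/measurable_EFinP.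
have mq : measurable_fun [set: V * V] (fun p => (F (diffquot u h p.1 p.2))%:E : \bar R).
  by apply/measurable_EFinP; exact: (measurableT_comp mF (measurable_diffquot h mu')).
have mA : measurable_fun [set: V] (fun z => (K z)%:E * \int[mu]_x (F (diffquot u h z x))%:E)%E.
  apply: emeasurable_funM => //.
  by apply: (measurable_fun_fubini_tonelli_F (m2 := mu) _ mq) => p; rewrite lee_fin.
have mD : measurable_fun [set: V] (fun z => (K z)%:E * dev h z)%E.
  by apply: emeasurable_funM => //; exact: measurable_dev.
have A0 z : (0 <= (K z)%:E * \int[mu]_x (F (diffquot u h z x))%:E)%E.
  by rewrite mule_ge0 ?lee_fin// integral_ge0// => x _; rewrite lee_fin.
have D0 z : (0 <= (K z)%:E * dev h z)%E by rewrite mule_ge0 ?lee_fin ?dev_ge0.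
have B0 z : (0 <= (K z)%:E * \int[mu]_x (F (dirgrad g (direction z) x))%:E)%E.
  by rewrite mule_ge0 ?lee_fin// integral_ge0// => x _; rewrite lee_fin.
have addint (c : R) : 0 <= c -> (FhK h + c%:E * devK h =
    \int[mu]_z ((K z)%:E * (\int[mu]_x (F (diffquot u h z x))%:E + c%:E * dev h z)))%E.
  move=> c0; rewrite /FhK /devK -ge0_integralZl ?lee_fin// -ge0_integralD//.
  - apply: eq_integral => z _.
    have I0 : (0 <= \int[mu]_x (F (diffquot u h z x))%:E)%E.
      by apply: integral_ge0 => x _; rewrite lee_fin.
    have cD0 : (0 <= c%:E * dev h z)%E by rewrite mule_ge0 ?lee_fin ?dev_ge0.
    by rewrite (ge0_muleDr _ I0 cD0) [in RHS]muleCA.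
  - by move=> z _; rewrite mule_ge0 ?lee_fin.
  - exact: measurable_funeM.
have mqz z : measurable_fun [set: V] (diffquot u h z).
  by have := measurableT_comp (measurable_diffquot h mu') (@measurable_pair1 _ _ V V z); exact.
have gap z := energy_gap F_ge0 F'0 F0 c1_ge0 c2_ge0 mF FE (sqint_dirgrad (direction z) sg)
   (mqz z) (ae_diffquot_avg z su sg ug h0).
have c10 : 0 <= c1 / 2 by rewrite divr_ge0.
have c20 : 0 <= c2 / 2 by rewrite divr_ge0.
have S0 c z : 0 <= c ->
    (0 <= (K z)%:E * (\int[mu]_x (F (diffquot u h z x))%:E + c%:E * dev h z))%E.
  move=> c0; rewrite mule_ge0 ?lee_fin// adde_ge0 ?mule_ge0 ?lee_fin ?dev_ge0//.
  by apply: integral_ge0 => x _; rewrite lee_fin.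
rewrite !addint//; split; apply: ge0_ae_le_integral_nonmeas => //.
- by move=> z; exact: S0.
- by apply: aeW => z; rewrite lee_wpmul2l ?lee_fin//; have [] := gap z.
- by move=> z; exact: S0.
- by apply: aeW => z; rewrite lee_wpmul2l ?lee_fin//; have [] := gap z.
Qed.

(** Makes the difference of energies a subtraction of reals. The coordinates of a direction are at
    most 1 in absolute value, so |grad u . direction z| is at most the sum G of the |g_i|, and F
    grows at most quadratically. *)
Lemma local_energy_lty : (\int[mu]_z (K z)%:E < +oo)%E -> (F0K < +oo)%E.
Proof.
move=> Koo.
have mg i : measurable_fun [set: V] (g i) by case: (sg i).
pose G x := \sum_(i < d) `|g i x|.
have sG : sqint mu G.
  apply: sqint_sum => i; have [mgi oo] := sg i; split; first exact: measurableT_comp.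
  by under eq_integral do rewrite real_normK ?num_real//.
have [mG Goo] := sG.
have mKE : measurable_fun [set: V] (EFin \o K) by exact/measurable_EFinP.
pose C := (\int[mu]_x ((c2 / 2 * (G x) ^+ 2)%:E))%E.
have c20 : 0 <= c2 / 2 by rewrite divr_ge0.
have Coo : (C < +oo)%E.
  rewrite /C; under eq_integral do rewrite EFinM.
  rewrite ge0_integralZl ?lee_fin//; last 2 first.
  - by apply/measurable_EFinP; exact: measurable_funX.
  - by move=> x _; rewrite lee_fin sqr_ge0.
  by rewrite lte_mul_pinfty ?lee_fin.
have C0 : (0 <= C)%E by apply: integral_ge0 => x _; rewrite lee_fin mulr_ge0 ?sqr_ge0.
apply: (@le_lt_trans _ _ (\int[mu]_z ((K z)%:E * C))%E).
  apply: ge0_ae_le_integral_nonmeas => [z|z|].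
  - by rewrite mule_ge0 ?lee_fin// integral_ge0// => x _; rewrite lee_fin.
  - by rewrite mule_ge0 ?lee_fin.
  apply: aeW => z; rewrite lee_wpmul2l ?lee_fin//.
  apply: ge0_ae_le_integral_nonmeas => [x|x|].
  - by rewrite lee_fin.
  - by rewrite lee_fin mulr_ge0 ?sqr_ge0.
  apply: aeW => x; rewrite lee_fin (le_trans (F_le_sqr F'0 F0 FE _))// ler_wpM2l//.
  rewrite -real_normK ?num_real// ler_sqr ?nnegrE ?sumr_ge0//.
  rewrite (le_trans (ler_norm_sum _ _ _))//; apply: ler_sum => i _.
  by rewrite normrM ler_piMl// direction_coord_le1.
rewrite ge0_integralZr//; last by move=> z _; rewrite lee_fin.
by rewrite muleC lte_mul_pinfty// ge0_fin_numE.
Qed.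

End energy_sandwich.

(** * The deviation of a function in H^2 *)

Section second_derivative_bound.
Variables (R : realType) (d : nat).
Local Notation V := 'rV[R]_d.
Local Notation mu := (lebn R d).
Local Notation P := (uniform_prob (@ltr01 R)).
Local Notation T01 := (measurableTypeR R).

Lemma integral_sqr_uniform01 : (\int[P]_t (((t : R) ^+ 2)%:E) <= 1)%E.
Proof.
have mt : measurable_fun [set: T01] (fun t : T01 => ((t : R) ^+ 2)%:E : \bar R).
  by apply/measurable_EFinP; apply: measurable_funX; exact: measurable_id.
rewrite (integral_uniform _ mt) => [|t]; last by rewrite lee_fin sqr_ge0.
rewrite subr0 invr1 mul1e.
apply: (@le_trans _ _ (\int[lebesgue_measure]_(t in `[0%R, 1%R]) (1%R%:E : \bar R)))%E.
  apply: ge0_le_integral => //.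
  - by move=> t _; rewrite lee_fin sqr_ge0.
  - exact: measurable_funTS.
  - move=> t /=; rewrite in_itv/= => /andP[t0 t1].
    by rewrite lee_fin expr_le1.
by rewrite integral_cst//= lebesgue_measure_itv/= lte01 sube0 mul1e.
Qed.

Lemma integral_increment_sqr (w : V -> R) (G : 'I_d -> V -> R) (k : V) : sqint mu w ->
  (forall i, sqint mu (G i)) -> is_weak_gradient w G ->
  (\int[mu]_x ((w (x + k)%R - w x) ^+ 2)%:E <= \int[mu]_x ((dirgrad G k x) ^+ 2)%:E)%E.
Proof.
move=> sw sG wG; have sk := sqint_dirgrad k sG.
apply: le_trans (integral_avg_sqr_le k sk).
apply: ge0_ae_le_integral_nonmeas => [x|x|]; try by rewrite lee_fin sqr_ge0.
have := sobolev_increment sw sk (weak_dirderiv_dirgrad k sw sG wG).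
by apply: filterS => x ->.
Qed.

(** The mean minimizes the squared deviation, so v(x) may be replaced by w(x). What remains is the
    increment of w along t k, of squared L2 norm at most t^2 times that of G . k. *)
Lemma deviation_le (w v : V -> R) (G : 'I_d -> V -> R) (k : V) : sqint mu w ->
  (forall i, sqint mu (G i)) -> is_weak_gradient w G ->
  {ae mu, forall x, v x = avg k w x} ->
  (deviation k w v <= \int[mu]_x ((dirgrad G k x) ^+ 2)%:E)%E.
Proof.
move=> sw sG wG vw; have [mw _] := sw.
pose D (p : V * T01) : \bar R := ((slide k w p - w p.1) ^+ 2)%:E.
have mD : measurable_fun [set: V * T01] D.
  apply/measurable_EFinP; apply: measurable_funX; apply: measurable_funB.
    exact: measurable_slide.
  exact: (measurableT_comp mw measurable_fst).
have D0 p : (0 <= D p)%E by rewrite lee_fin sqr_ge0.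
apply: (@le_trans _ _ (\int[mu]_x \int[P]_t D (x, t))%E).
  apply: ge0_ae_le_integral_nonmeas => [x|x|].
  - by apply: integral_ge0 => t _; rewrite lee_fin sqr_ge0.
  - exact: integral_ge0.
  have := ae_sqint_slide k sw; move: vw; apply: filterS2 => x vx sx.
  have scst c := sqintB sx (probability_sqint_cst P c).
  by rewrite /D /= -(ipE (scst (v x))) -(ipE (scst (w x))) lee_fin variance_le.
have -> : (\int[mu]_x \int[P]_t D (x, t) = \int[P]_t \int[mu]_x D (x, t))%E.
  exact: (fubini_tonelli D mD D0).
pose I := (\int[mu]_x ((dirgrad G k x) ^+ 2)%:E)%E.
have I0 : (0 <= I)%E by apply: integral_ge0 => x _; rewrite lee_fin sqr_ge0.
apply: (@le_trans _ _ (\int[P]_t (((t : R) ^+ 2)%:E * I))%E).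
  apply: ge0_ae_le_integral_nonmeas => [t|t|].
  - by apply: integral_ge0.
  - by rewrite mule_ge0 ?lee_fin ?sqr_ge0.
  apply: aeW => t; rewrite /D /slide /=.
  apply: (le_trans (integral_increment_sqr ((t : R) *: k) sw sG wG)).
  under eq_integral do rewrite dirgradZ exprMn EFinM.
  rewrite ge0_integralZl ?lee_fin ?sqr_ge0//.
  - have [ms _] := sqint_dirgrad k sG.
    by apply/measurable_EFinP; exact: measurable_funX.
  - by move=> x _; rewrite lee_fin sqr_ge0.
rewrite ge0_integralZr//; last 2 first.
- by apply/measurable_EFinP; apply: measurable_funX; exact: measurable_id.
- by move=> t _; rewrite lee_fin sqr_ge0.
rewrite -[leRHS]mul1e; apply: lee_wpmul2r => //.
exact: integral_sqr_uniform01.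
Qed.

(** The gradient of grad u . direction z is the Hessian applied to [direction z]. Its product with h
    z is at most h |z| S, where S sums the absolute values of the Hessian entries; A is the squared
    L2 norm of S. *)
Lemma dev_le (u : V -> R) (g : 'I_d -> V -> R) (H : 'I_d -> 'I_d -> V -> R) : sqint mu u ->
  (forall i, sqint mu (g i)) -> (forall i j, sqint mu (H i j)) ->
  is_weak_gradient u g -> (forall i, is_weak_gradient (g i) (H i)) ->
  exists2 A : R, 0 <= A & forall (h : R) (z : V), 0 < h ->
    (dev u g h z <= (h ^+ 2 * enorm z ^+ 2 * A)%:E)%E.
Proof.
move=> su sg sH ug gH.
pose S x := \sum_(i < d) \sum_(j < d) `|H j i x|.
have sS : sqint mu S.
  apply: sqint_sum => i; apply: sqint_sum => j; have [mH oo] := sH j i.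
  split; first exact: measurableT_comp.
  by under eq_integral do rewrite real_normK ?num_real//.
exists (ip mu S S) => [|h z h0]; first exact: ip_ge0.
pose G i x := dirgrad (fun j => H j i) (direction z) x.
have sG i : sqint mu (G i) by apply: sqint_dirgrad => j; exact: sH.
have sw := sqint_dirgrad (direction z) sg.
have wG : is_weak_gradient (dirgrad g (direction z)) G.
  move=> i phi tphi.
  have sp := test_function_sqint (test_function_partial i tphi).
  have sphi := test_function_sqint tphi.
  rewrite ipC [ip mu (G i) phi]ipC /G /dirgrad.
  rewrite ip_sumr//; last by move=> j; exact: sqintZ.
  rewrite ip_sumr//; last by move=> j; exact: sqintZ.
  rewrite -sumrN; apply: eq_bigr => j _.
  by rewrite ipC (ipZl _ (sg j) sp) gH// [in RHS]ipC (ipZl _ (sH j i) sphi) mulrN.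
apply: (le_trans (deviation_le sw sG wG (ae_diffquot_avg z su sg ug h0))).
have [mS _] := sS.
apply: (@le_trans _ _ (\int[mu]_x ((h ^+ 2 * enorm z ^+ 2) * (S x) ^+ 2)%:E)%E).
  apply: ge0_ae_le_integral_nonmeas => [x|x|].
  - by rewrite lee_fin sqr_ge0.
  - by rewrite lee_fin mulr_ge0 ?sqr_ge0// mulr_ge0 ?sqr_ge0.
  apply: aeW => x; rewrite lee_fin dirgradZ exprMn -mulrA ler_wpM2l ?sqr_ge0// -exprMn.
  have S0 : 0 <= S x by apply: sumr_ge0 => i _; exact: sumr_ge0.
  rewrite -real_normK ?num_real// ler_sqr ?nnegrE ?mulr_ge0 ?enorm_ge0//.
  rewrite (le_trans (ler_norm_sum _ _ _))// /S mulr_sumr; apply: ler_sum => i _.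
  rewrite normrM ler_pM ?coord_le_enorm// (le_trans (ler_norm_sum _ _ _))//.
  by apply: ler_sum => j _; rewrite normrM ler_piMl// direction_coord_le1.
have c0 : 0 <= h ^+ 2 * enorm z ^+ 2 by rewrite mulr_ge0 ?sqr_ge0.
have mS2 : measurable_fun [set: V] (fun x => (S x ^+ 2)%:E : \bar R).
  by apply/measurable_EFinP; exact: measurable_funX.
under eq_integral do rewrite EFinM.
rewrite ge0_integralZl//; last by move=> x _; rewrite lee_fin sqr_ge0.
by rewrite -ipE// -EFinM.
Qed.

End second_derivative_bound.

(** * From small deviation to a bounded functional *)

Section low_levels.
Variables (R : realType).
Local Notation P := (uniform_prob (@ltr01 R)).
Local Notation T01 := (measurableTypeR R).

(** Chebyshev: were q above 5 B on an interval of length 1/4, its integral would be at least 5 B / 4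
    > B. *)
Lemma exists_low_level (q : T01 -> \bar R) (B a : R) : measurable_fun [set: T01] q ->
  (forall t, 0 <= q t)%E -> (\int[P]_t q t <= B%:E)%E -> 0 < B -> 0 <= a -> a + 4^-1 <= 1 ->
  exists t : R, [/\ a <= t, t <= a + 4^-1 & (q t <= (5 * B)%:E)%E].
Proof.
move=> mq q0 qB B0 a0 a1; apply: contrapT => /forallNP H.
pose I : set T01 := `[a, a + 4^-1]%classic.
have mi : measurable I by exact: measurable_itv.
have : ((5 * B)%:E * P I <= B%:E)%E.
  apply: le_trans qB.
  have -> : P I = (\int[P]_t (\1_I t)%:E)%E by rewrite integral_indic// setIT.
  have mI : measurable_fun [set: T01] (fun t => (\1_I t)%:E : \bar R).
    by apply/measurable_EFinP; exact: measurable_indic.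
  rewrite -ge0_integralZl//; last by rewrite lee_fin mulr_ge0// ltW.
  apply: ge0_ae_le_integral_nonmeas => //.
    by move=> t; rewrite mule_ge0 ?lee_fin ?mulr_ge0// ltW.
  apply: aeW => t; rewrite indicE.
  case: (boolP (t \in _)) => [|_]; last by rewrite mule0.
  rewrite inE /I /= in_itv/= => /andP[at1 ta]; rewrite mule1.
  have [//|tq] := leP (5 * B)%:E (q t).
  by exfalso; apply: (H t); split => //; exact: ltW.
have -> : P I = (4^-1)%:E.
  rewrite /uniform_prob integral_uniform_pdf.
  under eq_integral => t.
    rewrite inE/= => -[_]; rewrite in_itv/= => ht; rewrite /uniform_pdf ht subr0 invr1; over.
  rewrite integral_cst/=; last by apply: measurableI => //; exact: measurable_itv.
  rewrite mul1e setIidl; last first.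
    by apply: subset_itv => //; rewrite bnd_simp.
  rewrite lebesgue_measure_itv/= lte_fin ltrDl invr_gt0 ltr0n/=.
  by rewrite -EFinD addrC addKr.
by rewrite -EFinM lee_fin; lra.
Qed.

End low_levels.

Section incremental_quotients.
Variables (R : realType) (d : nat).
Local Notation V := 'rV[R]_d.
Local Notation mu := (lebn R d).
Local Notation P := (uniform_prob (@ltr01 R)).
Local Notation T01 := (measurableTypeR R).

(** The increment quotient between x + t h z and x + s h z, transposed onto the test function; hence
    the shifts are backwards and the limit is minus the derivative along z. *)
Definition testquot (phi : V -> R) (h t s : R) (z x : V) : R :=
  (h * (s - t))^-1 * (phi (x - s *: (h *: z)) - phi (x - t *: (h *: z))).

(** [M] bounds the second derivative of phi along z; one mean value evaluates the quotient, a second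
    one compares the result with the derivative at x. Neither [M] nor the cube depends on h, t and
    s, as is required because the levels will vary with h. *)
Lemma testquot_bound (phi : V -> R^o) (z : V) : test_function phi ->
  exists (M : R) (j : nat), forall h t s, 0 < h -> h <= 1 -> 0 <= t -> t < s -> s <= 1 ->
    forall x, `|testquot phi h t s z x + dirderiv z phi x| <= h * M /\
              (testquot phi h t s z x + dirderiv z phi x != 0 -> cube j x).
Proof.
move=> tphi; have [sphi _] := tphi.
have tD := test_function_dirderiv z tphi; have [sD _] := tD.
have [M [M0 hM]] := test_function_bounded (test_function_dirderiv z tD).
have [j1 hj1] := test_function_support tphi.
have [j2 hj2] := test_function_support tD.
have [j3 hj3] := mem_cube z.
exists M, (j1 + j2 + j3)%N => h t s h0 h1 t0 ts s1 x; split.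
  have hst : 0 < h * (s - t) by rewrite mulr_gt0// subr_gt0.
  have pt (r : R) : x - r *: (h *: z) = - (r * h) *: z + x.
    by rewrite addrC -scaleNr scalerA mulNr.
  have dphi y := smooth_is_derive_dir z y sphi.
  have dD y := smooth_is_derive_dir z y sD.
  have [th thle thE] := mvt_line dphi (- (t * h) *: z + x) (- (h * (s - t))).
  have [th' th'le th'E] := mvt_line dD x (th - t * h).
  have E1 : testquot phi h t s z x = - dirderiv z phi ((th - t * h) *: z + x).
    rewrite /testquot (_ : phi (x - s *: (h *: z)) - phi (x - t *: (h *: z)) =
      - (h * (s - t)) * dirderiv z phi (th *: z + (- (t * h) *: z + x))).
      by rewrite mulNr mulrN mulKf ?gt_eqF// addrA -scalerDl.
    rewrite -thE; congr (phi _ - phi _).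
      by rewrite pt addrA -scalerDl; congr (_ *: _ + _); ring.
    by rewrite pt.
  rewrite E1 addrC -normrN opprB th'E normrM ler_pM//.
  rewrite (le_trans (ler_normB _ _))//.
  rewrite (le_trans (lerD thle (lexx _)))// normrN gtr0_norm//.
  rewrite ger0_norm ?mulr_ge0 ?(ltW h0)//.
  have -> : h * (s - t) + t * h = h * s by ring.
  by rewrite ler_piMr// ltW.
move=> e0; apply/cubeP => i.
have zi : `|z ord0 i| <= j3%:R by move/cubeP: hj3.
have j10 : 0 <= j1%:R :> R by []. have j20 : 0 <= j2%:R :> R by [].
have j30 : 0 <= j3%:R :> R by [].
have shifted r : 0 <= r -> r <= 1 -> phi (x - r *: (h *: z)) != 0 ->
    `|x ord0 i| <= (j1 + j2 + j3)%:R.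
  move=> r0 r1 /hj1 /cubeP /(_ i); rewrite !mxE => hx.
  have rhz : `|r * (h * z ord0 i)| <= j3%:R.
    rewrite !normrM (ger0_norm r0) (gtr0_norm h0) (le_trans _ zi)//.
    by rewrite mulrA ler_piMl// mulr_ile1// ltW.
  rewrite -(subrK (r * (h * z ord0 i)) (x ord0 i)) (le_trans (ler_normD _ _))//.
  by rewrite !natrD; lra.
have [p1|/shifted] := eqVneq (phi (x - s *: (h *: z))) 0; last first.
  by apply => //; rewrite (le_trans t0)// ltW.
have [p2|/shifted] := eqVneq (phi (x - t *: (h *: z))) 0; last first.
  by apply => //; rewrite (le_trans (ltW ts)).
have [p3|/hj2 /cubeP /(_ i) p3] := eqVneq (dirderiv z phi x) 0.
  by move: e0; rewrite /testquot p1 p2 p3 subrr mulr0 addr0 eqxx.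
by rewrite (le_trans p3)// !natrD; lra.
Qed.

(* At two levels t in [0, 1/4] and s in [3/4, 1] of low deviation, the increment
   quotient of w between x + t k and x + s k is bounded in L2; its pairing with
   phi is the pairing of w with a quotient of phi that is close to a derivative. *)
Lemma dev_bound_functional (w v : V -> R) (z : V) (phi : V -> R^o) (h B c M : R) (j : nat) :
  sqint mu w -> measurable_fun [set: V] v -> test_function phi ->
  0 < h -> h <= 1 -> 0 < B ->
  (deviation (h *: z) w v <= (B * h ^+ 2)%:E)%E ->
  (forall t s, 0 <= t -> t < s -> s <= 1 ->
    forall x, `|testquot phi h t s z x + dirderiv z phi x| <= h * M /\
              (testquot phi h t s z x + dirderiv z phi x != 0 -> cube j x)) ->
  - (2 * c * ip mu w (dirderiv z phi)) <= ip mu phi phi + c ^+ 2 * (80 * B) +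
    h * (M ^+ 2 * fine (mu (cube j)) + c ^+ 2 * ip mu w w).
Proof.
move=> sw mv tphi h0 h1 B0 devB tq; have [mw _] := sw.
have sphi := test_function_sqint tphi; have [mphi _] := sphi.
set k := h *: z in devB.
have sws t := sqint_shift ((t : R) *: k) sw.
pose D (p : V * T01) : \bar R := ((slide k w p - v p.1) ^+ 2)%:E.
have mD : measurable_fun [set: V * T01] D.
  apply/measurable_EFinP; apply: measurable_funX; apply: measurable_funB.
    exact: measurable_slide.
  exact: (measurableT_comp mv measurable_fst).
have D0 p : (0 <= D p)%E by rewrite lee_fin sqr_ge0.
pose q (t : T01) := (\int[mu]_x D (x, t))%E.
have mq : measurable_fun [set: T01] q.
  exact: (measurable_fun_fubini_tonelli_G (m1 := mu) D mD D0).
have q0 t : (0 <= q t)%E by exact: integral_ge0.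
have Bh0 : 0 < B * h ^+ 2 by rewrite mulr_gt0// exprn_gt0.
have qB : (\int[P]_t q t <= (B * h ^+ 2)%:E)%E.
  apply: le_trans devB; rewrite le_eqVlt; apply/orP; left; apply/eqP; apply: esym.
  exact: (fubini_tonelli D mD D0).
(* The two levels are at least 1/2 apart, so 1 / (h (s - t)) is at most 2 / h. *)
have [||t [t0 t1 qt]] := exists_low_level (a := 0) mq q0 qB Bh0; [by []|by lra|].
have [||s [s0 s1 qs]] := exists_low_level (a := 1 - 4^-1) mq q0 qB Bh0; [by lra|by lra|].
have ts : t < s by lra.
have s1' : s <= 1 by lra.
have {}tq := tq t s t0 ts s1'.
pose c' := (h * (s - t))^-1.
have hst : 0 < h * (s - t) by rewrite mulr_gt0// subr_gt0.
have c'h : c' ^+ 2 * h ^+ 2 <= 4.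
  rewrite -exprMn /c' invfM mulrAC mulVf ?gt_eqF// mul1r.
  have st : 2^-1 <= s - t by lra.
  have -> : 4 = 2 ^+ 2 :> R by rewrite -natrX.
  rewrite ler_sqr ?nnegrE ?invr_ge0 ?subr_ge0 ?(ltW ts)//.
  by rewrite invf_ple ?posrE ?subr_gt0.
pose a x := c' * (w (x + s *: k) - w (x + t *: k)).
have sa : sqint mu a by apply: sqintZ; apply: sqintB; exact: sws.
(* Both translates are compared with v. At each level the squared distance is at most 5 B h^2, so
   the square of w_s - w_t costs 2 (5 + 5) B h^2, and c'^2 h^2 <= 4 turns this into 80 B. *)
have aa : ip mu a a <= 80 * B.
  rewrite -lee_fin ipE//.
  pose qq x : \bar R := ((slide k w (x, s) - v x) ^+ 2)%:E.
  have mqq r : measurable_fun [set: V] (fun x => D (x, r)).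
    by have := measurableT_comp mD (@measurable_pair2 _ _ V T01 r); exact.
  have c20 : 0 <= 2 * c' ^+ 2 by rewrite mulr_ge0 ?sqr_ge0.
  apply: (@le_trans _ _ (\int[mu]_x ((2 * c' ^+ 2)%:E * (D (x, s) + D (x, t))))%E).
    apply: ge0_ae_le_integral_nonmeas => [x|x|].
    - by rewrite lee_fin sqr_ge0.
    - by apply: mule_ge0; [rewrite lee_fin|exact: adde_ge0].
    apply: aeW => x; rewrite /D /slide /= -EFinD -EFinM lee_fin /a exprMn.
    rewrite [leRHS]mulrAC [leRHS]mulrC ler_wpM2l ?sqr_ge0//.
    move: (w (x + s *: k)) (w (x + t *: k)) (v x) => ws wt vx.
    have := sqr_ge0 (ws - vx + (wt - vx)); nra.
  have mDD : measurable_fun [set: V] (fun x => D (x, s) + D (x, t))%E by exact: emeasurable_funD.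
  have DD0 x : (0 <= D (x, s) + D (x, t))%E by exact: adde_ge0.
  rewrite ge0_integralZl//.
  rewrite ge0_integralD//.
  apply: (@le_trans _ _ ((2 * c' ^+ 2)%:E * ((5 * (B * h ^+ 2))%:E + (5 * (B * h ^+ 2))%:E))%E).
    by rewrite lee_wpmul2l ?lee_fin// leeD.
  rewrite -EFinD -EFinM lee_fin.
  have -> : 2 * c' ^+ 2 * (5 * (B * h ^+ 2) + 5 * (B * h ^+ 2)) = (c' ^+ 2 * h ^+ 2) * (20 * B) by ring.
  have -> : 80 * B = 4 * (20 * B) by ring.
  by rewrite ler_wpM2r// mulr_ge0// ltW.
have sphis r := sqint_shift (- (r *: k)) sphi.
have stq : sqint mu (testquot phi h t s z) by apply: sqintZ; apply: sqintB; exact: sphis.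
have sD := test_function_sqint (test_function_dirderiv z tphi).
have aphi : ip mu phi a = ip mu w (testquot phi h t s z).
  rewrite ipC (ipZl c' (sqintB (sws s) (sws t)) sphi) (ipBl (sws s) (sws t) sphi).
  rewrite !ip_shift// [RHS]ipC (ipZl c' (sqintB (sphis s) (sphis t)) sw).
  by rewrite (ipBl (sphis s) (sphis t) sw) [ip mu w _]ipC [X in _ - X]ipC.
(* The error of the transposed quotient is at most h M in absolute value and vanishes off the cube,
   so [e / h] is bounded in L2 independently of h. *)
pose e x := testquot phi h t s z x + dirderiv z phi x.
have se : sqint mu e by exact: sqintD.
have ee : ip mu (fun x => h^-1 * e x) (fun x => h^-1 * e x) <= M ^+ 2 * fine (mu (cube j)).
  have she := sqintZ h^-1 se.
  have mcube : measurable (cube j : set V) by exact: measurable_rV_box.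
  have mi : measurable_fun [set: V] (fun x => (\1_(cube j) x : R)%:E).
    by apply/measurable_EFinP; exact: measurable_indic.
  rewrite -lee_fin ipE// EFinM fineK; last first.
    by rewrite ge0_fin_numE// cube_lty.
  apply: (@le_trans _ _ (\int[mu]_x ((M ^+ 2)%:E * (\1_(cube j) x : R)%:E))%E).
    apply: ge0_ae_le_integral_nonmeas => [x|x|].
    - by rewrite lee_fin sqr_ge0.
    - by rewrite mule_ge0 ?lee_fin ?sqr_ge0.
    apply: aeW => x; rewrite -EFinM lee_fin; have [eM ex] := tq x.
    have [e0|/ex cx] := eqVneq (e x) 0.
      by rewrite e0 mulr0 expr0n mulr_ge0 ?sqr_ge0.
    rewrite indicE mem_set// mulr1 exprMn -(real_normK (num_real (e x))) -exprMn.
    have M0 : 0 <= h * M by apply: le_trans eM.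
    have {M0} M0 : 0 <= M by move: M0; rewrite pmulr_rge0.
    by rewrite ler_sqr ?nnegrE ?mulr_ge0 ?invr_ge0 ?(ltW h0)// ler_pdivrMl.
  rewrite ge0_integralZl ?lee_fin ?sqr_ge0//.
  by rewrite integral_indic// setIT.
have E1 := ip_AMGM c sphi sa.
(* Estimating [e / h] and multiplying back by h leaves a factor h on the whole error term. *)
have E2 := ip_AMGM (- c) (sqintZ h^-1 se) sw.
rewrite (ipZl _ se sw) (ipDl stq sD sw) in E2.
rewrite aphi in E1; rewrite [ip mu w (dirderiv z phi)]ipC.
rewrite [ip mu w (testquot _ _ _ _ _)]ipC in E1.
move: E1 E2; rewrite sqrrN.
move: (ip mu (testquot phi h t s z) w) (ip mu (dirderiv z phi) w) => X Y E1 E2.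
have E3 : c ^+ 2 * ip mu a a <= c ^+ 2 * (80 * B) by rewrite ler_wpM2l ?sqr_ge0.
have E4 : 2 * (- c * (h^-1 * (X + Y))) <= M ^+ 2 * fine (mu (cube j)) + c ^+ 2 * ip mu w w.
  by apply: (le_trans E2); rewrite lerD2r.
have E5 := ler_wpM2l (ltW h0) E4.
have E6 : h * (2 * (- c * (h^-1 * (X + Y)))) = - (2 * c * (X + Y)).
  by field; rewrite gt_eqF.
by rewrite E6 in E5; lra.
Qed.

End incremental_quotients.

(** * Polarization of the gradient form *)

Section bounded_functionals.
Variables (R : realType) (d : nat).
Local Notation V := 'rV[R]_d.
Local Notation mu := (lebn R d).
Local Notation e_ i := (delta_mx ord0 i : V).
Implicit Type l : (V -> R^o) -> R.

(* Continuity of l for the L2 norm, in a quadratic form that needs neither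
   linearity nor square roots. *)
Definition L2_bounded l := exists A : R, forall (c : R) (phi : V -> R^o),
  test_function phi -> c * l phi <= c ^+ 2 * A + ip mu phi phi.

(** Both bounds are used at 2 c and averaged, so that [ip mu phi phi] keeps the coefficient 1. *)
Lemma L2_boundedD l1 l2 : L2_bounded l1 -> L2_bounded l2 ->
  L2_bounded (fun phi => l1 phi + l2 phi).
Proof.
move=> [A1 h1] [A2 h2]; exists (2 * (A1 + A2)) => c phi tphi.
have := h1 (2 * c) phi tphi; have := h2 (2 * c) phi tphi.
by rewrite !exprMn; lra.
Qed.

Lemma L2_boundedZ a l : L2_bounded l -> L2_bounded (fun phi => a * l phi).
Proof.
move=> [A h]; exists (a ^+ 2 * A) => c phi tphi.
by have := h (c * a) phi tphi; rewrite exprMn !mulrA.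
Qed.

Lemma eq_L2_bounded l1 l2 : (forall phi, test_function phi -> l1 phi = l2 phi) ->
  L2_bounded l1 -> L2_bounded l2.
Proof. by move=> E [A h]; exists A => c phi tphi; rewrite -E// h. Qed.

Variables (u : V -> R) (g : 'I_d -> V -> R).
Hypotheses (su : sqint mu u) (sg : forall i, sqint mu (g i)) (ug : is_weak_gradient u g).

Lemma L2_bounded_representative (i j : 'I_d) :
  L2_bounded (fun phi => ip mu u (partial i (partial j phi))) ->
  exists2 v, sqint mu v & forall phi : V -> R^o, test_function phi ->
    ip mu u (partial i (partial j phi)) = ip mu v phi.
Proof.
move=> [A hA].
have sp (phi : V -> R^o) : test_function phi -> sqint mu (partial i (partial j phi)).
  by move=> tphi; apply: test_function_sqint; do 2 apply: test_function_partial.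
apply: (@riesz_subspace _ _ R mu (fun phi => test_function (phi : V -> R^o))
  (fun phi => ip mu u (partial i (partial j phi))) (4 * A)).
- exact: test_function0.
- by move=> f; exact: test_function_sqint.
- by move=> f k c; exact: test_function_lin.
- move=> f k c tf tk; have [sf _] := tf; have [sk _] := tk.
  have /= -> := partials_lin [:: i; j] c sf sk.
  rewrite ipC (ipDl (sp _ tf) (sqintZ c (sp _ tk)) su) (ipZl c (sp _ tk) su).
  by congr (_ + _ * _); exact: ipC.
(* The Riesz lemma bounds 2 l f, so c = 2 is taken and the constant is 4 A. *)
- move=> f tf; have := hA 2 f tf.
  by rewrite (_ : 2 ^+ 2 = 4 :> R)// -natrX.
Qed.

(** Bilinear in a and b. Its diagonal is what the deviation controls; its entries at basis vectors
    are the pairings of u with second derivatives of phi, up to sign. *)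
Definition grad_form (phi : V -> R^o) (a b : V) : R := ip mu (dirgrad g a) (dirderiv b phi).

Lemma grad_formDl phi a a' b : test_function phi ->
  grad_form phi (a + a') b = grad_form phi a b + grad_form phi a' b.
Proof.
move=> tphi; have sd := test_function_sqint (test_function_dirderiv b tphi).
rewrite /grad_form -(ipDl (sqint_dirgrad a sg) (sqint_dirgrad a' sg) sd).
congr ip; apply/funext => x; rewrite /dirgrad -big_split/=; apply: eq_bigr => i _.
by rewrite mxE mulrDl.
Qed.

Lemma grad_formZl phi c a b : test_function phi ->
  grad_form phi (c *: a) b = c * grad_form phi a b.
Proof.
move=> tphi; have sd := test_function_sqint (test_function_dirderiv b tphi).
rewrite /grad_form -(ipZl c (sqint_dirgrad a sg) sd).
by congr ip; apply/funext => x; rewrite dirgradZ.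
Qed.

Lemma dirderivD (phi : V -> R^o) a b x : dirderiv (a + b) phi x = dirderiv a phi x + dirderiv b phi x.
Proof.
by rewrite /dirderiv -big_split/=; apply: eq_bigr => i _; rewrite mxE mulrDl.
Qed.

Lemma dirderivZ (phi : V -> R^o) c a x : dirderiv (c *: a) phi x = c * dirderiv a phi x.
Proof. by rewrite /dirderiv mulr_sumr; apply: eq_bigr => i _; rewrite mxE mulrA. Qed.

Lemma grad_formDr phi a b b' : test_function phi ->
  grad_form phi a (b + b') = grad_form phi a b + grad_form phi a b'.
Proof.
move=> tphi; have sd z := test_function_sqint (test_function_dirderiv z tphi).
rewrite /grad_form ![ip mu (dirgrad g a) _]ipC -(ipDl (sd b) (sd b') (sqint_dirgrad a sg)).
by congr ip; apply/funext => x; rewrite dirderivD.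
Qed.

Lemma grad_formZr phi c a b : test_function phi ->
  grad_form phi a (c *: b) = c * grad_form phi a b.
Proof.
move=> tphi; have sd z := test_function_sqint (test_function_dirderiv z tphi).
rewrite /grad_form ![ip mu (dirgrad g a) _]ipC -(ipZl c (sd b) (sqint_dirgrad a sg)).
by congr ip; apply/funext => x; rewrite dirderivZ.
Qed.

Lemma sum_delta (i : 'I_d) (y : 'I_d -> R) : \sum_(j < d) (e_ i) ord0 j * y j = y i.
Proof.
rewrite (bigD1 i)//= mxE !eqxx mul1r big1 ?addr0// => j ji.
by rewrite mxE eqxx/= (negbTE ji) mul0r.
Qed.

Lemma grad_form_delta (phi : V -> R^o) (i j : 'I_d) : test_function phi ->
  grad_form phi (e_ i) (e_ j) = - ip mu u (partial i (partial j phi)).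
Proof.
move=> tphi; rewrite ug ?opprK; last exact: test_function_partial.
congr ip; apply/funext => x; first exact: (sum_delta i (g^~ x)).
exact: (sum_delta j (fun k => partial k phi x)).
Qed.

(** The second difference of a quadratic form over a parallelogram leaves only the cross terms of
    its sides, independently of z. *)
Lemma grad_form_parallelogram phi z a b : test_function phi ->
  grad_form phi (z + a + b) (z + a + b) + grad_form phi z z +
    -1 * (grad_form phi (z + a) (z + a) + grad_form phi (z + b) (z + b)) =
  grad_form phi a b + grad_form phi b a.
Proof.
move=> tphi.
have D x y : grad_form phi (x + y) (x + y) =
    grad_form phi x x + grad_form phi x y + (grad_form phi y x + grad_form phi y y).
  by rewrite grad_formDl// !grad_formDr.
rewrite !D grad_formDl// grad_formDr//.
move: (grad_form phi z z) (grad_form phi z a) (grad_form phi z b) (grad_form phi a z)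
  (grad_form phi b z) (grad_form phi a a) (grad_form phi b b) (grad_form phi a b)
  (grad_form phi b a) => x1 x2 x3 x4 x5 x6 x7 x8 x9.
by ring.
Qed.

(** With sides eps e_i and eps e_j the cross terms add up to -2 eps^2 times the pairing of u with
    d_i d_j phi, by symmetry of second derivatives; hence the factor - 1 / (2 eps^2). *)
Lemma L2_bounded_polarization (z : V) (eps : R) (i j : 'I_d) : eps != 0 ->
  (forall y, [\/ y = z, y = z + eps *: e_ i, y = z + eps *: e_ j |
      y = z + eps *: e_ i + eps *: e_ j] -> L2_bounded (fun phi => grad_form phi y y)) ->
  L2_bounded (fun phi => ip mu u (partial i (partial j phi))).
Proof.
move=> eps0 H.
have h1 := H z (Or41 _ _ _ erefl); have h2 := H _ (Or42 _ _ _ erefl).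
have h3 := H _ (Or43 _ _ _ erefl); have h4 := H _ (Or44 _ _ _ erefl).
have := L2_boundedZ (- (2 * eps ^+ 2)^-1) (L2_boundedD (L2_boundedD h4 h1)
  (L2_boundedZ (-1) (L2_boundedD h2 h3))).
apply: eq_L2_bounded => phi tphi.
have Es : ip mu u (partial j (partial i phi)) = ip mu u (partial i (partial j phi)).
  by have [sphi _] := tphi; exact: (congr1 (ip mu u) (smooth_schwarz j i sphi)).
have Eij := grad_form_delta i j tphi.
have Eji := eq_trans (grad_form_delta j i tphi) (congr1 -%R Es).
move: Eij Eji {Es}; generalize (ip mu u (partial i (partial j phi))) => X Eij Eji.
rewrite grad_form_parallelogram// !grad_formZl// !grad_formZr// Eij Eji.
by field.
Qed.

End bounded_functionals.

(** * Good directions in the annulus *)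

Section good_directions.
Variables (R : realType) (d : nat).
Local Notation V := 'rV[R]_d.
Local Notation mu := (lebn R d).
Variables (u : V -> R) (g : 'I_d -> V -> R).
Hypotheses (su : sqint mu u) (sg : forall i, sqint mu (g i)).
Variable h : nat -> R.
Hypotheses (h_gt0 : forall n, 0 < h n) (h_le1 : forall n, h n <= 1) (h_cvg0 : h @ \oo --> (0 : R)).

(** Frequently, not eventually: Fatou controls only a lower limit. The bound on the functional is
    obtained by letting h_n tend to 0 along these n. *)
Definition good_direction (z : V) := exists2 B : R, 0 < B & forall N : nat,
  exists2 n, (N <= n)%N & (dev u g (h n) z <= (B * h n ^+ 2)%:E)%E.

Lemma good_direction_bounded z : good_direction z ->
  L2_bounded (fun phi => grad_form g phi z z).
Proof.
move=> [B B0 hB].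
have mu' : measurable_fun [set: V] u by case: su.
have sw := sqint_dirgrad (direction z) sg.
have mq n : measurable_fun [set: V] (diffquot u (h n) z).
  by have := measurableT_comp (measurable_diffquot (h n) mu') (@measurable_pair1 _ _ V V z); exact.
(* [dev] is built on [direction z] and the form on z; linearity in the first argument restores the
   factor |z|. *)
suff : L2_bounded (fun phi => ip mu (dirgrad g (direction z)) (dirderiv z phi)).
  move=> /(L2_boundedZ (enorm z)); apply: eq_L2_bounded => phi tphi.
  by rewrite -/(grad_form g phi (direction z) z) -grad_formZl// enorm_direction.
(* The estimate is applied at - c / 2, to match 2 c and the sign on its left-hand side, and 80 / 4 =
   20. *)
exists (20 * B) => c phi tphi.
have [M [j tq]] := testquot_bound z tphi.
pose w := dirgrad g (direction z).
pose L := M ^+ 2 * fine (mu (cube j)) + (- c / 2) ^+ 2 * ip mu w w.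
have L0 : 0 <= L.
  by apply: addr_ge0; apply: mulr_ge0; rewrite ?sqr_ge0 ?ip_ge0 ?fine_ge0.
apply/ler_addgt0Pr => e e0.
have L1 : 0 < L + 1 by rewrite ltr_wpDl.
have eL : 0 < e / (L + 1) by rewrite divr_gt0.
have /cvgrPdist_le /(_ _ eL) [N _ hN] := h_cvg0.
have [n Nn devn] := hB N.
have hn : h n <= e / (L + 1).
  by have := hN n Nn; rewrite /= sub0r normrN gtr0_norm.
have := dev_bound_functional (- c / 2) sw (mq n) tphi (h_gt0 n) (h_le1 n) B0 devn
  (fun t s => tq (h n) t s (h_gt0 n) (h_le1 n)).
rewrite -/w -/L => H.
have hL : h n * L <= e.
  rewrite (@le_trans _ _ (e / (L + 1) * L))// ?ler_wpM2r//.
  by rewrite mulrAC ler_pdivrMr// ler_wpM2l ?(ltW e0)// lerDl.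
apply: (@le_trans _ _ (ip mu phi phi + (- c / 2) ^+ 2 * (80 * B) + h n * L)).
  by apply: le_trans H; rewrite le_eqVlt; apply/orP; left; apply/eqP; field.
by apply: (le_trans (lerD (lexx _) hL)); rewrite lerD2r le_eqVlt; apply/orP; left; apply/eqP; field.
Qed.

End good_directions.

Section annulus.
Variables (R : realType) (d : nat).
Local Notation V := 'rV[R]_d.
Local Notation mu := (lebn R d).
Local Notation e_ i := (delta_mx ord0 i : V).

Lemma enorm_le_sum (x : V) : (forall i, 0 <= x ord0 i) -> enorm x <= \sum_(i < d) x ord0 i.
Proof.
move=> x0; have S0 : 0 <= \sum_(i < d) x ord0 i by exact: sumr_ge0.
rewrite -(ger0_norm S0) -sqrtr_sqr ler_wsqrtr// /dotp expr2 mulr_sumr.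
apply: ler_sum => i _; rewrite ler_wpM2r// (bigD1 i)//= lerDl sumr_ge0//.
Qed.

Lemma ae_and4 (A B C D : V -> Prop) :
  {ae mu, forall z, A z} -> {ae mu, forall z, B z} -> {ae mu, forall z, C z} ->
  {ae mu, forall z, D z} -> {ae mu, forall z, [/\ A z, B z, C z & D z]}.
Proof.
move=> aA aB aC aD.
have AB : {ae mu, forall z, A z /\ B z} by move: aA aB; apply: filterS2.
have CD : {ae mu, forall z, C z /\ D z} by move: aC aD; apply: filterS2.
by move: AB CD; apply: filterS2 => z [? ?] [].
Qed.

(** The corner z is sought in a box of side eps with lowest corner rho e_i, where r0 < rho < r1. All
    four vertices then have coordinates between those of rho e_i and the same plus 3 eps: one eps
    for the box and one for each side, which add up when i = j. Their norm is at least the i-th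
    coordinate and at most the sum of coordinates, rho + 3 eps d < r1. The box has positive measure,
    so it contains a point where the four almost-everywhere conditions hold together. *)
Lemma ae_parallelogram_annulus (P : V -> Prop) (r0 r1 : R) (i j : 'I_d) : 0 <= r0 < r1 ->
  {ae mu, forall z, r0 <= enorm z < r1 -> P z} ->
  exists (eps : R) (z : V), 0 < eps /\ forall y,
    [\/ y = z, y = z + eps *: e_ i, y = z + eps *: e_ j | y = z + eps *: e_ i + eps *: e_ j] -> P y.
Proof.
move=> /andP[r00 r01] aP.
pose rho := (r0 + r1) / 2.
have rho0 : r0 < rho by rewrite /rho; lra.
have rho1 : rho < r1 by rewrite /rho; lra.
have d0 : 0 < d%:R :> R by rewrite ltr0n (leq_ltn_trans (leq0n i)).
pose eps := (r1 - rho) / (4 * d%:R).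
have eps0 : 0 < eps by rewrite divr_gt0 ?subr_gt0// mulr_gt0.
have epsd : 3 * eps * d%:R < r1 - rho.
  rewrite (_ : 3 * eps * d%:R = 3 / 4 * (r1 - rho)); last by rewrite /eps; field; rewrite gt_eqF.
  by lra.
pose a : V := rho *: e_ i.
pose b : V := \row_k (a ord0 k + eps).
have aE k : a ord0 k = if k == i then rho else 0.
  by rewrite /a !mxE eqxx/=; case: eqP => _; rewrite ?mulr1 ?mulr0.
have bE k : b ord0 k = a ord0 k + eps by rewrite [LHS]mxE.
have eE (k l : 'I_d) : 0 <= (eps *: e_ l) ord0 k <= eps.
  by rewrite !mxE eqxx/=; case: eqP => _; rewrite ?mulr1 ?mulr0 (ltW eps0) lexx.
have inA (y : V) : (forall k, a ord0 k <= y ord0 k <= a ord0 k + 3 * eps) -> r0 <= enorm y < r1.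
  move=> hy.
  have a0 k : 0 <= a ord0 k.
    by rewrite aE; case: eqP => // _; rewrite (le_trans r00) ?ltW.
  have y0 k : 0 <= y ord0 k by have /andP[h _] := hy k; exact: le_trans h.
  apply/andP; split.
    apply: le_trans (coord_le_enorm y i); rewrite ger0_norm//.
    by have /andP[h _] := hy i; apply: le_trans h; rewrite aE eqxx ltW.
  apply: le_lt_trans (enorm_le_sum y0) _.
  apply: (@le_lt_trans _ _ (\sum_(k < d) (a ord0 k + 3 * eps))).
    by apply: ler_sum => k _; case/andP: (hy k).
  rewrite big_split/= sumr_const card_ord -[_ *+ d]mulr_natr.
  rewrite (bigD1 i)//= big1 ?addr0; last by move=> k ki; rewrite aE (negbTE ki).
  by rewrite aE eqxx; lra.
pose Q y := r0 <= enorm y < r1 -> P y.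
have aQ : {ae mu, forall z : V, [/\ Q z, Q (z + eps *: e_ i), Q (z + eps *: e_ j) &
    Q (z + (eps *: e_ i + eps *: e_ j))]}.
  exact: (ae_and4 aP (ae_shift (eps *: e_ i) aP) (ae_shift (eps *: e_ j) aP)
    (ae_shift (eps *: e_ i + eps *: e_ j) aP)).
have [N [mN N0 subN]] := aQ.
have [z hz Qz] : exists2 z, rV_box a b z & [/\ Q z, Q (z + eps *: e_ i), Q (z + eps *: e_ j) &
    Q (z + (eps *: e_ i + eps *: e_ j))].
  apply: contrapT => H.
  have bN : rV_box a b `<=` N by move=> z bz; apply: subN => /= Qz; apply: H; exists z.
  have : (mu (rV_box a b) <= mu N)%E by apply: le_measure; rewrite ?inE//; exact: measurable_rV_box.
  rewrite N0 lebn_box => [|k]; last by rewrite bE lerDl ltW.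
  rewrite lee_fin leNgt => /negP; apply; apply: prodr_gt0 => k _.
  by rewrite bE addrC addKr.
have zk k : a ord0 k <= z ord0 k <= a ord0 k + eps.
  by have := hz k; rewrite in_itv/= bE.
exists eps, z; split => // y.
case: Qz => Q1 Q2 Q3 Q4.
have addE (x y' : V) k : (x + y') ord0 k = x ord0 k + y' ord0 k by rewrite mxE.
case=> ->; [apply: Q1|apply: Q2|apply: Q3|rewrite -addrA; apply: Q4]; apply: inA => k;
  move: (zk k) (eE k i) (eE k j); rewrite ?addE => /andP[? ?] /andP[? ?] /andP[? ?];
  by apply/andP; split; lra.
Qed.

End annulus.

Section fatou_directions.
Variables (R : realType) (d : nat).
Local Notation V := 'rV[R]_d.
Local Notation mu := (lebn R d).
Variables (u : V -> R) (g : 'I_d -> V -> R) (K : V -> R) (h : nat -> R) (B : R).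
Hypotheses (su : sqint mu u) (sg : forall i, sqint mu (g i)).
Hypotheses (K_ge0 : forall z, 0 <= K z) (mK : measurable_fun [set: V] K).
Hypothesis h_gt0 : forall n, 0 < h n.
Hypothesis hB : forall n, (\int[mu]_z ((K z)%:E * dev u g (h n) z) <= (B * h n ^+ 2)%:E)%E.

(** The functions K dev(h_n, .) / h_n^2 have integrals at most B, so by Fatou their lower limit is
    integrable, hence finite almost everywhere. *)
Lemma ae_good_direction : {ae mu, forall z, 0 < K z -> good_direction u g h z}.
Proof.
pose q n (z : V) : \bar R := ((h n ^- 2)%:E * ((K z)%:E * dev u g (h n) z))%E.
have hi n : 0 <= h n ^- 2 by rewrite invr_ge0 sqr_ge0.
have Kd0 n z : (0 <= (K z)%:E * dev u g (h n) z)%E.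
  by apply: mule_ge0; [rewrite lee_fin|exact: dev_ge0].
have mKd n : measurable_fun [set: V] (fun z => (K z)%:E * dev u g (h n) z)%E.
  by apply: emeasurable_funM; [exact/measurable_EFinP|exact: measurable_dev].
have mq n : measurable_fun [set: V] (q n) by exact: measurable_funeM.
have q0 n z : (0 <= q n z)%E by apply: mule_ge0; [rewrite lee_fin|].
have qB n : (\int[mu]_z q n z <= B%:E)%E.
  rewrite ge0_integralZl ?lee_fin//.
  apply: (@le_trans _ _ ((h n ^- 2)%:E * (B * h n ^+ 2)%:E)%E).
    by apply: lee_wpmul2l; rewrite ?lee_fin.
  by rewrite -EFinM mulrCA mulVf ?mulr1// expf_neq0// gt_eqF.
have mL : measurable_fun [set: V] (fun z => limn_einf (q^~ z)).
  rewrite (_ : (fun z => _) = (fun z => - limn_esup (fun n => - q n z))%E).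
    by apply: measurableT_comp => //; apply: measurable_fun_limn_esup => n; exact: measurableT_comp.
  by apply/funext => z; rewrite -limn_einfN; congr limn_einf; apply/funext => n /=; rewrite oppeK.
have L0 z : (0 <= limn_einf (q^~ z))%E.
  rewrite limn_einf_lim; apply: lime_ge; first exact: is_cvg_einfs.
  by apply: nearW => n; apply: le_ereal_inf_tmp => _ [m _ <-]; exact: q0.
have Loo : (\int[mu]_z limn_einf (q^~ z) < +oo)%E.
  apply: le_lt_trans (fatou mu measurableT mq (fun n z _ => q0 n z)) _.
  apply: (@le_lt_trans _ _ B%:E); last exact: ltry.
  apply: limn_einf_le => n; exact: qB.
have iL : mu.-integrable [set: V] (fun z => limn_einf (q^~ z)).
  apply/integrableP; split => //.
  by under eq_integral do rewrite gee0_abs//.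
have := integrable_ae measurableT iL; apply: filterS => z /(_ I) Lz Kz.
have [r [r0 Lr]] : exists r : R, 0 < r /\ (limn_einf (q^~ z) < r%:E)%E.
  exists (fine (limn_einf (q^~ z)) + 1); rewrite ltr_wpDl ?fine_ge0//; split => //.
  by rewrite -[ltLHS](fineK Lz) lte_fin ltrDl.
(* Wherever K z dev / h_n^2 < r, division by K z gives the bound. *)
exists (r / K z) => [|N]; first exact: divr_gt0.
have [n Nn qn] := limn_einf_lt_frequently Lr N.
exists n => //; move: (ltW qn); rewrite /q.
have := dev_ge0 u g (h n) z; case: (dev u g (h n) z) => [x x0|_|]; last by [].
  rewrite -!EFinM !lee_fin => H.
  rewrite mulrAC ler_pdivlMr// -ler_pdivrMr ?exprn_gt0//.
  by rewrite mulrC [x * _]mulrC.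
(* An infinite deviation would make [q n z] infinite, as K z > 0. *)
have yE (r' : R) : 0 < r' -> (r'%:E * +oo = +oo)%E by move=> ?; rewrite gt0_muley.
by rewrite !yE ?invr_gt0 ?exprn_gt0.
Qed.

End fatou_directions.

(** * Second weak derivatives and the kernel *)

Section second_order.
Variables (R : realType) (d : nat).
Local Notation V := 'rV[R]_d.
Local Notation mu := (lebn R d).
Variables (u u' : V -> R) (g : 'I_d -> V -> R).
Hypotheses (su : sqint mu u') (uu' : {ae mu, forall x, u x = u' x}).
Hypotheses (sg : forall i, sqint mu (g i)) (ug : is_weak_gradient u' g).

(** The definition of g_i is tested with d_j phi, which turns the second weak derivative of u into
    the first one of g_i. *)
Lemma sobolev2_hessian : sobolev 2 u -> exists H : 'I_d -> 'I_d -> V -> R,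
  (forall i j, sqint mu (H i j)) /\ forall i, is_weak_gradient (g i) (H i).
Proof.
move=> [_ hu].
have hH (ij : 'I_d * 'I_d) : exists v : V -> R, sqint mu v /\
    forall phi : V -> R^o, test_function phi ->
    ip mu (g ij.1) (partial ij.2 phi) = - ip mu v phi.
  have [v0 /L2P[v sv vv] wv] := hu [:: ij.1; ij.2] (leqnn _).
  exists v; split => // phi tphi.
  have [w _] := weak_partials_ip [:: ij.1; ij.2] su sv uu' vv.
  have /= := w wv phi tphi; rewrite expr2 mulN1r opprK mul1r => <-.
  have := ug ij.1 (test_function_partial ij.2 tphi).
  by move=> /(congr1 -%R); rewrite opprK.
have [H hH'] := choice hH.
exists (fun i j => H (i, j)); split => [i j|i j phi tphi]; first exact: (hH' (i, j)).1.
exact: (hH' (i, j)).2.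
Qed.

Lemma sobolev2_of_mixed : sobolev 1 u ->
  (forall i j, exists2 v, sqint mu v & forall phi : V -> R^o, test_function phi ->
    ip mu u' (partial i (partial j phi)) = ip mu v phi) -> sobolev 2 u.
Proof.
move=> [Lu hu] hH; split => //.
case => [|i [|j [|//]]] ss; [exact: hu|exact: hu|].
have [v sv hv] := hH i j; exists v; first by apply/L2P; exists v => //; exact: aeW.
have vv : {ae mu, forall x, v x = v x} by exact: aeW.
have [_] := weak_partials_ip [:: i; j] su sv uu' vv; apply; move=> phi tphi; rewrite /= expr2 mulN1r opprK mul1r; exact: hv.
Qed.

End second_order.

Section kernels.
Variables (R : realType) (d : nat).
Local Notation V := 'rV[R]_d.
Local Notation mu := (lebn R d).
Implicit Type K : V -> R.

(** A Borel version may be negative on a null set; the maximum with 0 repairs this. *)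
Lemma kernel_representative K : (forall z, 0 <= K z) -> lebesgue_measurable K ->
  exists K' : V -> R, [/\ forall z, 0 <= K' z, measurable_fun [set: V] K' &
    {ae mu, forall z, K z = K' z}].
Proof.
move=> K0 [K1 mK1 KK1]; exists (fun z => Num.max (K1 z) 0); split.
- by move=> z; rewrite le_max lexx orbT.
- exact: measurable_maxr.
- by apply: filterS KK1 => z; move=> /(_ I) E; rewrite -E max_l.
Qed.

Lemma kernel_moments K K' : (forall z, 0 <= K z) -> (forall z, 0 <= K' z) ->
  measurable_fun [set: V] K' -> {ae mu, forall z, K z = K' z} ->
  (\int[mu]_z (K z * (1 + enorm z ^+ 2))%:E < +oo)%E ->
  (\int[mu]_z (K' z)%:E < +oo)%E /\ (\int[mu]_z (K' z * enorm z ^+ 2)%:E < +oo)%E.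
Proof.
move=> K0 K'0 mK' KK'.
have mE : measurable_fun [set: V] (fun z : V => enorm z ^+ 2).
  by apply: measurable_funX; exact: measurable_enorm.
have -> : (\int[mu]_z (K z * (1 + enorm z ^+ 2))%:E =
    \int[mu]_z (K' z * (1 + enorm z ^+ 2))%:E)%E.
  apply: ae_eq_integral_nonmeas; apply: filterS KK' => z ->//.
move=> Koo.
have mI : measurable_fun [set: V] (fun z => (K' z * (1 + enorm z ^+ 2))%:E).
  apply/measurable_EFinP; apply: measurable_funM => //; exact: measurable_funD.
split; apply: le_lt_trans Koo; apply: ge0_le_integral => //.
- by move=> z _; rewrite lee_fin.
- exact/measurable_EFinP.
- by move=> z _; rewrite lee_fin ler_peMr// lerDl sqr_ge0.
- by move=> z _; rewrite lee_fin mulr_ge0 ?sqr_ge0.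
- by apply/measurable_EFinP; exact: measurable_funM.
- by move=> z _; rewrite lee_fin ler_wpM2l// lerDr.
Qed.

Lemma kernel_pos_annulus K K' (r0 r1 : R) : {ae mu, forall z, K z = K' z} ->
  (0 < ess_inf mu (fun z => if (r0 <= enorm z < r1)%R then (K z)%:E else +oo))%E ->
  {ae mu, forall z, r0 <= enorm z < r1 -> 0 < K' z}.
Proof.
move=> KK' pos; have := ess_inf_le mu (fun z => if (r0 <= enorm z < r1)%R then (K z)%:E else +oo%E).
move: KK'; apply: filterS2 => z <- H hz.
by have := lt_le_trans pos H; rewrite hz lte_fin.
Qed.

Lemma sigma_const_le1 n : (2 <= n)%N -> sigma_const R n <= 1.
Proof.
rewrite /sigma_const; case: eqP => // _ n2; rewrite ler_pdivrMr ?ltr0n ?mul1r ?ler_nat.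
  by case: n n2 => [|[|n]] //= _.
by case: n n2 => [|[|n]].
Qed.

End kernels.

Section kernel_deviation.
Variables (R : realType) (d : nat).
Local Notation V := 'rV[R]_d.
Local Notation mu := (lebn R d).
Variables (K : V -> R) (u : V -> R) (g : 'I_d -> V -> R).
Hypotheses (K_ge0 : forall z, 0 <= K z) (mK : measurable_fun [set: V] K).
Hypotheses (su : sqint mu u) (sg : forall i, sqint mu (g i)) (ug : is_weak_gradient u g).

Lemma kernel_deviation_le (H : 'I_d -> 'I_d -> V -> R) :
  (\int[mu]_z (K z * enorm z ^+ 2)%:E < +oo)%E ->
  (forall i j, sqint mu (H i j)) -> (forall i, is_weak_gradient (g i) (H i)) ->
  exists2 A : R, 0 <= A & forall h : R, 0 < h ->
    (\int[mu]_z ((K z)%:E * dev u g h z) <= (A * h ^+ 2)%:E)%E.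
Proof.
move=> Koo sH gH; have [A A0 hA] := dev_le su sg sH ug gH.
pose k := fine (\int[mu]_z (K z * enorm z ^+ 2)%:E).
have I0 : (0 <= \int[mu]_z (K z * enorm z ^+ 2)%:E)%E.
  by apply: integral_ge0 => z _; rewrite lee_fin mulr_ge0 ?sqr_ge0.
have k0 : 0 <= k by exact: fine_ge0.
have kE : (\int[mu]_z (K z * enorm z ^+ 2)%:E = k%:E)%E by rewrite fineK// ge0_fin_numE.
have mE : measurable_fun [set: V] (fun z : V => enorm z ^+ 2).
  by apply: measurable_funX; exact: measurable_enorm.
have mKE : measurable_fun [set: V] (fun z : V => (K z * enorm z ^+ 2)%:E).
  by apply/measurable_EFinP; exact: measurable_funM.
exists (A * k) => [|h h0]; first exact: mulr_ge0.
have Ah0 : 0 <= A * h ^+ 2 by rewrite mulr_ge0 ?sqr_ge0.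
apply: (@le_trans _ _ (\int[mu]_z ((A * h ^+ 2)%:E * (K z * enorm z ^+ 2)%:E))%E).
  apply: ge0_le_integral => //.
  - by move=> z _; apply: mule_ge0; [rewrite lee_fin|exact: dev_ge0].
  - by apply: emeasurable_funM; [exact/measurable_EFinP|exact: measurable_dev].
  - exact: measurable_funeM.
  - move=> z _; apply: (@le_trans _ _ ((K z)%:E * (h ^+ 2 * enorm z ^+ 2 * A)%:E)%E).
      by apply: lee_wpmul2l; [rewrite lee_fin|exact: hA].
    by rewrite -!EFinM lee_fin le_eqVlt; apply/orP; left; apply/eqP; ring.
rewrite ge0_integralZl//; first by rewrite kE -EFinM mulrAC.
by move=> z _; rewrite lee_fin mulr_ge0 ?sqr_ge0.
Qed.

Lemma mixed_of_kernel_deviation (h : nat -> R) (B r0 r1 : R) :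
  (forall n, 0 < h n) -> (forall n, h n <= 1) -> h @ \oo --> (0 : R) -> 0 <= r0 < r1 ->
  {ae mu, forall z, r0 <= enorm z < r1 -> 0 < K z} ->
  (forall n, (\int[mu]_z ((K z)%:E * dev u g (h n) z) <= (B * h n ^+ 2)%:E)%E) ->
  forall i j, exists2 v, sqint mu v & forall phi : V -> R^o, test_function phi ->
    ip mu u (partial i (partial j phi)) = ip mu v phi.
Proof.
move=> h0 h1 hc r01 aK hB i j.
have aG : {ae mu, forall z, r0 <= enorm z < r1 -> good_direction u g h z}.
  have := ae_good_direction su sg K_ge0 mK h0 hB; move: aK.
  by apply: filterS2 => z Kz Gz hz; exact: Gz (Kz hz).
have [eps [z [eps0 Hz]]] := ae_parallelogram_annulus i j r01 aG.
apply: (L2_bounded_representative su).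
apply: (@L2_bounded_polarization _ _ _ g sg ug z eps); first by rewrite gt_eqF.
by move=> y /Hz Gy; exact: (good_direction_bounded su sg h0 h1 hc Gy).
Qed.

End kernel_deviation.

Section null_sequence.
Variables (R : realType) (a : R).
Hypothesis a0 : 0 < a.

(** The minimum keeps the steps below both a and 1, and [n.+2] makes this strict already at n =
    0. *)
Definition null_seq (n : nat) : R := Num.min a 1 / n.+2%:R.

Let m0 : 0 < Num.min a 1. Proof. by rewrite lt_min a0 ltr01. Qed.

Lemma null_seq_gt0 n : 0 < null_seq n.
Proof. by rewrite divr_gt0. Qed.

Lemma null_seq_lt n : null_seq n < Num.min a 1.
Proof. by rewrite ltr_pdivrMr// ltr_pMr// ltr1n. Qed.

Lemma null_seq_cvg0 : null_seq @ \oo --> (0 : R).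
Proof.
rewrite -[0 in X in _ --> X](mulr0 (Num.min a 1)).
by apply: cvgMr; have := @cvg_harmonic R; rewrite -(cvg_shiftS (@harmonic R)).
Qed.

End null_sequence.

(** * The equivalence *)

Theorem mainTheorem3 (R : realType) (d : nat) (hd : (2 <= d)%N)
    (Omega : set 'rV[R]_d) (K : 'rV[R]_d -> R) (f : R -> R)
    (hOmega : bounded_lipschitz_domain Omega)
    (hK : admissible_kernel K)
    (hf : admissible_integrand f)
    (hf2 : bounded_second_derivative f)
    (u : 'rV[R]_d -> R) (hu : X_space Omega u) :
  sobolev 2 u <->
  exists M hbar : R, [/\ 0 < M, 0 < hbar &
    forall h : R, 0 < h < hbar -> (rate_functional K f h u <= M%:E)%E].
Proof.
have [hu1 _] := hu.
have [f_ge0 _ f0 _ _] := hf.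
have [gam [C [F' [gam0 C0 F'0 cF FE]]]] := admissible_integrand_bounds hf hf2.
have [K0 mK _ Kmom [r0 [r1 [r00 r10 r01 Kpos]]]] := hK.
have [K' [K'0 mK' KK']] := kernel_representative K0 mK.
have [Koo K2oo] := kernel_moments K0 K'0 mK' KK' Kmom.
have [u' [g [su uu' sg gE ug]]] := sobolev1_representatives hu1.
pose F (t : R) := f `|t|.
have mF : measurable_fun [set: R] F by exact: continuous_measurable_fun.
have F_ge0 t : 0 <= F t by exact: f_ge0.
have F0 : F 0 = 0 by rewrite /F normr0.
have mu' : measurable_fun [set: 'rV[R]_d] u' by case: su.
have mg i : measurable_fun [set: 'rV[R]_d] (g i) by case: (sg i).
have gam_ge0 := ltW gam0.
have sw := energy_sandwich F_ge0 F'0 F0 gam_ge0 C0 mF FE K'0 mK' su sg ug.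
have FhE h := @F_nonlocalE _ _ K K' f u u' K0 K'0 mK' KK' mu' uu' f_ge0 mF h.
have F0E := F_localE K0 K'0 mK' KK' f_ge0 mF mg gE.
have F0oo := local_energy_lty F_ge0 F'0 F0 C0 FE K'0 mK' sg Koo.
pose devK h := (\int[lebn R d]_z ((K' z)%:E * dev u' g h z))%E.
have devK0 h : (0 <= devK h)%E.
  by apply: integral_ge0 => z _; apply: mule_ge0; [rewrite lee_fin|exact: dev_ge0].
have [a Ea] : exists a : R, F_local K f u = a%:E.
  exists (fine (F_local K f u)); rewrite fineK// F0E ge0_fin_numE//.
  apply: integral_ge0 => z _; apply: mule_ge0; first by rewrite lee_fin.
  by apply: integral_ge0 => x _; rewrite lee_fin; exact: F_ge0.
(* The lower half of the sandwich bounds the nonlocal energy by the local one, so it is a real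
   number too. *)
have key h : 0 < h -> exists b : R, [/\ F_nonlocal K f h u = b%:E,
    (b%:E + (gam / 2)%:E * devK h <= a%:E)%E & (a%:E <= b%:E + (C / 2)%:E * devK h)%E].
  move=> h0; have := sw h h0; rewrite -/(devK h) -(FhE h h0) -F0E Ea => -[lo hi].
  have Fh0 : (0 <= F_nonlocal K f h u)%E.
    rewrite FhE//; apply: integral_ge0 => z _; apply: mule_ge0; first by rewrite lee_fin.
    by apply: integral_ge0 => x _; rewrite lee_fin; exact: F_ge0.
  have cd0 : (0 <= (gam / 2)%:E * devK h)%E.
    by apply: mule_ge0 => //; rewrite lee_fin divr_ge0.
  have Fhoo : (F_nonlocal K f h u < +oo)%E.
    by apply: le_lt_trans (leeDl _ cd0) (le_lt_trans lo _); exact: ltry.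
  by exists (fine (F_nonlocal K f h u)); rewrite fineK ?ge0_fin_numE.
split => [hu2|[M [hbar [M0 hbar0 hM]]]].
  have [H [sH gH]] := sobolev2_hessian su uu' ug hu2.
  have [A A0 hA] := kernel_deviation_le K'0 mK' su sg ug K2oo sH gH.
  (* The bound C A / 2 holds for every h > 0; the added 1 only makes M positive. *)
  exists (C / 2 * A + 1), 1; split => //; first by rewrite ltr_wpDl ?mulr_ge0 ?divr_ge0.
  move=> h /andP[h0 _]; have [b [Eb _ hi]] := key h h0.
  have ab : a <= b + C / 2 * (A * h ^+ 2).
    rewrite -lee_fin (le_trans hi)// EFinD leeD2l// [leRHS]EFinM lee_wpmul2l ?lee_fin ?divr_ge0//.
    exact: hA.
  rewrite /rate_functional Ea Eb -EFinB -EFinM lee_fin ler_pdivrMr ?exprn_gt0//.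
  by have := sqr_ge0 h; lra.
(* The constant sigma is at most 1, so the annulus is nondegenerate. *)
have r0r1 : 0 <= r0 < r1.
  by rewrite r00 (lt_le_trans r01)// ler_piMl ?sigma_const_le1// ltW.
apply: (sobolev2_of_mixed su uu' hu1).
(* The constant 2 M / gamma comes from gamma / 2 times the weighted deviation being at most F_0 -
   F_h <= M h^2. *)
apply: (@mixed_of_kernel_deviation _ _ K' u' g K'0 mK' su sg ug (null_seq hbar)
  (2 * M / gam) r0 r1) => //.
- exact: null_seq_gt0.
- by move=> n; apply: ltW; apply: lt_le_trans (null_seq_lt hbar0 n) _; rewrite ge_min lexx orbT.
- exact: null_seq_cvg0.
- exact: kernel_pos_annulus KK' Kpos.
move=> n; set h := null_seq hbar n.
have h0 : 0 < h by exact: null_seq_gt0.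
have hh : h < hbar by apply: lt_le_trans (null_seq_lt hbar0 n) _; rewrite ge_min lexx.
have [b [Eb lo _]] := key h h0.
have := hM h; rewrite h0 hh => /(_ isT).
rewrite /rate_functional Ea Eb -EFinB -EFinM lee_fin ler_pdivrMr ?exprn_gt0// => ab.
have {}lo : ((gam / 2)%:E * devK h <= (a - b)%:E)%E by rewrite EFinB leeBrDl.
(* As gamma > 0, an infinite deviation would make the difference of the energies infinite. *)
have doo : devK h \is a fin_num.
  rewrite ge0_fin_numE//; have := devK0 h; move: lo; case: (devK h) => [r _ _|lo _|]//.
    exact: ltry.
  by move: lo; rewrite gt0_muley// lte_fin divr_gt0.
rewrite -/(devK h); rewrite -(fineK doo) -EFinM !lee_fin in lo *.
by rewrite mulrAC ler_pdivlMr//; lra.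
Qed.
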